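(* There exists a (nonzero) family of linear operators $\mathcal{R}_3=\mathcal{R}_3(u_1,u_2,u_3|v_3)$ on $\mathbb{C}[x_1,y_1,z_1,x_2,y_2,z_2]$, depending only on $u_1,u_2,u_3,v_3$ (not on $v_1,v_2$) and satisfying $$\mathcal{R}_3(u_1,u_2,u_3|v_3)=\mathcal{R}_3(u_1+\lambda,u_2+\lambda,u_3+\lambda|v_3+\lambda)\quad\text{for all }\lambda\in\mathbb{C},$$ which solves, for all generic parameters, the defining equations $$\mathcal{R}_{3}\,\mathrm{L}_{1}(u_1,u_2,u_3)\,\mathrm{L}_{2}(v_1,v_2,v_3)=\mathrm{L}_{1}(u_1,u_2,v_3)\,\mathrm{L}_{2}(v_1,v_2,u_3)\,\mathcal{R}_{3}.$$ These requirements fix $\mathcal{R}_3$ up to an overall normalization constant (a scalar, which may depend on the parameters): up to such a factor, $$\mathcal{R}_3\sim S_3^{-1}\cdot\frac{\Gamma(z_1\partial_{z_1}+u_2-v_3+1)}{\Gamma(z_1\partial_{z_1}+1)}\cdot e^{\frac{y_1}{z_1}\partial_{x_1}}\cdot\frac{\Gamma(y_1\partial_{y_1}+u_1-v_3+1)}{\Gamma(y_1\partial_{y_1}+u_1-u_3+1)}\cdot e^{-\frac{y_1}{z_1}\partial_{x_1}}\cdot\frac{\Gamma(z_1\partial_{z_1}+1)}{\Gamma(z_1\partial_{z_1}+u_2-u_3+1)}\cdot S_3,$$ where $$S_3=e^{(y_2-x_1z_2)\partial_{y_1}}\cdot e^{z_2\partial_{z_1}}\cdot e^{x_2\partial_{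x_1}}.$$
   Context: For complex parameters $a_1,a_2,a_3$ and $k\in\{1,2\}$ the $s\ell(3)$ Lax operator is the $3\times3$ matrix of differential operators $$\mathrm{L}_k(a_1,a_2,a_3)=\begin{pmatrix}1&0&0\\ -x_k&1&0\\ -y_k&-z_k&1\end{pmatrix}\begin{pmatrix}a_1&\partial_{x_k}-z_k\partial_{y_k}&\partial_{y_k}\\ 0&a_2&\partial_{z_k}\\ 0&0&a_3\end{pmatrix}\begin{pmatrix}1&0&0\\ x_k&1&0\\ y_k+x_kz_k&z_k&1\end{pmatrix}$$ acting on $\mathbb{C}[x_1,y_1,z_1,x_2,y_2,z_2]$, where products are matrix products with (noncommuting) operator entries. An operator placed to the left or right of a matrix composes with each entry from that side. Parameters are complex and generic: no pairwise difference of $u_1,u_2,u_3,v_1,v_2,v_3$ is an integer. Conventions for the explicit formula: exponentials act by their (locally finite) power series, so $S_3$ is an invertible operator on the polynomial ring. $f(z_1\partial_{z_1})$ and $f(y_1\partial_{y_1})$ act on a monomial by multiplication by $f$ of its exponent in $z_1$, respectively $y_1$. The factors involving $y_1/z_1$ take values in polynomials with negative powers of $z_1$ allowed; $1/\Gamma$ is taken to be $0$ at the nonpositive integers, so the factor $\Gamma(z_1\partial_{z_1}+u_2-v_3+1)/\Gamma(z_1\partial_{z_1}+1)$ annihilates monomials with negative powers of $z_1$. *)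

(* Defs.v *)
From HB Require Import structures.
From mathcomp Require Import all_boot all_order all_algebra.
From mathcomp Require Import complex freeg mpoly.
From mathcomp Require Import boolp classical_sets functions reals topology.
From mathcomp Require Import normedtype sequences exp trigo.

Set Implicit Arguments.
Unset Strict Implicit.
Unset Printing Implicit Defensive.

Import Order.TTheory GRing.Theory Num.Theory.
Import numFieldNormedType.Exports.

Local Open Scope ring_scope.
Local Open Scope complex_scope.

(* MathComp world; the complex numbers are R[i] for R : realType. *)

Section Gamma.
Variable R : realType.

(* n ^ z = exp (z ln n), for n > 0 *)
Definition natcpow (n : nat) (z : R[i]) : R[i] :=
  (expR (complex.Re z * ln n%:R))%:C *
  (cos (complex.Im z * ln n%:R) +i* sin (complex.Im z * ln n%:R)).

Definition rgamma_seq (z : R[i]) (n : nat) : R[i] :=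
  (\prod_(k < n.+1) (z + k%:R)) / (n`!%:R * natcpow n z).

(* Gauss' product 1/Gamma(z) = lim_n z (z + 1) ... (z + n) / (n! n^z); the
   limit is taken on real and imaginary parts. It is 0 at 0, -1, -2, ... *)
Definition rgamma (z : R[i]) : R[i] :=
  lim ((fun n => complex.Re (rgamma_seq z n)) @ \oo)%classic +i*
  lim ((fun n => complex.Im (rgamma_seq z n)) @ \oo)%classic.

(* The value at the poles is the dummy 0^-1 = 0. *)
Definition gamma (z : R[i]) : R[i] := (rgamma z)^-1.

End Gamma.

Section LocallyFiniteExp.
Variables (K : fieldType) (V : lmodType K).

(* Least n with D^n v = 0, for D locally nilpotent at v (dummy 0 otherwise). *)
Definition nilindex (D : V -> V) (v : V) : nat :=
  if pselect (exists n, iter n D v == 0) is left h then ex_minn h else 0%N.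

(* e^D v; for D linear and D^n v = 0 the omitted terms of the power series
   all vanish. *)
Definition expop (D : V -> V) (v : V) : V :=
  \sum_(k < nilindex D v) (k`!%:R)^-1 *: iter k D v.

End LocallyFiniteExp.

(* C[x1, y1, z1, x2, y2, z2] *)
Notation pols R := {mpoly R[i][6]}.

(* Exponents of x1, y1, z1, x2, y2, z2, that of z1 being any integer. *)
Notation lexpnt := (nat * nat * int * nat * nat * nat)%type.

(* C[x1, y1, z1, z1^-1, x2, y2, z2], as a vector space *)
Notation laurent R := {freeg lexpnt / R[i]}.

Section Lax.
Variable R : realType.

Local Notation pols := (pols R).

Definition x1 : 'I_6 := @Ordinal 6 0 isT.
Definition y1 : 'I_6 := @Ordinal 6 1 isT.
Definition z1 : 'I_6 := @Ordinal 6 2 isT.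
Definition x2 : 'I_6 := @Ordinal 6 3 isT.
Definition y2 : 'I_6 := @Ordinal 6 4 isT.
Definition z2 : 'I_6 := @Ordinal 6 5 isT.

Definition mulop (q : pols) : pols -> pols := fun p => q * p.

Definition opmx (s : seq (seq (pols -> pols))) : 'M[pols -> pols]_3 :=
  \matrix_(i < 3, j < 3) nth (fun=> 0) (nth [::] s i) j.

Definition opmul (A B : 'M[pols -> pols]_3) : 'M[pols -> pols]_3 :=
  \matrix_(i, j) fun p => \sum_k A i k (B k j p).

Definition lax (x y z : 'I_6) (a1 a2 a3 : R[i]) : 'M[pols -> pols]_3 :=
  opmul (opmul
    (opmx [:: [:: mulop 1;       mulop 0;       mulop 0];
              [:: mulop (- 'X_x); mulop 1;       mulop 0];
              [:: mulop (- 'X_y); mulop (- 'X_z); mulop 1]])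
    (opmx [:: [:: mulop a1%:MP;
                  (fun p => p^`M(x) - 'X_z * p^`M(y));
                  (fun p => p^`M(y))];
              [:: mulop 0; mulop a2%:MP; (fun p => p^`M(z))];
              [:: mulop 0; mulop 0;      mulop a3%:MP]]))
    (opmx [:: [:: mulop 1;                   mulop 0;    mulop 0];
              [:: mulop 'X_x;                mulop 1;    mulop 0];
              [:: mulop ('X_y + 'X_x * 'X_z); mulop 'X_z; mulop 1]]).

Definition lax1 := lax x1 y1 z1.
Definition lax2 := lax x2 y2 z2.

(* No difference of two entries (at distinct positions) is an integer. *)
Definition generic (s : seq R[i]) : Prop :=
  forall i j : nat, (i < j < size s)%N -> forall n : int, s`_i - s`_j <> n%:~R.

Definition opfamily := R[i] -> R[i] -> R[i] -> R[i] -> {linear pols -> pols}.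

Definition shift_invariant (R3 : opfamily) : Prop :=
  forall u1 u2 u3 v3 : R[i], generic [:: u1; u2; u3; v3] ->
  forall l : R[i],
  R3 u1 u2 u3 v3 =1 R3 (u1 + l) (u2 + l) (u3 + l) (v3 + l).

Definition defining_equations (R3 : opfamily) : Prop :=
  forall u1 u2 u3 v1 v2 v3 : R[i], generic [:: u1; u2; u3; v1; v2; v3] ->
  forall i j : 'I_3,
  R3 u1 u2 u3 v3 \o opmul (lax1 u1 u2 u3) (lax2 v1 v2 v3) i j =1
  opmul (lax1 u1 u2 v3) (lax2 v1 v2 u3) i j \o R3 u1 u2 u3 v3.

End Lax.

Section Formula.
Variable R : realType.

Local Notation pols := (pols R).
Local Notation laurent := (laurent R).

Definition S3 (p : pols) : pols :=
  expop (fun q : pols => ('X_y2 - 'X_x1 * 'X_z2) * q^`M(y1))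
    (expop (fun q : pols => 'X_z2 * q^`M(z1))
      (expop (fun q : pols => 'X_x2 * q^`M(x1)) p)).

Definition S3inv : pols -> pols := 'pinv_(fun=> 0) setT S3.

Definition to_laurent (p : pols) : laurent :=
  \sum_(m <- msupp p)
    << p@_m *g ((m x1, m y1, (m z1)%:Z, m x2, m y2, m z2) : lexpnt) >>.

(* Left inverse of to_laurent, dropping negative powers of z1. *)
Definition of_laurent : laurent -> pols :=
  fglift (fun k : lexpnt =>
    let: (a, b, c, d, e, f) := k in
    if c is Posz c' then
      'X_x1 ^+ a * 'X_y1 ^+ b * 'X_z1 ^+ c' *
      'X_x2 ^+ d * 'X_y2 ^+ e * 'X_z2 ^+ f
    else 0).

(* (y1 / z1) d/dx1 *)
Definition yz_dx : laurent -> laurent :=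
  fglift (fun k : lexpnt =>
    let: (a, b, c, d, e, f) := k in
    << a%:R *g ((a.-1, b.+1, c - 1, d, e, f) : lexpnt) >> : laurent).

(* h (z1 d/dz1) and h (y1 d/dy1) *)
Definition fun_zdz (h : R[i] -> R[i]) : laurent -> laurent :=
  fglift (fun k : lexpnt =>
    let: (a, b, c, d, e, f) := k in << h c%:~R *g k >> : laurent).
Definition fun_ydy (h : R[i] -> R[i]) : laurent -> laurent :=
  fglift (fun k : lexpnt =>
    let: (a, b, c, d, e, f) := k in << h b%:R *g k >> : laurent).

(* The factors Gamma(.)/Gamma(.) are written with the entire function
   rgamma = 1/Gamma as denominator. *)
Definition R3_formula (u1 u2 u3 v3 : R[i]) (p : pols) : pols :=
  S3inv (of_laurent
    (fun_zdz (fun t => gamma (t + u2 - v3 + 1) * rgamma (t + 1))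
    (expop yz_dx
    (fun_ydy (fun t => gamma (t + u1 - v3 + 1) * rgamma (t + u1 - u3 + 1))
    (expop (fun q => - yz_dx q)
    (fun_zdz (fun t => gamma (t + 1) * rgamma (t + u2 - u3 + 1))
    (to_laurent (S3 p)))))))).

End Formula.

(* Main.v *)
Require Import Defs.
From HB Require Import structures.
From mathcomp Require Import all_boot all_order all_algebra.
From mathcomp Require Import complex freeg mpoly ring lra.
From mathcomp Require Import boolp classical_sets functions reals topology.
From mathcomp Require Import normedtype sequences derive realfun exp trigo.

Set Implicit Arguments.
Unset Strict Implicit.
Unset Printing Implicit Defensive.

Import Order.TTheory GRing.Theory Num.Theory.
Import numFieldNormedType.Exports.
Local Open Scope ring_scope.

(** Write M for the lower unitriangular matrix with entries x, z and y + x z.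
    The Lax operator is M^-1 D M, where D is upper triangular with diagonal
    (a1, a2, a3) and its off-diagonal entries are the vector fields that
    generate left multiplication on matrices M.  The operator S3 is the
    substitution M_1 -> M_1 M_2, that is (x1, y1, z1) ->
    (x1 + x2, y1 + y2 - x1 z2, z1 + z2), so it commutes with the vector fields
    of D_1, and
      S3 L_1(u) L_2(v) = M_2^-1 L_1(u) F(v) M_2 S3,
    where F(v) is again upper triangular, of diagonal v ([translation_lax],
    [S3_lax]).  Hence R solves the defining equations if and only if
    T = S3 R S3^-1 intertwines the matrices M_2^-1 L_1 F M_2 before and after
    the exchange of u3 and v3.

    Existence.  If T commutes with the second set of variables, then only the
    entries of L_1 and of the third column of L_1 F have to be intertwined.
    They are generated, through commutators, by the weights
    x d/dx + y d/dy and y d/dy + z d/dz, by d/dx, and by three operators E, B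
    and W, of which B depends on u3 and W on v3 ([intertwine_lax_conj]).
    In the formula all factors preserve the span of the monomials with
    negative powers of z_1, so the middle part T of the formula acts on the
    quotient by this span, which is the polynomial ring with 1 / z replaced by
    the operator [divz] that divides by z and kills the terms free of z
    ([R3_formulaE]).  There T reads Q e^Y H e^-Y A with Y = y (1/z) d/dx: the
    diagonal factor A turns z (z d/dz + u2 - u3 + 1) in B into z (z d/dz + 1),
    conjugation by e^-Y turns E and W into operators in which u3 and v3 occur,
    apart from their sum, only next to y d/dy, and H exchanges u3 and v3 there
    by the functional equation of Gamma; then e^Y and Q undo the first two
    steps, with u3 replaced by v3 ([factored_intertwiner], [middle_intertwiner]).

    Uniqueness.  By shift invariance the parameters may be assumed to be
    nonzero, and then L_1 is injective on columns, because D is triangular.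
    Comparing the equations at (v1, v2), (v1 + 1, v2) and (v1, v2 + 1), which
    all involve the same T, isolates the entries of M_2, so T commutes with
    x2, y2, z2, intertwines E, B and X = [B, E], and T 1 is killed by all
    derivatives, hence constant ([rigid_one]).  A multiple of the solution of
    the formula can be subtracted from T to obtain an operator of the same kind
    that kills 1.  It kills every monomial: E and X increase the degree in
    x and y, B increases the exponent of z, and for generic parameters the
    monomials are combinations of values of these operators on smaller ones
    ([kernel_mon], [rigid_unique]).  The multiple makes sense since T 1 is a
    nonzero constant for the solution of the formula ([middle_one]).

    Of the Gamma function, only the recursion and the fact that 1 / Gamma has no
    zeros besides 0, -1, -2, ... are used ([gammaS], [rgamma_neq0]). *)

(** * The factors of the product of Gauss *)

Section GaussFactor.
Variable R : realType.
Implicit Types x y t h : R.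

(** With z = x + i y, this is the real part of (1 + z t) exp(z ln(1 - t)) for
    h = 0, and its imaginary part for h = - pi / 2: a phase shift exchanges
    the two, so that one computation serves both. *)
Definition gauss_factor x y h t : R := expR (x * ln (1 - t)) *
  ((1 + x * t) * cos (y * ln (1 - t) + h) - y * t * sin (y * ln (1 - t) + h)).

Lemma is_derive_gauss_factor x y h t : t < 1 ->
  is_derive t 1 (gauss_factor x y h) (expR (x * ln (1 - t)) * (t / (1 - t)) *
   ((y ^+ 2 - x - x ^+ 2) * cos (y * ln (1 - t) + h) +
    (2 * x * y + y) * sin (y * ln (1 - t) + h))).
Proof.
move=> t1; have t1_gt0 : 0 < 1 - t by rewrite subr_gt0.
have dL : is_derive t 1 (fun s : R => ln (1 - s)) (- (1 - t)^-1).
  have d1t : is_derive t 1 (fun s : R => 1 - s) (-1).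
    by have := is_deriveB (is_derive_cst (1 : R) t 1) (is_derive_id t 1); rewrite sub0r.
  have := @is_derive1_comp _ (@ln R) (fun s => 1 - s) t _ _
            (is_derive1_ln t1_gt0) d1t.
  by rewrite mulrN1.
have dxL : is_derive t 1 (fun s : R => x * ln (1 - s)) (x * - (1 - t)^-1).
  exact: is_deriveZ.
have dyL : is_derive t 1 (fun s : R => y * ln (1 - s) + h) (y * - (1 - t)^-1).
  have := is_deriveD (is_deriveZ y dL) (is_derive_cst h t 1).
  by rewrite addr0.
have dE := @is_derive1_comp _ (@expR R) _ t _ _ (is_derive_expR _) dxL.
have dc := @is_derive1_comp _ (@cos R) _ t _ _ (is_derive_cos _) dyL.
have ds := @is_derive1_comp _ (@sin R) _ t _ _ (is_derive_sin _) dyL.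
have dP : is_derive t 1 (fun s : R => 1 + x * s) x.
  have := is_deriveD (is_derive_cst (1 : R) t 1) (is_deriveZ x (is_derive_id t 1)).
  by rewrite add0r /GRing.scale /= mulr1.
have dQ : is_derive t 1 (fun s : R => y * s) y.
  have := is_deriveZ y (is_derive_id t 1).
  by rewrite /GRing.scale /= mulr1.
have := is_deriveM dE (is_deriveB (is_deriveM dP dc) (is_deriveM dQ ds)).
rewrite /gauss_factor => /is_derive_eq; apply.
rewrite /GRing.scale /=.
rewrite !fctE /=; by field; rewrite gt_eqF.
Qed.

(** The linear terms of 1 + z t and of (1 - t)^z cancel; concretely, the
    derivative above is O(t). *)
Lemma gauss_factor_bound x y h : exists2 D, 0 <= D &
  forall t, 0 < t <= 2^-1 -> `|gauss_factor x y h t - cos h| <= D * t ^+ 2.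
Proof.
pose D := expR `|x| * 2 * (`|y ^+ 2 - x - x ^+ 2| + `|2 * x * y + y|).
have D0 : 0 <= D by rewrite /D !mulr_ge0 ?expR_ge0 ?addr_ge0.
exists D => // t /andP[t0 t2].
have F0 : gauss_factor x y h 0 = cos h.
  by rewrite /gauss_factor subr0 ln1 !mulr0 expR0 mul0r subr0 addr0 !mul1r add0r.
rewrite -F0.
have lt1 s : s <= t -> s < 1.
  by move=> st; apply: (le_lt_trans st); apply: (le_lt_trans t2); rewrite invf_lt1// ltr1n.
pose df s := expR (x * ln (1 - s)) * (s / (1 - s)) *
   ((y ^+ 2 - x - x ^+ 2) * cos (y * ln (1 - s) + h) +
    (2 * x * y + y) * sin (y * ln (1 - s) + h)).
have [s||s] := @MVT R (gauss_factor x y h) df 0 t t0.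
- rewrite in_itv/= => /andP[_ /ltW st].
  exact: (is_derive_gauss_factor x y h (lt1 _ st)).
- apply: derivable_within_continuous => s; rewrite in_itv/= => /andP[_ st].
  by have [] := is_derive_gauss_factor x y h (lt1 _ st).
rewrite in_itv/= => /andP[s0 st] ->; rewrite subr0.
rewrite normrM (gtr0_norm t0) expr2 mulrA.
apply: ler_wpM2r; first exact: ltW.
have s2 : s <= 2^-1 by apply: le_trans t2; apply: ltW.
have s1 : 2^-1 <= 1 - s by lra.
have s1_gt0 : 0 < 1 - s by lra.
have Ls : `|ln (1 - s)| <= 1.
  rewrite ler0_norm; last by apply: ln_le0; lra.
  have -> : - ln (1 - s) = ln ((1 - s)^-1) by rewrite lnV ?posrE.
  rewrite -[leRHS]expRK ler_ln ?posrE ?invr_gt0 ?expR_gt0//.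
  apply: (@le_trans _ _ 2); first by rewrite invf_ple ?posrE.
  by have := expR_ge1Dx (1 : R); apply: le_trans.
have le_E : `|expR (x * ln (1 - s))| <= expR `|x|.
  rewrite ger0_norm ?expR_ge0// ler_expR (le_trans (ler_norm _))// normrM.
  by rewrite ler_piMr.
have le_Q : `|s / (1 - s)| <= 2 * t.
  rewrite gtr0_norm ?divr_gt0// ler_pdivrMr//.
  have : t * 2^-1 <= t * (1 - s) by rewrite ler_wpM2l// ltW.
  by move: st; lra.
set p := y ^+ 2 - x - x ^+ 2; set q := 2 * x * y + y.
have le_S : `|p * cos (y * ln (1 - s) + h) + q * sin (y * ln (1 - s) + h)| <=
    `|p| + `|q|.
  apply: (le_trans (ler_normD _ _)); rewrite !normrM.
  by apply: lerD; rewrite ler_piMr// ?cos_max ?sin_max.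
rewrite /df /D !normrM -/p -/q.
have -> : expR `|x| * 2 * (`|p| + `|q|) * t = expR `|x| * (2 * t) * (`|p| + `|q|).
  by ring.
apply: ler_pM => //; rewrite ?mulr_ge0//.
by rewrite -normrM; apply: ler_pM.
Qed.
End GaussFactor.

(** * Convergence of complex infinite products *)

Section InfiniteProduct.
Variable R : realType.
Local Open Scope classical_set_scope.
Local Open Scope complex_scope.
Implicit Types a b : R[i].

(** Limits are taken separately on real and imaginary parts, which is why this
    norm is more convenient than the modulus. *)
Definition norm1 a : R := `|complex.Re a| + `|complex.Im a|.

Lemma norm1D a b : norm1 (a + b) <= norm1 a + norm1 b.
Proof.
case: a b => [a a'] [b b']; rewrite /norm1 /= addrACA.
by apply: lerD; apply: ler_normD.
Qed.

Lemma norm1M a b : norm1 (a * b) <= norm1 a * norm1 b.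
Proof.
case: a b => [a a'] [b b']; rewrite /norm1 /=.
have -> : (`|a| + `|a'|) * (`|b| + `|b'|) =
  `|a * b| + `|a' * b'| + (`|a * b'| + `|a' * b|) by rewrite !normrM; ring.
by apply: lerD; [apply: ler_normB|apply: ler_normD].
Qed.

Lemma norm1_ge0 a : 0 <= norm1 a. Proof. by rewrite addr_ge0. Qed.

Lemma norm1_eq0 a : norm1 a = 0 -> a = 0.
Proof.
move=> /eqP; rewrite paddr_eq0// !normr_eq0.
by case: a => a a' /= /andP[/eqP-> /eqP->].
Qed.

Variables (p r : nat -> R[i]) (C : R).
Hypothesis C_ge0 : 0 <= C.
Hypothesis pS : forall n, (0 < n)%N -> p n.+1 = p n * r n.
Hypothesis r1 : forall n, (0 < n)%N -> norm1 (r n - 1) <= C / n.+1%:R ^+ 2.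

(* C / n majorizes the tail of the sum of the C / k^2, by telescoping. *)
Let b n := C / n%:R.

Let r1b n : (0 < n)%N -> norm1 (r n - 1) <= b n - b n.+1.
Proof.
move=> n0; apply: (le_trans (r1 n0)); rewrite /b -mulrBr ler_wpM2l//.
have n1 : 0 < n%:R :> R by rewrite ltr0n.
have -> : (n%:R^-1 - n.+1%:R^-1 : R) = (n%:R * n.+1%:R)^-1.
  by rewrite -natr1; field; rewrite natr1 !gt_eqF ?ltr0n.
rewrite lef_pV2 ?posrE ?exprn_gt0 ?mulr_gt0 ?ltr0n// expr2 ler_wpM2r//.
by rewrite ler_nat.
Qed.

Let b_ge0 n : 0 <= b n. Proof. by rewrite divr_ge0. Qed.

Let prod_step B n k : (0 < n)%N ->
  (forall j, (j < k)%N -> norm1 (p (n + j)) <= B) ->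
  norm1 (p (n + k) - p n) <= B * (b n - b (n + k)).
Proof.
move=> n0; elim: k => [|k IHk] pB.
  by rewrite addn0 !subrr mulr0 /norm1 !normr0 addr0.
rewrite addnS pS ?addn_gt0 ?n0//.
have -> : p (n + k) * r (n + k) - p n =
    (p (n + k) - p n) + p (n + k) * (r (n + k) - 1) by ring.
apply: (le_trans (norm1D _ _)).
have -> : B * (b n - b (n + k).+1) =
    B * (b n - b (n + k)) + B * (b (n + k) - b (n + k).+1) by ring.
apply: lerD; first by apply: IHk => j jk; apply: pB; apply: ltnW.
apply: (le_trans (norm1M _ _)).
apply: ler_pM; rewrite ?norm1_ge0 ?pB// r1b// addn_gt0 n0//.
Qed.

(** Once C / N <= 1/4, the relative variation of p beyond N is at most
    2 (b N) <= 1/2, so |p| stays between |p N| / 2 and 2 |p N|: the upper bound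
    makes p converge and the lower one keeps its limit away from 0. *)
Lemma tail_bounds : exists2 N, (0 < N)%N &
  (forall n k, (N <= n)%N ->
     norm1 (p (n + k) - p n) <= 2 * norm1 (p N) * (b n - b (n + k))) /\
  forall k, norm1 (p N) / 2 <= norm1 (p (N + k)).
Proof.
pose N := (Num.bound (4 * C)).+1; exists N => //.
have bN : b N <= 1 / 4.
  rewrite /b ler_pdivrMr ?ltr0n//.
  have : 4 * C < N%:R.
    apply: lt_trans (archi_boundP _) _; first by rewrite mulr_ge0.
    by rewrite ltr_nat.
  lra.
have P0 := norm1_ge0 (p N).
  (* Both bounds are proved together: the variation up to k is controlled by
     the size of p before k. *)
have close k : norm1 (p (N + k)) <= 2 * norm1 (p N) /\
    norm1 (p (N + k) - p N) <= norm1 (p N) / 2.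
  have [m] := ubnP k; elim: m k => // m IHm k; rewrite ltnS => km.
  have step : norm1 (p (N + k) - p N) <= norm1 (p N) / 2.
    apply: (@le_trans _ _ (2 * norm1 (p N) * (b N - b (N + k)))).
      by apply: prod_step => // j jk; apply: (IHm j _).1; apply: leq_trans jk km.
    apply: (@le_trans _ _ (2 * norm1 (p N) * (1 / 4))); last by lra.
    rewrite ler_wpM2l ?mulr_ge0//; apply: le_trans bN.
    by rewrite gerBl.
  split=> //; rewrite -[p (N + k)](subrK (p N)).
  by apply: (le_trans (norm1D _ _)); lra.
split=> [n k Nn|k].
  apply: prod_step; first exact: leq_trans Nn.
  by move=> j _; rewrite -(subnKC Nn) -addnA; have [] := close (n - N + j)%N.
have [_ ck] := close k.
have : norm1 (p N) <= norm1 (p (N + k)) + norm1 (p (N + k) - p N).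
  have -> : norm1 (p (N + k) - p N) = norm1 (p N - p (N + k)).
    by rewrite /norm1 -opprB !raddfN !normrN.
  by rewrite -{1}[p N](subrK (p (N + k))) addrC; apply: norm1D.
lra.
Qed.

(** By [tail_bounds], the sequence c (p n) - B b n, with B = 2 |p N|, is
    nondecreasing and bounded, and B b n tends to 0. *)
Let component_cvg (c : R[i] -> R) : {morph c : x y / x - y} ->
  (forall a, `|c a| <= norm1 a) -> cvgn (c \o p).
Proof.
move=> cB c_le; have [N N0 [tail _]] := tail_bounds.
set B := 2 * norm1 (p N) in tail.
pose v n := c (p (n + N)%N) - B * b (n + N)%N.
have B0 : 0 <= B by rewrite mulr_ge0 ?norm1_ge0.
have v_cvg : cvgn v.
  apply: nondecreasing_is_cvgn.
    move=> m n mn; rewrite /v.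
    have := le_trans (c_le _) (tail (m + N)%N (n - m)%N (leq_addl _ _)).
    have -> : (m + N + (n - m) = n + N)%N by rewrite addnAC subnKC.
    rewrite cB ler_norml => /andP[+ _]; lra.
  exists (c (p N) + B * b N) => _ [n _ <-]; rewrite /v.
  have := le_trans (c_le _) (tail N n (leqnn N)).
  rewrite [(N + n)%N]addnC cB ler_norml => /andP[_].
  have : 0 <= B * b (n + N)%N by rewrite mulr_ge0.
  lra.
have b_cvg : (fun n => B * b (n + N)%N) @ \oo --> (0 : R).
  rewrite -(mulr0 (B * C)); under eq_fun do rewrite /b mulrA.
  apply: cvgM; first exact: cvg_cst.
  rewrite (cvg_shiftn N (fun n => n%:R^-1 : R)) -(cvg_shiftn 1).
  under eq_fun do rewrite addn1.
  exact: cvg_harmonic.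
apply/cvg_ex; exists (lim (v @ \oo) + 0).
rewrite -(cvg_shiftn N).
rewrite (_ : [sequence _]_n = (fun n => v n + B * b (n + N)%N)); last first.
  by apply/funext => n /=; rewrite /v subrK.
exact: cvgD.
Qed.

Lemma Re_cvg : cvgn (fun n => complex.Re (p n)).
Proof.
apply: (component_cvg (c := @complex.Re R)) => [a a'|a]; first exact: raddfB.
by rewrite /norm1 lerDl.
Qed.

Lemma Im_cvg : cvgn (fun n => complex.Im (p n)).
Proof.
apply: (component_cvg (c := @complex.Im R)) => [a a'|a]; first exact: raddfB.
by rewrite /norm1 lerDr.
Qed.

Lemma prod_limit_neq0 : (forall n, p n != 0) ->
  lim ((fun n => complex.Re (p n)) @ \oo)%classic +i*
  lim ((fun n => complex.Im (p n)) @ \oo)%classic != 0.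
Proof.
move=> p_neq0; have [N N0 [_ lower]] := tail_bounds.
have PN : 0 < norm1 (p N).
  rewrite lt_neqAle norm1_ge0 andbT eq_sym; apply/eqP => /norm1_eq0 /eqP.
  by apply/negP.
apply/eqP => -[re0 im0].
have cN : (fun n => norm1 (p n)) @ \oo -->
    `|lim ((fun n => complex.Re (p n)) @ \oo)%classic| +
    `|lim ((fun n => complex.Im (p n)) @ \oo)%classic|.
  by apply: cvgD; apply: cvg_norm; [exact: Re_cvg|exact: Im_cvg].
rewrite re0 im0 normr0 addr0 in cN.
suff : norm1 (p N) / 2 <= 0 by lra.
rewrite -(cvg_lim (@Rhausdorff R) cN).
apply: limr_ge; first by apply/cvg_ex; exists 0.
exists N => // n /= Nn; rewrite -(subnKC Nn); exact: lower.
Qed.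
End InfiniteProduct.

(** * The reciprocal Gamma function *)

Section GammaTheory.
Local Open Scope classical_set_scope.
Variable R : realType.
Local Open Scope complex_scope.
Implicit Types z : R[i].

(** exp (z l) for real l. *)
Definition cis_exp z (l : R) : R[i] :=
  (expR (complex.Re z * l))%:C *
  (cos (complex.Im z * l) +i* sin (complex.Im z * l)).

Lemma cis_expD z l m : cis_exp z (l + m) = cis_exp z l * cis_exp z m.
Proof.
rewrite /cis_exp !mulrDr expRD rmorphM cosD sinD mulrACA; congr (_ * _).
by apply/eqP; rewrite eq_complex /=; apply/andP; split; apply/eqP; ring.
Qed.

Lemma cis_exp0 z : cis_exp z 0 = 1.
Proof. by rewrite /cis_exp !mulr0 expR0 cos0 sin0 mul1r. Qed.

Lemma cis_exp_neq0 z l : cis_exp z l != 0.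
Proof.
apply/eqP => z0; have := cis_expD z l (- l).
by rewrite subrr cis_exp0 z0 mul0r; apply/eqP; rewrite oner_eq0.
Qed.

Lemma natcpowE n z : natcpow n z = cis_exp z (ln n%:R). Proof. by []. Qed.

Lemma natcpow_neq0 n z : natcpow n z != 0.
Proof. exact: cis_exp_neq0. Qed.

(** Consecutive terms of the sequence of Gauss differ by the factor
    (1 + z t) (1 - t)^z with t = 1 / (n + 1). *)
Lemma rgamma_seqS z n : (0 < n)%N ->
  rgamma_seq z n.+1 = rgamma_seq z n *
    ((1 + z / n.+1%:R) * cis_exp z (ln (1 - n.+1%:R^-1))).
Proof.
move=> n0; rewrite /rgamma_seq big_ord_recr /= factS natrM.
have -> : natcpow n z = natcpow n.+1 z * cis_exp z (ln (1 - n.+1%:R^-1)).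
  have n1 : 0 < n%:R :> R by rewrite ltr0n.
  have n2 : 0 < n.+1%:R :> R by rewrite ltr0n.
  rewrite !natcpowE -cis_expD -lnM ?posrE ?subr_gt0 ?invf_lt1 ?ltr1n//.
  rewrite mulrBr mulr1 divff ?gt_eqF//.
  by rewrite -natr1 addrK.
have := natcpow_neq0 n.+1 z; have := cis_exp_neq0 z (ln (1 - n.+1%:R^-1)).
have : n`!%:R != 0 :> R[i] by rewrite pnatr_eq0 -lt0n fact_gt0.
have : n.+1%:R != 0 :> R[i] by rewrite pnatr_eq0.
set e := cis_exp _ _; set w := natcpow _ _; set q := _ `! %:R.
set k := n.+1%:R; move: e w q k (\prod_(_ < _) _) => e w q k P k0 q0 e0 w0.
by field; rewrite k0 q0 e0 w0.
Qed.

Lemma rgamma_factor_bound z : exists2 C, 0 <= C & forall n, (0 < n)%N ->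
  norm1 ((1 + z / n.+1%:R) * cis_exp z (ln (1 - n.+1%:R^-1)) - 1) <=
  C / n.+1%:R ^+ 2.
Proof.
case: z => x y.
have [C C0 HC] := gauss_factor_bound x y 0.
have [D D0 HD] := gauss_factor_bound x y (- (pi / 2)).
exists (C + D) => [|n n0]; first exact: addr_ge0.
pose t : R := n.+1%:R^-1.
have t_itv : 0 < t <= 2^-1.
  rewrite invr_gt0 ltr0n /= lef_pV2 ?posrE ?ltr0n//.
  by rewrite ler_nat ltnS.
rewrite -exprVn [leRHS]mulrDl -/t.
have cos_half a : cos (a - pi / 2) = sin a :> R.
  by rewrite cosB cos_pihalf sin_pihalf mulr0 add0r mulr1.
have sin_half a : sin (a - pi / 2) = - cos a :> R.
  by rewrite sinB cos_pihalf sin_pihalf mulr0 mulr1 sub0r.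
have -> : (1 + (x +i* y) / n.+1%:R) * cis_exp (x +i* y) (ln (1 - t)) - 1 =
  (gauss_factor x y 0 t - cos 0) +i* (gauss_factor x y (- (pi / 2)) t - cos (- (pi / 2))).
  have -> : (n.+1%:R : R[i])^-1 = t%:C by rewrite fmorphV rmorph_nat.
  rewrite /gauss_factor /cis_exp cos0 cosN cos_pihalf !addr0 cos_half sin_half.
  by apply/eqP; rewrite eq_complex /=; apply/andP; split; apply/eqP; ring.
by rewrite /norm1 /=; apply: lerD; [apply: HC|apply: HD].
Qed.

Lemma rgamma_seq_cvg z :
  (fun n => complex.Re (rgamma_seq z n)) @ \oo --> complex.Re (rgamma z) /\
  (fun n => complex.Im (rgamma_seq z n)) @ \oo --> complex.Im (rgamma z).
Proof.
have [C C0 HC] := rgamma_factor_bound z.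
by split; [apply: (Re_cvg C0 (@rgamma_seqS z) HC)|
           apply: (Im_cvg C0 (@rgamma_seqS z) HC)].
Qed.

(** The terms of the sequence are then nonzero, and a product whose factors
    are 1 + O(1/n^2) has a nonzero limit unless a factor vanishes. *)
Lemma rgamma_neq0 z : (forall n : nat, z + n%:R != 0) -> rgamma z != 0.
Proof.
move=> z_neq0; have [C C0 HC] := rgamma_factor_bound z.
apply: (prod_limit_neq0 C0 (@rgamma_seqS z) HC) => n.
rewrite /rgamma_seq; apply: mulf_neq0.
  by rewrite prodf_seq_neq0; apply/allP => k _; rewrite z_neq0.
by rewrite invr_neq0// mulf_neq0 ?natcpow_neq0// pnatr_eq0 -lt0n fact_gt0.
Qed.

Lemma rgammaS z : rgamma z = z * rgamma (z + 1).
Proof.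
have [re im] := rgamma_seq_cvg z; have [reS imS] := rgamma_seq_cvg (z + 1).
(* The two products differ by their extreme factors only; the correction
   tends to 1. *)
have step n : (0 < n)%N ->
    z * rgamma_seq (z + 1) n = rgamma_seq z n * (1 + (z + 1) * (n%:R^-1)%:C).
  move=> n0; have n1 : n%:R != 0 :> R[i] by rewrite pnatr_eq0 -lt0n.
  have -> : (n%:R^-1)%:C = (n%:R : R[i])^-1 by rewrite fmorphV rmorph_nat.
  rewrite /rgamma_seq.
  have -> : natcpow n (z + 1) = n%:R * natcpow n z.
    case: z {re im reS imS} => x y; rewrite /natcpow /= addr0 mulrDl mul1r expRD.
    by rewrite lnK ?posrE ?ltr0n// rmorphM rmorph_nat mulrCA mulrA.
  have -> : z * (\prod_(k < n.+1) (z + 1 + k%:R) / (n`!%:R * (n%:R * natcpow n z))) =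
    (z * \prod_(k < n.+1) (z + 1 + k%:R)) / (n`!%:R * (n%:R * natcpow n z)) by rewrite mulrA.
  have -> : z * \prod_(k < n.+1) (z + 1 + k%:R) =
      \prod_(k < n.+1) (z + k%:R) * (z + 1 + n%:R).
    rewrite big_ord_recr /= [in RHS]big_ord_recl /= addr0 mulrA.
    congr (_ * _ * _); apply: eq_bigr => k _.
    by rewrite /bump /= add1n -natr1; ring.
  have := natcpow_neq0 n z.
  have : n`!%:R != 0 :> R[i] by rewrite pnatr_eq0 -lt0n fact_gt0.
  set q := _ `! %:R; set w := natcpow _ _.
  by move: q w (\prod_(_ < _) _) => q w P q0 w0; field; rewrite n1 q0 w0.
have inv_cvg : (fun n => n%:R^-1 : R) @ \oo --> (0 : R).
  rewrite -(cvg_shiftn 1); under eq_fun do rewrite addn1.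
  exact: cvg_harmonic.
have ReM a b : complex.Re (a * b) =
    complex.Re a * complex.Re b - complex.Im a * complex.Im b :> R.
  by case: a b => ? ? [].
have ImM a b : complex.Im (a * b) =
    complex.Re a * complex.Im b + complex.Im a * complex.Re b :> R.
  by case: a b => ? ? [].
pose e n : R[i] := 1 + (z + 1) * (n%:R^-1)%:C.
have cvg_to (f : nat -> R) (l m : R) : f @ \oo --> l -> l = m -> f @ \oo --> m.
  by move=> fl <-.
have e_cvg : (fun n => complex.Re (e n)) @ \oo --> (1 : R) /\
             (fun n => complex.Im (e n)) @ \oo --> (0 : R).
  have eE n : e n = (1 + complex.Re (z + 1) * n%:R^-1) +i*
      (complex.Im (z + 1) * n%:R^-1).
    rewrite /e; case: (z + 1) => x y.
    by apply/eqP; rewrite eq_complex /=; apply/andP; split; apply/eqP; ring.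
  split; under eq_fun do rewrite eE /=.
    apply: cvg_to.
      by apply: cvgD; [exact: cvg_cst|apply: cvgM; [exact: cvg_cst|exact: inv_cvg]].
    by rewrite mulr0 addr0.
  apply: cvg_to; first by apply: cvgM; [exact: cvg_cst|exact: inv_cvg].
  by rewrite mulr0.
have [eRe eIm] := e_cvg.
have near_eq (c : R[i] -> R) :
    \forall n \near \oo, c (z * rgamma_seq (z + 1) n) = c (rgamma_seq z n * e n).
  by exists 1%N => // n /= n0; rewrite step.
have lim_eq (f g : nat -> R) (l m : R) : (\forall n \near \oo, f n = g n) ->
    f @ \oo --> l -> g @ \oo --> m -> l = m.
  move=> fg fl gm; have gl : g @ \oo --> l.
    by apply: cvg_trans fl; apply: near_eq_cvg.
  by rewrite -(cvg_lim (@Rhausdorff R) gl) (cvg_lim (@Rhausdorff R) gm).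
apply/esym/eqP; rewrite eq_complex; apply/andP; split; apply/eqP.
- apply: (lim_eq _ _ _ _ (near_eq (@complex.Re R))).
    rewrite ReM; under eq_fun do rewrite ReM.
    by apply: cvgB; apply: cvgM => //; exact: cvg_cst.
  under eq_fun do rewrite ReM.
  apply: cvg_to; first by apply: cvgB; apply: cvgM; eassumption.
  by rewrite mulr1 mulr0 subr0.
- apply: (lim_eq _ _ _ _ (near_eq (@complex.Im R))).
    rewrite ImM; under eq_fun do rewrite ImM.
    by apply: cvgD; apply: cvgM => //; exact: cvg_cst.
  under eq_fun do rewrite ImM.
  apply: cvg_to; first by apply: cvgD; apply: cvgM; eassumption.
  by rewrite mulr1 mulr0 add0r.
Qed.

Lemma gammaS z : z != 0 -> gamma (z + 1) = z * gamma z.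
Proof.
move=> z0; rewrite /gamma (rgammaS z).
have [->|r0] := eqVneq (rgamma (z + 1)) 0; first by rewrite mulr0 invr0 mulr0.
by rewrite invfM mulrA divff ?mul1r.
Qed.
End GammaTheory.

(** * Exponentials of locally nilpotent operators *)

Section LocallyFiniteExpTheory.
Variables (K : numFieldType) (V : lmodType K).
Implicit Types (D F G : {linear V -> V}) (v : V).

Definition locnil D := forall v, exists n, iter n D v = 0.

Lemma iter_linear0 D n : iter n D 0 = 0.
Proof. by elim: n => //= n ->; rewrite linear0. Qed.

Lemma iter_eq0_le D m n v : (m <= n)%N -> iter m D v = 0 -> iter n D v = 0.
Proof. by move=> /subnK <- Dv; rewrite iterD Dv iter_linear0. Qed.

Lemma expopE D n v : iter n D v = 0 ->
  expop D v = \sum_(k < n) (k`!%:R)^-1 *: iter k D v.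
Proof.
move=> Dv; rewrite /expop /nilindex; case: pselect => [h|[]]; last first.
  by exists n; apply/eqP.
case: ex_minnP => m /eqP Dm /(_ n); rewrite Dv eqxx => /(_ isT) le_mn.
rewrite -(subnKC le_mn) big_split_ord /= [X in _ = _ + X]big1 ?addr0// => i _.
by rewrite (iter_eq0_le (leq_addr i m) Dm) scaler0.
Qed.

Lemma iter_linear D n a u v :
  iter n D (a *: u + v) = a *: iter n D u + iter n D v.
Proof. by elim: n => //= n ->; rewrite linearP. Qed.

Lemma locnil2 D u v : locnil D -> exists n, iter n D u = 0 /\ iter n D v = 0.
Proof.
move=> nilD; have [[m Du] [n Dv]] := (nilD u, nilD v).
by exists (maxn m n); split;
  [apply: iter_eq0_le Du; apply: leq_maxl|apply: iter_eq0_le Dv; apply: leq_maxr].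
Qed.

Lemma expop_linear D : locnil D -> linear (expop D).
Proof.
move=> nilD a u v; have [n [Du Dv]] := locnil2 u v nilD.
rewrite (expopE (n := n)) ?(expopE Du) ?(expopE Dv); last first.
  by rewrite iter_linear Du Dv scaler0 addr0.
rewrite scaler_sumr -big_split; apply: eq_bigr => k _ /=.
by rewrite iter_linear scalerDr !scalerA mulrC.
Qed.

Lemma expop_fix D v : D v = 0 -> expop D v = v.
Proof. by move=> Dv; rewrite (expopE (n := 1%N)) // big_ord1 invr1 scale1r. Qed.

(** When G = [F, D] commutes with D, the powers satisfy
    F D^n = D^n F + n D^(n-1) G, and the series sums to
    F e^D = e^D F + e^D G. *)
Lemma expop_conj D F G : locnil D ->
  (forall v, F (D v) = D (F v) + G v) -> (forall v, G (D v) = D (G v)) ->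
  forall v, F (expop D v) = expop D (F v) + expop D (G v).
Proof.
move=> nilD FD GD v.
have GDn n : G (iter n D v) = iter n D (G v).
  by elim: n => //= n IHn; rewrite GD IHn.
have FDn n : F (iter n D v) = iter n D (F v) + n%:R *: iter n.-1 D (G v).
  elim: n => [|n IHn] /=; first by rewrite scale0r addr0.
  rewrite FD IHn GDn linearD linearZ /= -addrA; congr (_ + _).
  case: n {IHn} => [|n] /=; first by rewrite scale0r add0r scale1r.
  by rewrite -[in RHS]natr1 scalerDl scale1r.
have [m [m1 m2]] := locnil2 (F v) (G v) nilD; have [n Dn] := nilD v.
pose N := maxn m n.
have le_mN : (m <= N)%N by apply: leq_maxl.
have Nv : iter N.+1 D v = 0.
  by apply: iter_eq0_le Dn; apply: leqW; apply: leq_maxr.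
rewrite (expopE Nv) linear_sum /= (expopE (n := N.+1)); last first.
  by apply: iter_eq0_le m1; apply: leqW.
rewrite (expopE (iter_eq0_le le_mN m2)).
under eq_bigr => k _ do rewrite linearZ /= FDn scalerDr scalerA.
rewrite big_split /=; congr (_ + _).
rewrite big_ord_recl /= mulr0 scale0r add0r; apply: eq_bigr => k _ /=.
congr (_ *: _); rewrite /bump /= add1n factS natrM invfM mulrAC mulVf ?mul1r//.
by rewrite pnatr_eq0.
Qed.

Lemma expop_comm D G : locnil D -> (forall v, G (D v) = D (G v)) ->
  forall v, G (expop D v) = expop D (G v).
Proof.
move=> nilD GD v; have [n Dv] := nilD v.
have GDk k : G (iter k D v) = iter k D (G v).
  by elim: k => //= k IHk; rewrite GD IHk.
rewrite (expopE Dv) linear_sum (expopE (n := n)); last by rewrite -GDk Dv linear0.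
by apply: eq_bigr => k _; rewrite linearZ /= GDk.
Qed.

(** The form used below: the conjugate of F by e^D is F - G. *)
Lemma expop_conjV D F G : locnil D ->
  (forall v, F (D v) = D (F v) + G v) -> (forall v, G (D v) = D (G v)) ->
  forall v, expop D (F v) = F (expop D v) - G (expop D v).
Proof.
by move=> nilD FD GD v; rewrite (expop_conj nilD FD GD) (expop_comm nilD GD) addrK.
Qed.
End LocallyFiniteExpTheory.

(** * Differential operators in six variables *)

(** All computations with differential operators take place in an abstract
    commutative ring A over K with elements X i and commuting derivations
    d i dual to them, where they reduce to ring identities. *)
Record partials (K A : comNzRingType) (C : {rmorphism K -> A})
  (X : 'I_6 -> A) (d : 'I_6 -> A -> A) : Prop := Partials {
  partialsD : forall i p q, d i (p + q) = d i p + d i q;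
  partialsN : forall i p, d i (- p) = - d i p;
  partialsM : forall i p q, d i (p * q) = d i p * q + p * d i q;
  partialsC : forall i c, d i (C c) = 0;
  partialsX : forall i j, d i (X j) = (j == i)%:R;
  partials_comm : forall i j p, d i (d j p) = d j (d i p) }.

(** The operator s stands for 1 / z_1 on Laurent polynomials modulo negative
    powers of z_1.  It is a left inverse of z_1 only, and fails to commute with
    d/dz_1, which is why the Euler operator appears instead. *)
Record zdivision (K A : comNzRingType) (C : {rmorphism K -> A})
  (X : 'I_6 -> A) (d : 'I_6 -> A -> A) (s : A -> A) : Prop := Zdivision {
  zdivD : forall p q, s (p + q) = s p + s q;
  zdivN : forall p, s (- p) = - s p;
  zdivC : forall c p, s (C c * p) = C c * s p;
  zdivZ : forall p, s (X z1 * p) = p;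
  zdivX : forall i p, i != z1 -> s (X i * p) = X i * s p;
  zdiv_d : forall i p, i != z1 -> s (d i p) = d i (s p);
  zdiv_euler : forall p, s (X z1 * d z1 p) = X z1 * d z1 (s p) + s p }.

Section Weyl.
Variables (K A : comNzRingType) (C : {rmorphism K -> A}).
Variables (X : 'I_6 -> A) (d : 'I_6 -> A -> A).
Hypothesis part : partials C X d.
Let dD := partialsD part.
Let dN := partialsN part.
Let dM := partialsM part.
Let dC := partialsC part.
Let dX := partialsX part.
Let dd := partials_comm part.

Lemma partials0 i : d i 0 = 0. Proof. by rewrite -{1}(rmorph0 C) dC. Qed.
Lemma partials1 i : d i 1 = 0. Proof. by rewrite -{1}(rmorph1 C) dC. Qed.
Lemma partials_nat n i : d i n%:R = 0.
Proof. by elim: n => [|n IHn]; rewrite ?partials0// -natr1 dD IHn partials1 addr0. Qed.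

Record scalar_linear (e : A -> A) : Prop := ScalarLinear {
  slD : forall p q, e (p + q) = e p + e q;
  slN : forall p, e (- p) = - e p;
  slC : forall c p, e (C c * p) = C c * e p }.

(** The commutation rules of the substitution M_1 -> M_1 M_2, that is
    p (x1, y1, z1, ...) -> p (x1 + x2, y1 + y2 - x1 z2, z1 + z2, ...). *)
Record translation (S : A -> A) : Prop := Translation {
  tr_lin : scalar_linear S;
  tr_x1 : forall p, S (X x1 * p) = (X x1 + X x2) * S p;
  tr_y1 : forall p, S (X y1 * p) = (X y1 + X y2 - X x1 * X z2) * S p;
  tr_z1 : forall p, S (X z1 * p) = (X z1 + X z2) * S p;
  tr_x2 : forall p, S (X x2 * p) = X x2 * S p;
  tr_y2 : forall p, S (X y2 * p) = X y2 * S p;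
  tr_z2 : forall p, S (X z2 * p) = X z2 * S p;
  tr_dx1 : forall p, S (d x1 p) = d x1 (S p) + X z2 * d y1 (S p);
  tr_dy1 : forall p, S (d y1 p) = d y1 (S p);
  tr_dz1 : forall p, S (d z1 p) = d z1 (S p);
  tr_dx2 : forall p, S (d x2 p) = d x2 (S p) - d x1 (S p) - X z2 * d y1 (S p);
  tr_dy2 : forall p, S (d y2 p) = d y2 (S p) - d y1 (S p);
  tr_dz2 : forall p, S (d z2 p) =
             d z2 (S p) - d z1 (S p) + X x1 * d y1 (S p) }.

(** The commutation rules of e^(q d_j) when q does not depend on the variable
    of index j: it is the substitution X j -> X j + q. *)
Record shift_exp (q : A) (j : 'I_6) (e : A -> A) : Prop := ShiftExp {
  se_lin : scalar_linear e;
  se_X : forall i p, e (X i * p) = (X i + (i == j)%:R * q) * e p;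
  se_d : forall i p, e (d i p) = d i (e p) - d i q * d j (e p) }.

(** The hypothesis on e is [expop_conjV] for D = q d_j. *)
Lemma exp_shift_exp (q : A) (j : 'I_6) (e : A -> A) : d j q = 0 ->
  let D p := q * d j p in scalar_linear e ->
  (forall F G : A -> A, scalar_linear F -> scalar_linear G ->
     (forall p, F (D p) = D (F p) + G p) -> (forall p, G (D p) = D (G p)) ->
     forall p, e (F p) = F (e p) - G (e p)) ->
  shift_exp q j e.
Proof.
move=> dq D e_lin push; split=> // i p.
- rewrite (push (fun p => X i * p) (fun p => - ((i == j)%:R * (q * p)))).
  + by ring.
  + by split=> * /=; ring.
  + by split=> * /=; ring.
  + by move=> r; rewrite /D dM dX; ring.
  + by move=> r; rewrite /D dN !dM partials_nat dq; ring.
- have dji : d j (d i q) = 0 by rewrite dd dq partials0.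
  rewrite (push (d i) (fun p => d i q * d j p))//.
  + by split=> * ; rewrite ?(dD, dN, dM, dC); ring.
  + by split=> *; rewrite ?(dD, dN, dM, dC); ring.
  + by move=> r; rewrite /D !dM (dd i j); ring.
  + by move=> r; rewrite /D !dM dji dq; ring.
Qed.

Lemma translation_exp e1 e2 e3 :
  shift_exp (X x2) x1 e1 -> shift_exp (X z2) z1 e2 ->
  shift_exp (X y2 - X x1 * X z2) y1 e3 ->
  translation (fun p => e3 (e2 (e1 p))).
Proof.
move=> [[e1D e1N e1C] e1X e1d] [[e2D e2N e2C] e2X e2d] [[e3D e3N e3C] e3X e3d].
split; first by split=> *; rewrite ?(e1D, e1N, e1C) ?(e2D, e2N, e2C) ?(e3D, e3N, e3C).
all: move=> p; rewrite ?(e1X, e1d) ?(dX, dD, dN, dM) /=.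
all: rewrite ?(mulrDl, mul0r, mul1r, subr0, addr0) ?(e2D, e2N, e2X, e2d, dX) /=.
all: rewrite ?(mulrDl, mul0r, mul1r, subr0, addr0) ?(e3D, e3N, e3X, e3d, dX, dD, dN, dM) /=.
all: ring.
Qed.

(** The entries of M^-1 D M with all derivatives moved to the right, which
    produces the constants 1 and 2 added to the parameters. *)
Definition lax_entry (x y z : 'I_6) (a1 a2 a3 : K) (i j : nat) (p : A) : A :=
  nth (fun=> 0) (nth [::] [::
   [:: fun p => C (a1 + 2) * p + X x * d x p + X y * d y p;
       fun p => d x p;
       fun p => d y p];
   [:: fun p => X y * d z p
         - X x * (C (a1 - a2 + 1) * p + X x * d x p + X y * d y p - X z * d z p);
       fun p => C (a2 + 1) * p + X z * d z p - X x * d x p;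
       fun p => d z p - X x * d y p] ;
   [:: fun p => - X y * (C (a1 - a3 + 2) * p + X x * d x p + X y * d y p + X z * d z p)
          - X x * (X z * (C (a2 - a3 + 1) * p + X z * d z p));
       fun p => - X y * d x p - X z * (C (a2 - a3 + 1) * p + X z * d z p);
       fun p => C a3 * p - X y * d y p - X z * d z p]] i) j p.

Section LaxE.
Variables (x y z : 'I_6) (a1 a2 a3 : K).
Hypothesis xyz_uniq : uniq [:: x; y; z].
Let entry (s : seq (seq (A -> A))) i j := nth (fun=> 0) (nth [::] s i) j.
Lemma lax_entries i j p :
  let s := [:: [:: *%R 1;       *%R 0;       *%R 0];
              [:: *%R (- X x); *%R 1;       *%R 0];
              [:: *%R (- X y); *%R (- X z); *%R 1]] in
  let t := [:: [:: *%R (C a1);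
                  (fun p => d x p - X z * d y p);
                  (fun p => d y p)];
              [:: *%R 0; *%R (C a2); (fun p => d z p)];
              [:: *%R 0; *%R 0;      *%R (C a3)]] in
  let w := [:: [:: *%R 1;                   *%R 0;    *%R 0];
              [:: *%R (X x);                *%R 1;    *%R 0];
              [:: *%R (X y + X x * X z); *%R (X z); *%R 1]] in
  let c k := entry s i 0 (entry t 0 k (entry w k j p)) +
    entry s i 1 (entry t 1 k (entry w k j p)) +
    entry s i 2 (entry t 2 k (entry w k j p)) in
  (i < 3)%N -> (j < 3)%N ->
  c 0%N + c 1%N + c 2%N = lax_entry x y z a1 a2 a3 i j p.
Proof.
move: xyz_uniq.
rewrite /= !inE !negb_or => /and3P[/andP[/negbTE xy /negbTE xz] /negbTE yz _].
have yx := etrans (eq_sym y x) xy; have zx := etrans (eq_sym z x) xz.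
have zy := etrans (eq_sym z y) yz.
case: i => [|[|[|//]]]; case: j => [|[|[|//]]] _ _; rewrite /lax_entry /entry /=.
all: rewrite ?(mul0r, mul1r, addr0, add0r, partials0, subr0, mulr0).
all: rewrite ?(dD, dN, dM, dC, dX, partials0, eqxx, xy, xz, yz, yx, zx, zy).
all: rewrite /=; ring.
Qed.
End LaxE.

Section S3.
Variable S : A -> A.
Hypothesis S_tr : translation S.
Let SD := slD (tr_lin S_tr).
Let SN := slN (tr_lin S_tr).
Let SC := slC (tr_lin S_tr).
Let tr := (tr_x1 S_tr, tr_y1 S_tr, tr_z1 S_tr, tr_x2 S_tr, tr_y2 S_tr, tr_z2 S_tr).
Let trd := (tr_dx1 S_tr, tr_dy1 S_tr, tr_dz1 S_tr, tr_dx2 S_tr, tr_dy2 S_tr, tr_dz2 S_tr).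

(** The off-diagonal entries of the matrix F(v) obtained from D_2 by conjugation
    with the translation: the fields of D_2 minus those of the first point
    that generate right multiplication on M_1. *)
Definition U12 p := d x2 p - X z2 * d y2 p - d x1 p.
Definition U13 p := d y2 p - d y1 p.
Definition U23 p := d z2 p - d z1 p + X x1 * d y1 p.

(** Matrices of operators are handled through their action on columns of
    polynomials: L_1 on a column, M_2^-1 on a column g, the column of index j
    of M_2 applied to p, and the same followed by F(v). *)
Definition lax1_vec (a1 a2 a3 : K) (f0 f1 f2 : A) (i : nat) : A :=
  let L := lax_entry x1 y1 z1 a1 a2 a3 in L i 0%N f0 + L i 1%N f1 + L i 2%N f2.
Definition lower_inv (g : nat -> A) (i : nat) : A :=
  nth 0 [:: g 0%N; g 1%N - X x2 * g 0%N; g 2%N - X y2 * g 0%N - X z2 * g 1%N] i.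

Definition lower_col (j : nat) (p : A) (k : nat) : A :=
  nth 0 (nth [::] [:: [:: p; X x2 * p; (X y2 + X x2 * X z2) * p];
    [:: 0; p; X z2 * p]; [:: 0; 0; p]] j) k.
Definition lax2_col v1 v2 v3 (j : nat) (p : A) (k : nat) : A :=
  nth 0 [:: C v1 * lower_col j p 0 + U12 (lower_col j p 1) + U13 (lower_col j p 2);
            C v2 * lower_col j p 1 + U23 (lower_col j p 2); C v3 * lower_col j p 2] k.
(** The entry (i, j) of M_2^-1 L_1(u) F(v) M_2. *)
Definition lax_conj u1 u2 u3 v1 v2 v3 (i j : nat) (p : A) : A :=
  let g := lax2_col v1 v2 v3 j p in lower_inv (lax1_vec u1 u2 u3 (g 0%N) (g 1%N) (g 2%N)) i.

(** S L_1 = M_2^-1 L_1 M_2 S. *)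
Lemma translation_lax1 u1 u2 u3 i q0 q1 q2 : (i < 3)%N ->
  S (lax1_vec u1 u2 u3 q0 q1 q2 i) =
  lower_inv (lax1_vec u1 u2 u3 (S q0) (X x2 * S q0 + S q1)
    ((X y2 + X x2 * X z2) * S q0 + X z2 * S q1 + S q2)) i.
Proof.
case: i => [|[|[|//]]] _; rewrite /lax1_vec /lower_inv /lax_entry/=.
all: rewrite ?(SD, SN, SC, tr, trd, mulNr).
all: rewrite ?(partials0, partials1, dD, dN, dM, dC, dX) /=.
all: ring.
Qed.

(** M_2 S L_2 = F(v) M_2 S. *)
Lemma translation_lax2 v1 v2 v3 j p : (j < 3)%N ->
  let L2 k := S (lax_entry x2 y2 z2 v1 v2 v3 k j p) in
  let g := lax2_col v1 v2 v3 j (S p) in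
  [/\ L2 0%N = g 0%N, X x2 * L2 0%N + L2 1%N = g 1%N &
      (X y2 + X x2 * X z2) * L2 0%N + X z2 * L2 1%N + L2 2%N = g 2%N].
Proof.
case: j => [|[|[|//]]] _; rewrite /lax2_col /lower_col /lax_entry/= /U12 /U13 /U23.
all: rewrite ?(SD, SN, SC, tr, trd, mulNr).
all: rewrite ?(partials0, partials1, dD, dN, dM, dC, dX) /=.
all: split; ring.
Qed.

Lemma translation_lax u1 u2 u3 v1 v2 v3 i j p : (i < 3)%N -> (j < 3)%N ->
  let L2 k := lax_entry x2 y2 z2 v1 v2 v3 k j p in
  S (lax1_vec u1 u2 u3 (L2 0%N) (L2 1%N) (L2 2%N) i) =
  lax_conj u1 u2 u3 v1 v2 v3 i j (S p).
Proof.
move=> i3 j3 L2; rewrite translation_lax1// /lax_conj.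
by have [-> -> ->] := translation_lax2 v1 v2 v3 p j3.
Qed.
End S3.

Let dyx p : d y1 (d x1 p) = d x1 (d y1 p). Proof. exact: dd. Qed.
Let dzx p : d z1 (d x1 p) = d x1 (d z1 p). Proof. exact: dd. Qed.
Let dzy p : d z1 (d y1 p) = d y1 (d z1 p). Proof. exact: dd. Qed.

Section Operators.
Variables u1 u2 : K.
(** Up to sign, [opE], [opX] and [opB] are the entries (2, 1), (3, 1) and
    (3, 2) of L_1, while [opW], [opV] and [opK] come from the third column of
    L_1 F(v), see [lax1_vec_col3]. *)
Definition opE p :=
  X x1 * (C (u1 - u2 + 1) * p + X x1 * d x1 p + X y1 * d y1 p - X z1 * d z1 p) -
  X y1 * d z1 p.
Definition opB v p :=
  X y1 * d x1 p + X z1 * (C (u2 - v + 1) * p + X z1 * d z1 p).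
Definition opX v p :=
  X y1 * (C (u1 - v + 2) * p + X x1 * d x1 p + X y1 * d y1 p + X z1 * d z1 p) +
  X x1 * (X z1 * (C (u2 - v + 1) * p + X z1 * d z1 p)).
Definition opW v p :=
  C (u1 - v + 1) * d y1 p + X y1 * d y1 (d y1 p) + d x1 (d z1 p).
Definition opV v p :=
  X x1 * opW v p - (X y1 * d y1 (d z1 p) + X z1 * d z1 (d z1 p) +
                    C (u2 - v + 1) * d z1 p).
Definition opK u v p :=
  opX u (d y1 p) + opB u (d z1 p - X x1 * d y1 p) +
  C v * (C u * p - X y1 * d y1 p - X z1 * d z1 p).

Lemma comm_BE v p : opB v (opE p) - opE (opB v p) = opX v p.
Proof.
rewrite /opX /opB /opE.
do 3 rewrite ?(partials0, partials1, dD, dN, dM, dC, dX, dyx, dzx, dzy) /=.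
ring.
Qed.

Lemma comm_WE v p : opW v (opE p) - opE (opW v p) = opV v p.
Proof.
rewrite /opV /opW /opE.
do 3 rewrite ?(partials0, partials1, dD, dN, dM, dC, dX, dyx, dzx, dzy) /=.
ring.
Qed.

(** The only operator that involves both u3 and v3 is a combination of
    commutators, up to terms that are symmetric in u3 and v3: here u and v
    stand for them, and the constant term and the coefficient 6 + ... are
    invariant under their exchange.  The identity is the reason why
    intertwining E, B and W suffices. *)
Lemma opK_comm u v p :
  opK u v p *+ 4 = opB u (opV v p) - opV v (opB u p) +
    (opW v (opX u p) - opX u (opW v p)) +
    (C (4 * u * v - (u2 - u + 1) * (u2 - v + 1) - (u1 - u + 2) * (u1 - v + 1)
        - (u2 - u + 1)) * p
     - C (6 + u1 + u2 + u + v) * (X y1 * d y1 p + X z1 * d z1 p)).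
Proof.
rewrite /opK /opV /opW /opX /opB.
do 3 rewrite ?(partials0, partials1, dD, dN, dM, dC, dX, dyx, dzx, dzy) /=.
ring.
Qed.

(** Separates in L_1 F(v) the derivatives with respect to the second set of
    variables, which only multiply entries of the first two columns of L_1. *)
Lemma lax1_vec_col3 u3 v3 i m0 m1 m2 : (i < 3)%N ->
  let L := lax_entry x1 y1 z1 u1 u2 u3 i in
  lax1_vec u1 u2 u3 (m0 + U13 m2) (m1 + U23 m2) (C v3 * m2) i =
  L 0%N (m0 + d y2 m2) + L 1%N (m1 + d z2 m2) +
  nth 0 [:: - opW v3 m2; opV v3 m2; opK u3 v3 m2] i.
Proof.
rewrite /lax1_vec /lax_entry /opK /opV /opW /opX /opB /U13 /U23.
case: i => [|[|[|//]]] _ /=.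
all: do 3 rewrite ?(partials0, partials1, dD, dN, dM, dC, dX, dyx, dzx, dzy) /=.
all: ring.
Qed.
End Operators.

Record diagonal (k : 'I_6) (f : A -> A) : Prop := Diagonal {
  diag_lin : scalar_linear f;
  diag_X : forall i p, i != k -> f (X i * p) = X i * f p;
  diag_d : forall i p, i != k -> f (d i p) = d i (f p);
  diag_euler : forall p, f (X k * d k p) = X k * d k (f p) }.

(** Commutation with the second set of variables, of indices 3, 4 and 5. *)
Record inert (f : A -> A) : Prop := Inert {
  inert_X : forall (i : 'I_6) p, (2 < i)%N -> f (X i * p) = X i * f p;
  inert_d : forall (i : 'I_6) p, (2 < i)%N -> f (d i p) = d i (f p) }.

(** A generating set of relations, from which those for all entries follow. *)
Record intertwiner (u1 u2 u3 v3 : K) (T : A -> A) : Prop := Intertwiner {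
  it_lin : scalar_linear T;
  it_inert : inert T;
  it_dx : forall p, T (d x1 p) = d x1 (T p);
  it_xy : forall p, T (X x1 * d x1 p) + T (X y1 * d y1 p) =
                    X x1 * d x1 (T p) + X y1 * d y1 (T p);
  it_yz : forall p, T (X y1 * d y1 p) + T (X z1 * d z1 p) =
                    X y1 * d y1 (T p) + X z1 * d z1 (T p);
  it_E : forall p, T (opE u1 u2 p) = opE u1 u2 (T p);
  it_B : forall p, T (opB u2 u3 p) = opB u2 v3 (T p);
  it_W : forall p, T (opW u1 v3 p) = opW u1 u3 (T p) }.

Section Intertwiner.
Variables (u1 u2 u3 v3 : K) (T : A -> A).
Hypothesis mul4I : forall p q : A, p *+ 4 = q *+ 4 -> p = q.
Hypothesis T_it : intertwiner u1 u2 u3 v3 T.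
Let TD := slD (it_lin T_it).
Let TN := slN (it_lin T_it).
Let TC := slC (it_lin T_it).
Let Tx2 p : T (X x2 * p) = X x2 * T p. Proof. exact: (inert_X (it_inert T_it)). Qed.
Let Ty2 p : T (X y2 * p) = X y2 * T p. Proof. exact: (inert_X (it_inert T_it)). Qed.
Let Tz2 p : T (X z2 * p) = X z2 * T p. Proof. exact: (inert_X (it_inert T_it)). Qed.
Let Tdx2 p : T (d x2 p) = d x2 (T p). Proof. exact: (inert_d (it_inert T_it)). Qed.
Let Tdy2 p : T (d y2 p) = d y2 (T p). Proof. exact: (inert_d (it_inert T_it)). Qed.
Let Tdz2 p : T (d z2 p) = d z2 (T p). Proof. exact: (inert_d (it_inert T_it)). Qed.
Let Tdx1 := it_dx T_it.
Let Txy := it_xy T_it.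
Let Tyz := it_yz T_it.
Let TE := it_E T_it.
Let TB := it_B T_it.
Let TW := it_W T_it.

Lemma intertwine_opX p : T (opX u1 u2 u3 p) = opX u1 u2 v3 (T p).
Proof. by rewrite -!comm_BE TD TN TB TE TE TB. Qed.

Lemma intertwine_opV p : T (opV u1 u2 v3 p) = opV u1 u2 u3 (T p).
Proof. by rewrite -!comm_WE TD TN TW TE TE TW. Qed.

Lemma intertwine_opK p : T (opK u1 u2 u3 v3 p) = opK u1 u2 v3 u3 (T p).
Proof.
have T4 q : T q *+ 4 = T (q *+ 4) by rewrite !mulrSr !mulr0n !add0r !TD.
have T6 a b a' b' k l q q' :
    T (a - b + (a' - b') + (C k * q - C l * q')) =
    T a - T b + (T a' - T b') + (C k * T q - C l * T q').
  by rewrite !(TD, TN) !TC.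
apply: mul4I; rewrite T4 !opK_comm T6 (TD (X y1 * d y1 p)) Tyz.
rewrite TB intertwine_opV intertwine_opV TB TW intertwine_opX intertwine_opX TW.
rewrite !rmorphB !rmorphD !rmorphM/=; ring.
Qed.

Lemma intertwine_lax i k p : (i < 3)%N -> (k < 2)%N ->
  T (lax_entry x1 y1 z1 u1 u2 u3 i k p) = lax_entry x1 y1 z1 u1 u2 v3 i k (T p).
Proof.
have opE' v q : lax_entry x1 y1 z1 u1 u2 v 1 0 q = - opE u1 u2 q.
  by rewrite /lax_entry /opE /=; ring.
have opX' v q : lax_entry x1 y1 z1 u1 u2 v 2 0 q = - opX u1 u2 v q.
  by rewrite /lax_entry /opX /=; ring.
have opB' v q : lax_entry x1 y1 z1 u1 u2 v 2 1 q = - opB u2 v q.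
  by rewrite /lax_entry /opB /=; ring.
case: i => [|[|[|//]]]; case: k => [|[|//]] _ _.
- by rewrite /lax_entry /= !TD TC -!addrA Txy.
- exact: Tdx1.
- by rewrite !opE' TN TE.
- rewrite /lax_entry /= !TD TN TC -!addrA; congr (_ + _).
  have -> : T (X z1 * d z1 p) - T (X x1 * d x1 p) =
      T (X y1 * d y1 p) + T (X z1 * d z1 p) -
      (T (X x1 * d x1 p) + T (X y1 * d y1 p)) by ring.
  by rewrite Tyz Txy; ring.
- by rewrite !opX' TN intertwine_opX.
- by rewrite !opB' TN TB.
Qed.

(** Every column of F(v) M_2 has the form (C v1 m0 + U12 m1 + U13 m2, ...). *)
Lemma intertwine_col v1 v2 i m0 m1 m2 : (i < 3)%N ->
  T (lax1_vec u1 u2 u3 (C v1 * m0 + U12 m1 + U13 m2) (C v2 * m1 + U23 m2)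
       (C v3 * m2) i) =
  lax1_vec u1 u2 v3 (C v1 * T m0 + U12 (T m1) + U13 (T m2))
    (C v2 * T m1 + U23 (T m2)) (C u3 * T m2) i.
Proof.
move=> i3; have T3 a b c : T (a + b + c) = T a + T b + T c by rewrite !TD.
have TU12 q : T (U12 q) = U12 (T q).
  by rewrite /U12 !TD !TN Tz2 Tdx2 Tdy2 Tdx1.
rewrite !lax1_vec_col3// T3 !intertwine_lax// (T3 (C v1 * m0)) (TD (C v2 * m1)) !TC TU12 Tdy2 Tdz2.
congr (_ + _).
case: i i3 => [|[|[|//]]] _ /=; first by rewrite TN TW.
- exact: intertwine_opV.
- exact: intertwine_opK.
Qed.

Lemma intertwine_lax_conj v1 v2 i j p : (i < 3)%N -> (j < 3)%N ->
  T (lax_conj u1 u2 u3 v1 v2 v3 i j p) = lax_conj u1 u2 v3 v1 v2 u3 i j (T p).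
Proof.
have T0 : T 0 = 0 by have := TC 0 0; rewrite rmorph0 !mul0r.
move=> i3 j3; have Tm k : (k < 3)%N -> T (lower_col j p k) = lower_col j (T p) k.
  rewrite /lower_col; case: j j3 => [|[|[|//]]] _; case: k => [|[|[|k]]] //= _.
    by rewrite !mulrDl -!mulrA TD Ty2 Tx2 Tz2.
have Tg k : (k < 3)%N ->
    T (lax1_vec u1 u2 u3 (lax2_col v1 v2 v3 j p 0) (lax2_col v1 v2 v3 j p 1)
         (lax2_col v1 v2 v3 j p 2) k) =
    lax1_vec u1 u2 v3 (lax2_col v1 v2 u3 j (T p) 0) (lax2_col v1 v2 u3 j (T p) 1)
         (lax2_col v1 v2 u3 j (T p) 2) k.
  by move=> k3; rewrite [LHS]intertwine_col// !Tm.
rewrite /lax_conj /lower_inv; case: i i3 => [|[|[|//]]] _ /=; first exact: Tg.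
- by rewrite TD TN Tx2 !Tg.
- have T3 a b c : T (a - b - c) = T a - T b - T c by rewrite !(TD, TN).
  by rewrite T3 Ty2 Tz2 !Tg.
Qed.
End Intertwiner.
End Weyl.

(** * The factored intertwiner *)

Section Factorization.
Variables (K A : comNzRingType) (C : {rmorphism K -> A}).
Variables (X : 'I_6 -> A) (d : 'I_6 -> A -> A) (s : A -> A).
Hypothesis part : partials C X d.
Let dD := partialsD part.
Let dN := partialsN part.
Let dM := partialsM part.
Let dC := partialsC part.
Let dX := partialsX part.
Let dd := partials_comm part.
Let zD p := X z1 * d z1 p.
Hypothesis zdiv : zdivision C X d s.
Let sD := zdivD zdiv.
Let sN := zdivN zdiv.
Let sC := zdivC zdiv.
Let sz := zdivZ zdiv.
Let sx p : s (X x1 * p) = X x1 * s p. Proof. by apply: (zdivX zdiv). Qed.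
Let sy p : s (X y1 * p) = X y1 * s p. Proof. by apply: (zdivX zdiv). Qed.
Let sdx p : s (d x1 p) = d x1 (s p). Proof. by apply: (zdiv_d zdiv). Qed.
Let sdy p : s (d y1 p) = d y1 (s p). Proof. by apply: (zdiv_d zdiv). Qed.
Let szD p : s (zD p) = zD (s p) + s p. Proof. exact: (zdiv_euler zdiv). Qed.

(** The commutation rules of e^(eps Y) with Y = y (1/z) d/dx. *)
Record shear (eps : A) (e : A -> A) : Prop := Shear {
  shear_lin : scalar_linear C e;
  shear_x : forall p, e (X x1 * p) = X x1 * e p + eps * (X y1 * s (e p));
  shear_y : forall p, e (X y1 * p) = X y1 * e p;
  shear_s : forall p, e (s p) = s (e p);
  shear_dx : forall p, e (d x1 p) = d x1 (e p);
  shear_dy : forall p, e (d y1 p) = d y1 (e p) - eps * s (d x1 (e p));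
  shear_zD : forall p, e (zD p) = zD (e p) + eps * (X y1 * s (d x1 (e p)));
  shear_inert : inert X d e;
  shear_zzD : forall p, e (X z1 * (p + zD p)) =
     X z1 * (e p + zD (e p)) + eps * (X y1 * d x1 (e p)) }.

Variables (u1 u2 u3 v3 : K).

(* The diagonal factors A and Q depend on the exponent of z and H on that of y;
   the hypotheses on them are those that the recursion of Gamma provides. *)
Variables (Am Hm Qm ep em : A -> A).
Hypothesis eM : shear (- 1) em.
Hypothesis eP : shear 1 ep.
Hypothesis Adiag : diagonal C X d z1 Am.
Hypothesis Qdiag : diagonal C X d z1 Qm.
Hypothesis Az : forall p, Am (X z1 * (C (u2 - u3 + 1) * p + zD p)) =
  X z1 * (Am p + zD (Am p)).
Hypothesis Adz : forall p, Am (d z1 p) = s (zD (Am p) + C (u2 - u3) * Am p).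
Hypothesis Qz : forall p, Qm (X z1 * (p + zD p)) =
  X z1 * (C (u2 - v3 + 1) * Qm p + zD (Qm p)).
Hypothesis Qdz : forall p, Qm (s (zD p + C (u2 - v3) * p)) = d z1 (Qm p).
Hypothesis Hdiag : diagonal C X d y1 Hm.
Hypothesis Hs : forall p, Hm (s p) = s (Hm p).
Hypothesis Hy : forall p, Hm (X y1 * (C (u1 - u3 + 1) * p + X y1 * d y1 p)) =
  X y1 * (C (u1 - v3 + 1) * Hm p + X y1 * d y1 (Hm p)).
Hypothesis Hdy : forall p, Hm (C (u1 - v3 + 1) * d y1 p + X y1 * d y1 (d y1 p)) =
  C (u1 - u3 + 1) * d y1 (Hm p) + X y1 * d y1 (d y1 (Hm p)).

Let Hlin := diag_lin Hdiag.
Let Hx p : Hm (X x1 * p) = X x1 * Hm p. Proof. exact: (diag_X Hdiag). Qed.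
Let Hz p : Hm (X z1 * p) = X z1 * Hm p. Proof. exact: (diag_X Hdiag). Qed.
Let Hdx p : Hm (d x1 p) = d x1 (Hm p). Proof. exact: (diag_d Hdiag). Qed.
Let HzD p : Hm (zD p) = zD (Hm p).
Proof. by rewrite /zD Hz (diag_d Hdiag). Qed.
Let HyD := diag_euler Hdiag.
Let zdiag a : diagonal C X d z1 a -> scalar_linear C a /\
  [/\ forall p, a (X x1 * p) = X x1 * a p, forall p, a (X y1 * p) = X y1 * a p,
      forall p, a (d x1 p) = d x1 (a p), forall p, a (d y1 p) = d y1 (a p) &
      forall p, a (zD p) = zD (a p)].
Proof. by case=> la aX ad az; split=> //; split=> // p; rewrite ?aX ?ad. Qed.

(** Q e^Y H e^-Y A. *)
Definition factored p := Qm (ep (Hm (em (Am p)))).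

Let sub a p q : scalar_linear C a -> a (p - q) = a p - a q.
Proof. by case=> aD aN _; rewrite aD aN. Qed.

Let dzx p : d z1 (d x1 p) = d x1 (d z1 p). Proof. exact: dd. Qed.
Let dzy p : d z1 (d y1 p) = d y1 (d z1 p). Proof. exact: dd. Qed.
Let dyx p : d y1 (d x1 p) = d x1 (d y1 p). Proof. exact: dd. Qed.
Let dxzD p : d x1 (zD p) = zD (d x1 p).
Proof. by rewrite /zD dM dX mul0r add0r dzx. Qed.
Let dyzD p : d y1 (zD p) = zD (d y1 p).
Proof. by rewrite /zD dM dX mul0r add0r dzy. Qed.
Let zDD p q : zD (p + q) = zD p + zD q.
Proof. by rewrite /zD dD mulrDr. Qed.
Let zDN p : zD (- p) = - zD p.
Proof. by rewrite /zD dN mulrN. Qed.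
Let zDy p : zD (X y1 * p) = X y1 * zD p.
Proof. by rewrite /zD dM dX mul0r add0r; ring. Qed.
Let zDx p : zD (X x1 * p) = X x1 * zD p.
Proof. by rewrite /zD dM dX mul0r add0r; ring. Qed.
Let zDC c p : zD (C c * p) = C c * zD p.
Proof. by rewrite /zD dM dC mul0r add0r; ring. Qed.
Let szD' p : s (X z1 * d z1 p) = zD (s p) + s p.
Proof. exact: szD. Qed.

(* Conjugation by A turns E and W into hatE and hatW, and conjugation by e^-Y
   turns the latter into tilE and tilW, where u3 and v3, which H has to
   exchange, occur only next to y d/dy and through their sum. *)
Let hatE b p :=
  X x1 * (C (u1 - u2 + 1) * p + X x1 * d x1 p + X y1 * d y1 p - zD p) -
  X y1 * s (zD p + C b * p).
Let tilE c p :=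
  X x1 * (C (u1 - u2 + 1) * p + X x1 * d x1 p + X y1 * d y1 p - zD p) -
  s (X y1 * (C c * p + X y1 * d y1 p)).
Let hatW b v p := C (u1 - v + 1) * d y1 p + X y1 * d y1 (d y1 p) +
  d x1 (s (zD p + C b * p)).
Let tilW v p := C (u1 - v + 1) * d y1 p + X y1 * d y1 (d y1 p) +
  s (d x1 (X y1 * d y1 p + (X y1 * d y1 p + (zD p + C (u1 + u2 - u3 - v3 + 1) * p)))).

Lemma em_hatE b p : em (hatE b p) = tilE (u1 - u2 + b + 1) (em p).
Proof.
case: eM => [[eD eN eC] ex ey es edx edy ez _ _]; rewrite /hatE /tilE.
rewrite ?(eD, eN, eC, ex, ey, es, edx, edy, ez).
do 3 rewrite ?(mulN1r, mulrN, sD, sN, sC, sx, sy, sdx, sdy, szD, dD, dN, dM, dX, dxzD, dyzD, zDD,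
  zDN, zDx, zDy, zDC, opprK) /=.
ring.
Qed.
Lemma ep_tilE b p : ep (tilE (u1 - u2 + b + 1) p) = hatE b (ep p).
Proof.
case: eP => [[eD eN eC] ex ey es edx edy ez _ _]; rewrite /hatE /tilE.
do 3 rewrite ?(eD, eN, eC, ex, ey, es, edx, edy, ez).
do 3 rewrite ?(mul1r, mulrN, mulrDr, sD, sN, sC, sx, sy, sdx, sdy, szD, dD, dN, dM, dX, dxzD, dyzD, zDD,
  zDN, zDx, zDy, zDC, opprK) /=.
ring.
Qed.

Lemma em_hatW p : em (hatW (u2 - u3) v3 p) = tilW v3 (em p).
Proof.
case: eM => [[eD eN eC] ex ey es edx edy ez _ _]; rewrite /hatW /tilW.
do 3 rewrite ?(eD, eN, eC, ex, ey, es, edx, edy, ez).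
do 3 rewrite ?(mulN1r, mulrN, mulrDr, sD, sN, sC, sx, sy, sdx, sdy, szD, dD, dN, dM, dC, dX, dxzD, dyzD, zDD,
  zDN, zDx, zDy, zDC, opprK, dyx, partials1 part) /=.
ring.
Qed.

Lemma ep_tilW p : ep (tilW u3 p) = hatW (u2 - v3) u3 (ep p).
Proof.
case: eP => [[eD eN eC] ex ey es edx edy ez _ _]; rewrite /hatW /tilW.
do 3 rewrite ?(eD, eN, eC, ex, ey, es, edx, edy, ez, mul1r).
do 3 rewrite ?(mul1r, mulrN, mulrDr, sD, sN, sC, sx, sy, sdx, sdy, szD, dD, dN, dM, dC, dX, dxzD, dyzD, zDD,
  zDN, zDx, zDy, zDC, opprK, dyx, partials1 part) /=.
ring.
Qed.

Lemma Hm_tilE p :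
  Hm (tilE (u1 - u3 + 1) p) = tilE (u1 - v3 + 1) (Hm p).
Proof.
case: Hlin => [eD eN eC].
by rewrite /tilE eD eN Hx Hs Hy !(eD, eN, eC) Hx Hdx HyD HzD.
Qed.

Lemma Hm_tilW p : Hm (tilW v3 p) = tilW u3 (Hm p).
Proof.
case: Hlin => [eD eN eC].
by rewrite /tilW eD Hdy Hs Hdx !eD eC HyD HzD.
Qed.

Lemma factored_E p : factored (opE C X d u1 u2 p) = opE C X d u1 u2 (factored p).
Proof.
have [lA [Ax Ay Adx Ady AzD]] := zdiag Adiag.
have [lQ [Qx Qy Qdx Qdy QzD]] := zdiag Qdiag.
rewrite /factored; have -> : Am (opE C X d u1 u2 p) = hatE (u2 - u3) (Am p).
  rewrite /opE /hatE (sub _ _ lA) Ax Ay Adz (sub _ _ lA) AzD.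
  by rewrite !(slD lA, slC lA) Ax Adx Ay Ady.
rewrite em_hatE (_ : u1 - u2 + (u2 - u3) + 1 = u1 - u3 + 1); last by ring.
rewrite Hm_tilE (_ : u1 - v3 + 1 = u1 - u2 + (u2 - v3) + 1); last by ring.
rewrite ep_tilE /hatE /opE (sub _ _ lQ) Qx Qy Qdz (sub _ _ lQ) QzD.
by rewrite !(slD lQ, slC lQ) Qx Qdx Qy Qdy.
Qed.

Lemma factored_W p : factored (opW C X d u1 v3 p) = opW C X d u1 u3 (factored p).
Proof.
have [lA [Ax Ay Adx Ady AzD]] := zdiag Adiag.
have [lQ [Qx Qy Qdx Qdy QzD]] := zdiag Qdiag.
rewrite /factored; have -> : Am (opW C X d u1 v3 p) = hatW (u2 - u3) v3 (Am p).
  by rewrite /opW /hatW !(slD lA, slC lA) Ay !Ady Adx Adz.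
rewrite em_hatW Hm_tilW ep_tilW /hatW /opW.
by rewrite !(slD lQ) (slC lQ) Qy !Qdy Qdx Qdz.
Qed.

(** A turns B into y d/dx + z (z d/dz + 1); conjugation by e^-Y removes the
    first term and H commutes with the second. *)
Lemma factored_B p : factored (opB C X d u2 u3 p) = opB C X d u2 v3 (factored p).
Proof.
have [lA [Ax Ay Adx Ady AzD]] := zdiag Adiag.
have [lQ [Qx Qy Qdx Qdy QzD]] := zdiag Qdiag.
have [lm _ my _ mdx _ _ _ mz] := eM; have [lp _ py _ pdx _ _ _ pz] := eP.
rewrite /factored /opB (slD lA) Ay Adx -/(zD _) Az (slD lm) mz my mdx.
rewrite mulN1r addrC subrK Hz (slD Hlin) HzD pz mul1r addrC (slD lQ).
by rewrite Qy Qdx Qz.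
Qed.

Lemma factored_dx p : factored (d x1 p) = d x1 (factored p).
Proof.
by rewrite /factored (diag_d Adiag)// (shear_dx eM) Hdx (shear_dx eP) (diag_d Qdiag).
Qed.

(** Y has weight 0 for x d/dx + y d/dy, and likewise for y d/dy + z d/dz. *)
Lemma factored_xy p : factored (X x1 * d x1 p) + factored (X y1 * d y1 p) =
  X x1 * d x1 (factored p) + X y1 * d y1 (factored p).
Proof.
have [lA [Ax Ay Adx Ady AzD]] := zdiag Adiag.
have [lQ [Qx Qy Qdx Qdy QzD]] := zdiag Qdiag.
have [lm mx my ms mdx mdy mzD _ mz] := eM; have [lp px py ps pdx pdy pzD _ pz] := eP.
have lH := Hlin.
have L a p1 q : scalar_linear C a -> a (p1 + q) = a p1 + a q by case.
have T0D p1 q : factored (p1 + q) = factored p1 + factored q by rewrite /factored !(slD lA, slD lm, slD lH, slD lp, slD lQ).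
rewrite -T0D /factored (slD lA) Ax Ay Adx Ady.
have -> q : em (X x1 * d x1 q + X y1 * d y1 q) = X x1 * d x1 (em q) + X y1 * d y1 (em q).
  rewrite (slD lm) mx my mdx mdy; ring.
rewrite (slD lH) Hx Hdx HyD.
have -> q : ep (X x1 * d x1 q + X y1 * d y1 q) = X x1 * d x1 (ep q) + X y1 * d y1 (ep q).
  rewrite (slD lp) px py pdx pdy; ring.
by rewrite (slD lQ) Qx Qdx Qy Qdy.
Qed.

Lemma factored_yz p : factored (X y1 * d y1 p) + factored (X z1 * d z1 p) =
  X y1 * d y1 (factored p) + X z1 * d z1 (factored p).
Proof.
have [lA [Ax Ay Adx Ady AzD]] := zdiag Adiag.
have [lQ [Qx Qy Qdx Qdy QzD]] := zdiag Qdiag.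
have [lm mx my ms mdx mdy mzD _ mz] := eM; have [lp px py ps pdx pdy pzD _ pz] := eP.
have lH := Hlin.
have T0D p1 q : factored (p1 + q) = factored p1 + factored q by rewrite /factored !(slD lA, slD lm, slD lH, slD lp, slD lQ).
rewrite -T0D -/(zD _) /factored (slD lA) Ay Ady AzD.
have -> q : em (X y1 * d y1 q + zD q) = X y1 * d y1 (em q) + zD (em q).
  rewrite (slD lm) my mdy mzD; ring.
rewrite (slD lH) HyD HzD.
have -> q : ep (X y1 * d y1 q + zD q) = X y1 * d y1 (ep q) + zD (ep q).
  rewrite (slD lp) py pdy pzD; ring.
by rewrite (slD lQ) Qy Qdy QzD.
Qed.

Lemma factored_intertwiner : intertwiner C X d u1 u2 u3 v3 factored.
Proof.
have [lA lQ] := (diag_lin Adiag, diag_lin Qdiag).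
have [lm lp] := (shear_lin eM, shear_lin eP).
split; [| |exact: factored_dx|exact: factored_xy|exact: factored_yz|exact: factored_E|exact: factored_B|exact: factored_W].
  split=> *; rewrite /factored.
  - by rewrite !(slD lA, slD lm, slD Hlin, slD lp, slD lQ).
  - by rewrite !(slN lA, slN lm, slN Hlin, slN lp, slN lQ).
  - by rewrite !(slC lA, slC lm, slC Hlin, slC lp, slC lQ).
have [[mX md] [pX pd]] := (shear_inert eM, shear_inert eP).
split=> i p i2; have [iy iz] : i != y1 /\ i != z1.
- by split; apply: contraTneq i2 => ->.
- by rewrite /factored (diag_X Adiag)// mX// (diag_X Hdiag)// pX// (diag_X Qdiag).
- by split; apply: contraTneq i2 => ->.
- by rewrite /factored (diag_d Adiag)// md// (diag_d Hdiag)// pd// (diag_d Qdiag).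
Qed.
End Factorization.

(** * The exponential of y (1/z) d/dx *)
Section ShearOfExponential.
Variables (K A : comNzRingType) (C : {rmorphism K -> A}).
Variables (X : 'I_6 -> A) (d : 'I_6 -> A -> A) (s : A -> A).
Hypothesis part : partials C X d.
Let dD := partialsD part.
Let dN := partialsN part.
Let dM := partialsM part.
Let dC := partialsC part.
Let dX := partialsX part.
Let dd := partials_comm part.
Let zD p := X z1 * d z1 p.
Hypothesis zdiv : zdivision C X d s.
Let sD := zdivD zdiv.
Let sN := zdivN zdiv.
Let sC := zdivC zdiv.
Let sz := zdivZ zdiv.
Let sx p : s (X x1 * p) = X x1 * s p. Proof. by apply: (zdivX zdiv). Qed.
Let sy p : s (X y1 * p) = X y1 * s p. Proof. by apply: (zdivX zdiv). Qed.
Let sdx p : s (d x1 p) = d x1 (s p). Proof. by apply: (zdiv_d zdiv). Qed.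
Let sdy p : s (d y1 p) = d y1 (s p). Proof. by apply: (zdiv_d zdiv). Qed.
Let szD p : s (zD p) = zD (s p) + s p. Proof. exact: (zdiv_euler zdiv). Qed.
Let sx2 p : s (X x2 * p) = X x2 * s p. Proof. by apply: (zdivX zdiv). Qed.
Let sdx2 p : s (d x2 p) = d x2 (s p). Proof. by apply: (zdiv_d zdiv). Qed.
Let sy2 p : s (X y2 * p) = X y2 * s p. Proof. by apply: (zdivX zdiv). Qed.
Let sdy2 p : s (d y2 p) = d y2 (s p). Proof. by apply: (zdiv_d zdiv). Qed.
Let sz2 p : s (X z2 * p) = X z2 * s p. Proof. by apply: (zdivX zdiv). Qed.
Let sdz2 p : s (d z2 p) = d z2 (s p). Proof. by apply: (zdiv_d zdiv). Qed.

Variables (eps : K) (e : A -> A).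
Let D p := C eps * (X y1 * s (d x1 p)).
Hypothesis e_lin : scalar_linear C e.
(* As in [expop_conjV], for the generator D. *)
Hypothesis push : forall F G : A -> A, scalar_linear C F -> scalar_linear C G ->
  (forall p, F (D p) = D (F p) + G p) -> (forall p, G (D p) = D (G p)) ->
  forall p, e (F p) = F (e p) - G (e p).

Let szD' p : s (X z1 * d z1 p) = X z1 * d z1 (s p) + s p.
Proof. exact: szD. Qed.
Let dzx p : d z1 (d x1 p) = d x1 (d z1 p). Proof. exact: dd. Qed.
Let dzy p : d z1 (d y1 p) = d y1 (d z1 p). Proof. exact: dd. Qed.
Let dyx p : d y1 (d x1 p) = d x1 (d y1 p). Proof. exact: dd. Qed.
Let d20x p : d x2 (d x1 p) = d x1 (d x2 p). Proof. exact: dd. Qed.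
Let d21x p : d y2 (d x1 p) = d x1 (d y2 p). Proof. exact: dd. Qed.
Let d22x p : d z2 (d x1 p) = d x1 (d z2 p). Proof. exact: dd. Qed.

Let s0 : s 0 = 0. Proof. by have := sC 0 0; rewrite rmorph0 !mul0r. Qed.
Let simp := (s0, sD, sN, sC, sx, sy, sz, sdx, sdy, sx2, sy2, sz2, sdx2, sdy2, sdz2,
  partials0 part, partials1 part, dD, dN, dM, dC, dX, dzx, dzy, dyx, d20x, d21x, d22x).

(** The case G = 0 of push. *)
Lemma exp_inert (F : A -> A) : scalar_linear C F ->
  (forall p, F (D p) = D (F p)) -> forall p, e (F p) = F (e p).
Proof.
move=> Flin FD p; rewrite (push (F := F) (G := fun p => 0)) ?subr0//.
- by split=> * /=; ring.
- by move=> q; rewrite FD addr0.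
- by move=> q; rewrite /D; do 2 rewrite ?simp /=; ring.
Qed.

Lemma exp_inert2 : inert X d e.
Proof.
split=> i p i2; have [[ix iy] iz] : (i != x1 /\ i != y1) /\ i != z1.
- by do !split; apply: contraTneq i2 => ->.
- apply: exp_inert; first by split=> * /=; ring.
  move=> q; rewrite /D dM dX (negPf ix) mul0r add0r (zdivX zdiv)//; ring.
- by do !split; apply: contraTneq i2 => ->.
- apply: exp_inert; first by split=> *; rewrite ?simp; ring.
  move=> q; rewrite /D !dM dC dX [y1 == i]eq_sym (negPf iy).
  rewrite -(zdiv_d zdiv)// (dd i x1) /=; ring.
Qed.

(** For each rule, G is the commutator of the operator with D. *)
Lemma exp_shear : shear C X d s (C eps) e.
Proof.
split=> //; try exact: exp_inert2.
- move=> p; rewrite (push (F := fun p => X x1 * p) (G := fun p => - (C eps * (X y1 * s p)))) ?opprK//.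
  + by split=> * /=; ring.
  + by split=> *; do 2 rewrite ?simp /=; ring.
  + by move=> q; rewrite /D; do 2 rewrite ?simp /=; ring.
  + by move=> q; rewrite /D; do 2 rewrite ?simp /=; ring.
- move=> p; rewrite (push (F := fun p => X y1 * p) (G := fun p => 0)) ?subr0//.
  + by split=> * /=; ring.
  + by split=> * /=; ring.
  + by move=> q; rewrite /D; do 2 rewrite ?simp /=; ring.
  + by move=> q; rewrite /D; do 2 rewrite ?simp /=; ring.
- move=> p; rewrite (push (F := s) (G := fun p => 0)) ?subr0//.
  + by split=> * /=; ring.
  + by move=> q; rewrite /D; do 2 rewrite ?simp /=; ring.
  + by move=> q; rewrite /D; do 2 rewrite ?simp /=; ring.
- move=> p; rewrite (push (F := d x1) (G := fun p => 0)) ?subr0//.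
  + by split=> *; do 2 rewrite ?simp /=; ring.
  + by split=> * /=; ring.
  + by move=> q; rewrite /D; do 2 rewrite ?simp /=; ring.
  + by move=> q; rewrite /D; do 2 rewrite ?simp /=; ring.
- move=> p; rewrite (push (F := d y1) (G := fun p => C eps * s (d x1 p))) ?subr0//.
  + by split=> *; do 2 rewrite ?simp /=; ring.
  + by split=> *; do 2 rewrite ?simp /=; ring.
  + by move=> q; rewrite /D; do 2 rewrite ?simp /=; ring.
  + by move=> q; rewrite /D; do 2 rewrite ?simp /=; ring.
- move=> p; rewrite (push (F := zD) (G := fun p => - (C eps * (X y1 * s (d x1 p))))) ?opprK//.
  + by split=> *; rewrite /zD; do 2 rewrite ?simp /=; ring.
  + by split=> *; do 2 rewrite ?simp /=; ring.
  (* Here ring needs the relation s (z d/dz q) = z d/dz (s q) + s q, differentiated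
     by x and rewritten with s (z q) = q. *)
  + move=> q; rewrite /D /zD; do 2 rewrite ?simp ?szD' /=.
    apply/eqP; rewrite -subr_eq0; apply/eqP.
    transitivity (C eps * X y1 *
      (X z1 * d x1 (d z1 (s q)) + d x1 (s q) - d x1 (d z1 q))); first by ring.
    by rewrite -!dzx -sdx -szD' sz subrr mulr0.
  + by move=> q; rewrite /D; do 2 rewrite ?simp /=; ring.
- move=> p; rewrite (push (F := fun p => X z1 * (p + zD p)) (G := fun p => - (C eps * (X y1 * d x1 p)))) ?opprK//.
  + by split=> *; rewrite /zD; do 2 rewrite ?simp /=; ring.
  + by split=> *; do 2 rewrite ?simp /=; ring.
  + move=> q; rewrite /D /zD; do 2 rewrite ?simp ?szD' /=.
    apply/eqP; rewrite -subr_eq0; apply/eqP.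
    transitivity (C eps * X y1 * X z1 *
      (X z1 * d x1 (d z1 (s q)) + d x1 (s q) - d x1 (d z1 q))); first by ring.
    by rewrite -!dzx -sdx -szD' sz subrr mulr0.
  + by move=> q; rewrite /D; do 2 rewrite ?simp /=; ring.
Qed.

End ShearOfExponential.

(** * Rigidity of the intertwining relations *)

Section Uniqueness.
Variables (K : fieldType) (A : idomainType) (C : {rmorphism K -> A}).
Variables (X : 'I_6 -> A) (d : 'I_6 -> A -> A).
Hypothesis part : partials C X d.
Let dD := partialsD part.
Let dN := partialsN part.
Let dM := partialsM part.
Let dC := partialsC part.
Let dX := partialsX part.
Let dd := partials_comm part.
Hypothesis X_neq0 : forall i, X i != 0.

Let partials0 := partials0 part.
Let partials1 := partials1 part.

Lemma C_inj0 c p : c != 0 -> C c * p = 0 -> p = 0.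
Proof. by move=> c0 /eqP; rewrite mulf_eq0 fmorph_eq0 (negPf c0) => /eqP. Qed.

(** In L_1 = M_1^-1 D M_1 both outer factors are invertible and D is upper
    triangular with nonzero constants on its diagonal, so a column killed by
    L_1 is found to vanish from its last entry upwards. *)
Lemma lax1_vec_inj a1 a2 a3 f0 f1 f2 : a1 != 0 -> a2 != 0 -> a3 != 0 ->
  (forall i, (i < 3)%N -> lax1_vec C X d a1 a2 a3 f0 f1 f2 i = 0) ->
  [/\ f0 = 0, f1 = 0 & f2 = 0].
Proof.
move=> a1_neq0 a2_neq0 a3_neq0 l_eq0; pose w := X y1 + X x1 * X z1.
have [l0 l1 l2] := And3 (l_eq0 0 isT) (l_eq0 1 isT) (l_eq0 2 isT).
have h2 : w * f0 + X z1 * f1 + f2 = 0.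
  apply: (C_inj0 a3_neq0); transitivity
    (w * lax1_vec C X d a1 a2 a3 f0 f1 f2 0 + X z1 * lax1_vec C X d a1 a2 a3 f0 f1 f2 1 +
     lax1_vec C X d a1 a2 a3 f0 f1 f2 2).
    by rewrite /w /lax1_vec /lax_entry /=; ring.
  by rewrite l0 l1 l2 !mulr0 !addr0.
have h1 : X x1 * f0 + f1 = 0.
  apply: (C_inj0 a2_neq0); transitivity
    (X x1 * lax1_vec C X d a1 a2 a3 f0 f1 f2 0 + lax1_vec C X d a1 a2 a3 f0 f1 f2 1 -
     d z1 (w * f0 + X z1 * f1 + f2)).
    by rewrite /w /lax1_vec /lax_entry !(dD, dM, dX) /=; ring.
  by rewrite l0 l1 h2 partials0 mulr0 addr0 subr0.
have f00 : f0 = 0.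
  apply: (C_inj0 a1_neq0); transitivity
    (lax1_vec C X d a1 a2 a3 f0 f1 f2 0 - d x1 (X x1 * f0 + f1) +
     X z1 * d y1 (X x1 * f0 + f1) - d y1 (w * f0 + X z1 * f1 + f2)).
    by rewrite /w /lax1_vec /lax_entry !(dD, dM, dX) /=; ring.
  by rewrite l0 h1 h2 !partials0 mulr0 !subr0 addr0.
move: h1 h2; rewrite f00 !mulr0 !add0r => f10; rewrite f10 mulr0 add0r.
by [].
Qed.

Section Kernel.
Variables (u1 u2 u3 v3 : K) (T : A -> A).
Hypothesis TD : forall p q, T (p + q) = T p + T q.
Hypothesis TC : forall c p, T (C c * p) = C c * T p.
Hypothesis Tx2 : forall p, T (X x2 * p) = X x2 * T p.
Hypothesis Ty2 : forall p, T (X y2 * p) = X y2 * T p.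
Hypothesis Tz2 : forall p, T (X z2 * p) = X z2 * T p.
Hypothesis TE : forall p, T (opE C X d u1 u2 p) = opE C X d u1 u2 (T p).
Hypothesis TB : forall p, T (opB C X d u2 u3 p) = opB C X d u2 v3 (T p).
Hypothesis TX : forall p, T (opX C X d u1 u2 u3 p) = opX C X d u1 u2 v3 (T p).
Hypothesis T1 : T 1 = 0.
Hypothesis u12 : forall n : nat, u1 - u2 + n%:R != 0.
Hypothesis u13 : forall n : nat, u1 - u3 + n%:R != 0.
Hypothesis u23 : forall n : nat, u2 - u3 + n%:R != 0.

Let TCI c p : c != 0 -> T (C c * p) = 0 -> T p = 0.
Proof. by rewrite TC; apply: C_inj0. Qed.

Lemma d_Xn i j n : j != i -> d i (X j ^+ n) = 0.
Proof.
move=> /negPf ji; elim: n => [|n IHn]; first by rewrite expr0 partials1.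
by rewrite exprS dM dX ji IHn mul0r mulr0 addr0.
Qed.

Lemma dS_Xn i n : d i (X i ^+ n.+1) = n.+1%:R * X i ^+ n.
Proof.
elim: n => [|n IHn]; first by rewrite expr1 dX eqxx mulr1.
by rewrite exprS dM dX eqxx IHn; rewrite /= !exprS; ring.
Qed.

Lemma euler_Xn i n : X i * d i (X i ^+ n) = n%:R * X i ^+ n.
Proof.
case: n => [|n]; first by rewrite expr0 partials1 mul0r mulr0.
by rewrite dS_Xn exprS; ring.
Qed.

Let mon a b c := X x1 ^+ a * X y1 ^+ b * X z1 ^+ c.

Lemma euler_mon a b c :
  [/\ X x1 * d x1 (mon a b c) = a%:R * mon a b c,
      X y1 * d y1 (mon a b c) = b%:R * mon a b c,
      X z1 * d z1 (mon a b c) = c%:R * mon a b c &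
      d z1 (mon a b c.+1) = c.+1%:R * mon a b c].
Proof.
rewrite /mon; split.
- by rewrite !dM (d_Xn b) ?(d_Xn c)// !mulr0 !addr0 !mulrA euler_Xn; ring.
- rewrite !dM (d_Xn a) ?(d_Xn c)// !mulr0 !addr0 mul0r add0r.
  by rewrite !mulrA -[X y1 * _ * _]mulrAC euler_Xn; ring.
- rewrite !dM (d_Xn a) ?(d_Xn b)// mul0r mulr0 addr0 mul0r add0r.
  by rewrite mulrCA euler_Xn; ring.
- rewrite !dM (d_Xn a) ?(d_Xn b)// mul0r mulr0 addr0 mul0r add0r.
  by rewrite dS_Xn; ring.
Qed.

(** Induction on the degree s + 1 in x and y.  The elements E (x^a y^b z^(c+1))
    and X (x^a y^b z^c) with a + b = s are in the kernel and are combinations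
    of x^(a+1) y^b z^(c+1) and x^a y^(b+1) z^c, with determinant
    (s + u1 - u2 + 1) (s + u1 - u3 + 1).  In degree 0, B produces the powers
    of z from 1. *)
Lemma kernel_mon a b c : T (mon a b c) = 0.
Proof.
have E0 : opE C X d u1 u2 0 = 0.
  by rewrite /opE !partials0 !mulr0 !(addr0, subr0, mulr0).
have B0 : opB C X d u2 v3 0 = 0.
  by rewrite /opB !partials0 !mulr0 !(addr0, subr0, mulr0).
have X0 : opX C X d u1 u2 v3 0 = 0.
  by rewrite /opX !partials0 !mulr0 !(addr0, subr0, mulr0).
have monx a' b' c' : mon a'.+1 b' c' = X x1 * mon a' b' c'.
  by rewrite /mon exprS; ring.
have mony a' b' c' : mon a' b'.+1 c' = X y1 * mon a' b' c'.
  by rewrite /mon exprS; ring.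
have monz a' b' c' : mon a' b' c'.+1 = X z1 * mon a' b' c'.
  by rewrite /mon exprS; ring.
have [s] := ubnPeq (a + b)%N; move: a b c; elim: s => [|s IHs] a b c.
  rewrite addn_eq0 => /andP[/eqP-> /eqP->]; elim: c => [|c IHc].
    by rewrite /mon !expr0 !mulr1.
  apply: (TCI (u23 c.+1)); have [_ _ ez _] := euler_mon 0 0 c.
  have <- : opB C X d u2 u3 (mon 0 0 c) = C (u2 - u3 + c.+1%:R) * mon 0 0 c.+1.
    rewrite /opB ez monz /mon !expr0 !mul1r d_Xn//; ring.
  by rewrite TB IHc.
have det_neq0 : (s%:R + u1 - u2 + 1) * (s%:R + u1 - u3 + 1) != 0 :> K.
  rewrite mulf_neq0//.
    by rewrite (_ : _ + 1 = u1 - u2 + s.+1%:R) ?u12//; ring.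
  by rewrite (_ : _ + 1 = u1 - u3 + s.+1%:R) ?u13//; ring.
have stepE a' b' c' : (a' + b')%N = s -> T (opE C X d u1 u2 (mon a' b' c')) = 0.
  by move=> /eqP ab; rewrite TE IHs.
have stepX a' b' c' : (a' + b')%N = s ->
    T (opX C X d u1 u2 u3 (mon a' b' c')) = 0.
  by move=> /eqP ab; rewrite TX IHs.
case: a => [|a]; [case: b => [//|b]|].
  rewrite add0n eqSS => /eqP bs; apply: (TCI det_neq0).
  have [ex ey ez dz] := euler_mon 0 b c.
  have [ex' ey' ez' _] := euler_mon 0 b c.+1.
  (* Cramer's rule for the 2 x 2 system, here solved for y^(b+1) z^c. *)
  have -> : C ((s%:R + u1 - u2 + 1) * (s%:R + u1 - u3 + 1)) * mon 0 b.+1 c =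
     C (s%:R + u1 - u2 - c%:R) * opX C X d u1 u2 u3 (mon 0 b c) +
     C (u3 - u2 - c.+1%:R) * opE C X d u1 u2 (mon 0 b c.+1).
    rewrite /opX /opE ex ey ez ex' ey' ez' dz mony monz -bs; ring.
  by rewrite TD !TC stepE ?stepX ?mulr0 ?addr0.
rewrite addSn eqSS => /eqP abs; case: c => [|c].
  apply: (TCI (u12 s.+1)); have [ex ey ez _] := euler_mon a b 0.
  have <- : opE C X d u1 u2 (mon a b 0) =
      C (u1 - u2 + s.+1%:R) * mon a.+1 b 0.
    have dz0 : d z1 (mon a b 0) = 0.
      by rewrite /mon expr0 mulr1 dM !d_Xn// mul0r mulr0 addr0.
    by rewrite /opE ex ey dz0 monx -abs; ring.
  exact: stepE.
apply: (TCI det_neq0).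
have [ex ey ez dz] := euler_mon a b c.
have [ex' ey' ez' _] := euler_mon a b c.+1.
(* Cramer's rule for the other unknown, x^(a+1) y^b z^(c+1). *)
have -> : C ((s%:R + u1 - u2 + 1) * (s%:R + u1 - u3 + 1)) * mon a.+1 b c.+1 =
   C (s%:R + u1 - u3 + 2 + c%:R) * opE C X d u1 u2 (mon a b c.+1) +
   C c.+1%:R * opX C X d u1 u2 u3 (mon a b c).
  rewrite /opX /opE ex ey ez ex' ey' ez' dz monx monz -abs; ring.
by rewrite TD !TC stepE ?stepX ?mulr0 ?addr0.
Qed.

Lemma kernel_full a b c a' b' c' :
  T (X x1 ^+ a * X y1 ^+ b * X z1 ^+ c * (X x2 ^+ a' * X y2 ^+ b' * X z2 ^+ c')) = 0.
Proof.
rewrite mulrC -/(mon a b c) -!mulrA; move: (mon a b c) (kernel_mon a b c) => m Tm.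
elim: a' => [|n IHn]; last by rewrite exprS -mulrA Tx2 IHn mulr0.
elim: b' => [|n IHn] in m Tm *; last first.
  by rewrite expr0 mul1r exprS -mulrA Ty2 -[X in T X]mul1r -(expr0 (X x2)) IHn ?mulr0.
elim: c' => [|n IHn]; first by rewrite !expr0 !mul1r.
by move: IHn; rewrite !expr0 !mul1r exprS -mulrA Tz2 => ->; rewrite mulr0.
Qed.
End Kernel.

Section Rigidity.
Variables (u1 u2 u3 v1 v2 v3 : K) (T : A -> A).
Hypothesis TD : forall p q, T (p + q) = T p + T q.
Hypothesis TN : forall p, T (- p) = - T p.
Hypothesis TC : forall c p, T (C c * p) = C c * T p.
Hypothesis u1_neq0 : u1 != 0.
Hypothesis u2_neq0 : u2 != 0.
Hypothesis u3_neq0 : u3 != 0.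
Hypothesis v3_neq0 : v3 != 0.
Let solves w1 w2 := forall i j p, (i < 3)%N -> (j < 3)%N ->
  T (lax_conj C X d u1 u2 u3 w1 w2 v3 i j p) = lax_conj C X d u1 u2 v3 w1 w2 u3 i j (T p).
(* T does not depend on v1 and v2, so it solves the equations at nearby
   parameters too; differences of these equations isolate single entries. *)
Hypothesis T00 : solves v1 v2.
Hypothesis T10 : solves (v1 + 1) v2.
Hypothesis T01 : solves v1 (v2 + 1).

(* T maps the image of the column f under M_2^-1 L_1(u1, u2, u3) to the image
   of g under M_2^-1 L_1(u1, u2, v3).  By injectivity f determines g. *)
Let inter f0 f1 f2 g0 g1 g2 := forall i, (i < 3)%N ->
  T (lower_inv X (lax1_vec C X d u1 u2 u3 f0 f1 f2) i) = lower_inv X (lax1_vec C X d u1 u2 v3 g0 g1 g2) i.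

Lemma lax_conj_vecB a1 a2 a3 f0 f1 f2 g0 g1 g2 i : (i < 3)%N ->
  lower_inv X (lax1_vec C X d a1 a2 a3 (f0 - g0) (f1 - g1) (f2 - g2)) i =
  lower_inv X (lax1_vec C X d a1 a2 a3 f0 f1 f2) i - lower_inv X (lax1_vec C X d a1 a2 a3 g0 g1 g2) i.
Proof.
have lvB k : (k < 3)%N -> lax1_vec C X d a1 a2 a3 (f0 - g0) (f1 - g1) (f2 - g2) k =
    lax1_vec C X d a1 a2 a3 f0 f1 f2 k - lax1_vec C X d a1 a2 a3 g0 g1 g2 k.
  by case: k => [|[|[|//]]] _; rewrite /lax1_vec /lax_entry /= ?(dD, dN); ring.
case: i => [|[|[|//]]] _; rewrite /lower_inv /= !lvB//; ring.
Qed.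

Lemma lax_conj_vecC a1 a2 a3 c f0 f1 f2 i : (i < 3)%N ->
  lower_inv X (lax1_vec C X d a1 a2 a3 (C c * f0) (C c * f1) (C c * f2)) i =
  C c * lower_inv X (lax1_vec C X d a1 a2 a3 f0 f1 f2) i.
Proof.
have lvC k : (k < 3)%N -> lax1_vec C X d a1 a2 a3 (C c * f0) (C c * f1) (C c * f2) k =
    C c * lax1_vec C X d a1 a2 a3 f0 f1 f2 k.
  by case: k => [|[|[|//]]] _; rewrite /lax1_vec /lax_entry /= ?(dM, dC); ring.
case: i => [|[|[|//]]] _; rewrite /lower_inv /= !lvC//; ring.
Qed.

Lemma interB f0 f1 f2 g0 g1 g2 f0' f1' f2' g0' g1' g2' :
  inter f0 f1 f2 g0 g1 g2 -> inter f0' f1' f2' g0' g1' g2' ->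
  inter (f0 - f0') (f1 - f1') (f2 - f2') (g0 - g0') (g1 - g1') (g2 - g2').
Proof. by move=> If If' i i3; rewrite !lax_conj_vecB// TD TN If// If'. Qed.

Lemma interC c f0 f1 f2 g0 g1 g2 : inter f0 f1 f2 g0 g1 g2 ->
  inter (C c * f0) (C c * f1) (C c * f2) (C c * g0) (C c * g1) (C c * g2).
Proof. by move=> If i i3; rewrite !lax_conj_vecC// TC If. Qed.

Lemma lower_inv_inj (g : nat -> A) : (forall i, (i < 3)%N -> lower_inv X g i = 0) ->
  forall i, (i < 3)%N -> g i = 0.
Proof.
move=> g0; have [h0 h1 h2] := And3 (g0 0 isT) (g0 1 isT) (g0 2 isT).
rewrite /lower_inv /= in h0 h1 h2; rewrite h0 mulr0 subr0 in h1.
by rewrite h0 h1 !mulr0 !subr0 in h2; case=> [|[|[|]]].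
Qed.

Lemma inter_uniq f0 f1 f2 g0 g1 g2 g0' g1' g2' :
  inter f0 f1 f2 g0 g1 g2 -> inter f0 f1 f2 g0' g1' g2' ->
  [/\ g0 = g0', g1 = g1' & g2 = g2'].
Proof.
move=> If If'; suff [/eqP e0 /eqP e1 /eqP e2] :
  [/\ g0 - g0' = 0, g1 - g1' = 0 & g2 - g2' = 0].
  by split; apply/eqP; rewrite -subr_eq0.
apply: (lax1_vec_inj u1_neq0 u2_neq0 v3_neq0); apply: lower_inv_inj => i i3.
by rewrite lax_conj_vecB// -If// -If'// subrr.
Qed.

Let interE f0 f1 f2 g0 g1 g2 f0' f1' f2' g0' g1' g2' :
  inter f0 f1 f2 g0 g1 g2 -> f0 = f0' -> f1 = f1' -> f2 = f2' ->
  g0 = g0' -> g1 = g1' -> g2 = g2' -> inter f0' f1' f2' g0' g1' g2'.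
Proof. by move=> If <- <- <- <- <- <-. Qed.

(** v1 occurs only in the first entry of the first column of F(v) M_2. *)
Lemma inter_e1 p : inter p 0 0 (T p) 0 0.
Proof.
have I10 : inter _ _ _ _ _ _ := fun i i3 => T10 p i3 (isT : (0 < 3)%N).
have I00 : inter _ _ _ _ _ _ := fun i i3 => T00 p i3 (isT : (0 < 3)%N).
by apply: (interE (interB I10 I00)); rewrite /lax2_col /lower_col /=; ring.
Qed.

(** v2 occurs in the second entry of the second column, where it multiplies p,
    and of the first column, where it multiplies x2 p: comparing the two cases
    gives the commutation with x2. *)
Lemma inter_e2 p : inter 0 p 0 0 (T p) 0.
Proof.
have I10 : inter _ _ _ _ _ _ := fun i i3 => T01 p i3 (isT : (1 < 3)%N).
have I00 : inter _ _ _ _ _ _ := fun i i3 => T00 p i3 (isT : (1 < 3)%N).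
by apply: (interE (interB I10 I00)); rewrite /lax2_col /lower_col /=; ring.
Qed.

Lemma inter_e2x p : inter 0 (X x2 * p) 0 0 (X x2 * T p) 0.
Proof.
have I10 : inter _ _ _ _ _ _ := fun i i3 => T01 p i3 (isT : (0 < 3)%N).
have I00 : inter _ _ _ _ _ _ := fun i i3 => T00 p i3 (isT : (0 < 3)%N).
by apply: (interE (interB I10 I00)); rewrite /lax2_col /lower_col /=; ring.
Qed.

Lemma rigid_x2 p : T (X x2 * p) = X x2 * T p.
Proof. by have [] := inter_uniq (inter_e2 (X x2 * p)) (inter_e2x p). Qed.

(** This and the next two lemmas are what remains of the three columns of
    F(v) M_2 once the terms with v1 and v2 are removed. *)
Lemma inter_col3 p : inter (U13 d p) (U23 X d p) (C v3 * p)
  (U13 d (T p)) (U23 X d (T p)) (C u3 * T p).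
Proof.
have I : inter _ _ _ _ _ _ := fun i i3 => T00 p i3 (isT : (2 < 3)%N).
by apply: (interE I); rewrite /lax2_col /lower_col /= /U12 ?partials0; ring.
Qed.

Lemma inter_col2 p :
  inter (U12 X d p + U13 d (X z2 * p)) (U23 X d (X z2 * p)) (C v3 * (X z2 * p))
    (U12 X d (T p) + U13 d (X z2 * T p)) (U23 X d (X z2 * T p))
    (C u3 * (X z2 * T p)).
Proof.
have I : inter _ _ _ _ _ _ := fun i i3 => T00 p i3 (isT : (1 < 3)%N).
apply: (interE (interB I (interC v2 (inter_e2 p))));
  rewrite /lax2_col /lower_col /=; ring.
Qed.

Lemma inter_col1 p :
  let w q := (X y2 + X x2 * X z2) * q in
  inter (U12 X d (X x2 * p) + U13 d (w p)) (U23 X d (w p)) (C v3 * w p)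
    (U12 X d (X x2 * T p) + U13 d (w (T p))) (U23 X d (w (T p))) (C u3 * w (T p)).
Proof.
have I : inter _ _ _ _ _ _ := fun i i3 => T00 p i3 (isT : (0 < 3)%N).
apply: (interE (interB (interB I (interC v1 (inter_e1 p)))
  (interC v2 (inter_e2x p)))); rewrite /lax2_col /lower_col /=; ring.
Qed.

(** The first column minus x2 times the second is y2 times the third one. *)
Lemma rigid_y2 p : T (X y2 * p) = X y2 * T p.
Proof.
have I := interB (inter_col1 p) (inter_col2 (X x2 * p)).
have J : inter (U13 d (X y2 * p)) (U23 X d (X y2 * p)) (C v3 * (X y2 * p))
   (U13 d (X y2 * T p)) (U23 X d (X y2 * T p)) (C u3 * (X y2 * T p)).
  by apply: (interE I); rewrite /= ?rigid_x2 /U13 /U23 ?(dD, dM); ring.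
have [_ _ /(mulfI _)->//] := inter_uniq (inter_col3 (X y2 * p)) J.
by rewrite fmorph_eq0.
Qed.

(** The second column is z2 times the third, up to a term U12 in its first
    entry.  Uniqueness of g also shows that T commutes with U12. *)
Lemma rigid_z2 p : T (X z2 * p) = X z2 * T p /\ T (U12 X d p) = U12 X d (T p).
Proof.
have I := interB (inter_col2 p) (inter_e1 (U12 X d p)).
have J : inter (U13 d (X z2 * p)) (U23 X d (X z2 * p)) (C v3 * (X z2 * p))
   (U12 X d (T p) + U13 d (X z2 * T p) - T (U12 X d p)) (U23 X d (X z2 * T p)) (C u3 * (X z2 * T p)).
  by apply: (interE I); ring.
have [e0 _ /(mulfI _) e2] := inter_uniq (inter_col3 (X z2 * p)) J.
have {}e2 : T (X z2 * p) = X z2 * T p by apply: e2; rewrite fmorph_eq0.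
split=> //; move: e0; rewrite e2 addrAC -[LHS]add0r => /addIr /eqP.
by rewrite eq_sym subr_eq0 => /eqP.
Qed.

Lemma inter_lax1_vec f0 f1 f2 g0 g1 g2 i : inter f0 f1 f2 g0 g1 g2 -> (i < 3)%N ->
  T (lax1_vec C X d u1 u2 u3 f0 f1 f2 i) = lax1_vec C X d u1 u2 v3 g0 g1 g2 i.
Proof.
move=> If; have [I0 I1 I2] := And3 (If 0 isT) (If 1 isT) (If 2 isT).
rewrite /lower_inv /= in I0 I1 I2.
have {}I1 : T (lax1_vec C X d u1 u2 u3 f0 f1 f2 1) = lax1_vec C X d u1 u2 v3 g0 g1 g2 1.
  by move: I1; rewrite TD TN rigid_x2 I0 => /addIr.
have T3 a b c : T (a - b - c) = T a - T b - T c by rewrite !(TD, TN).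
have {}I2 : T (lax1_vec C X d u1 u2 u3 f0 f1 f2 2) = lax1_vec C X d u1 u2 v3 g0 g1 g2 2.
  by move: I2; rewrite T3 rigid_y2 (rigid_z2 _).1 I0 I1 => /addIr /addIr.
by case: i => [|[|[|]]].
Qed.

Let opl (a : K) q :
  [/\ lax_entry C X d x1 y1 z1 u1 u2 a 1 0 q = - opE C X d u1 u2 q,
     lax_entry C X d x1 y1 z1 u1 u2 a 2 0 q = - opX C X d u1 u2 a q &
     lax_entry C X d x1 y1 z1 u1 u2 a 2 1 q = - opB C X d u2 a q].
Proof. by rewrite /lax_entry /opE /opX /opB; split=> /=; ring. Qed.

Let lax1_vec_e1 (a : K) i q : (i < 3)%N ->
  lax1_vec C X d u1 u2 a q 0 0 i = lax_entry C X d x1 y1 z1 u1 u2 a i 0 q.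
Proof.
by case: i => [|[|[|]]]//= _; rewrite /lax1_vec /lax_entry /= !partials0; ring.
Qed.

Let lax1_vec_e2 (a : K) i q : (i < 3)%N ->
  lax1_vec C X d u1 u2 a 0 q 0 i = lax_entry C X d x1 y1 z1 u1 u2 a i 1 q.
Proof.
by case: i => [|[|[|]]]//= _; rewrite /lax1_vec /lax_entry /= !partials0; ring.
Qed.

Lemma rigid_lax i k p : (i < 3)%N -> (k < 2)%N ->
  T (lax_entry C X d x1 y1 z1 u1 u2 u3 i k p) = lax_entry C X d x1 y1 z1 u1 u2 v3 i k (T p).
Proof.
move=> i3; case: k => [|[|//]] _.
  by rewrite -!lax1_vec_e1// (inter_lax1_vec (inter_e1 p)).
by rewrite -!lax1_vec_e2// (inter_lax1_vec (inter_e2 p)).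
Qed.

Lemma rigid_E p : T (opE C X d u1 u2 p) = opE C X d u1 u2 (T p).
Proof.
by apply: oppr_inj; rewrite -TN; case: (opl u3 p) (opl v3 (T p)) => <- _ _ [<- _ _]; exact: rigid_lax.
Qed.

Lemma rigid_X p : T (opX C X d u1 u2 u3 p) = opX C X d u1 u2 v3 (T p).
Proof.
by apply: oppr_inj; rewrite -TN; case: (opl u3 p) (opl v3 (T p)) => _ <- _ [_ <- _]; exact: rigid_lax.
Qed.

Lemma rigid_B p : T (opB C X d u2 u3 p) = opB C X d u2 v3 (T p).
Proof.
by apply: oppr_inj; rewrite -TN; case: (opl u3 p) (opl v3 (T p)) => _ _ <- [_ _ <-]; exact: rigid_lax.
Qed.

(** Applied to 1, the intertwining of the entries (1, 2), (2, 2) and (1, 1) of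
    L_1 gives the derivatives with respect to x1, z1 and y1; the third column
    and U12 give the others. *)
Lemma rigid_one i : d i (T 1) = 0.
Proof.
have T0 : T 0 = 0 by have := TC 0 0; rewrite rmorph0 !mul0r.
have TC1 c : T (C c) = C c * T 1 by rewrite -[in LHS](mulr1 (C c)) TC.
have fx : d x1 (T 1) = 0.
  have : T (d x1 1) = d x1 (T 1) := rigid_lax 1 (isT : (0 < 3)%N) (isT : (1 < 2)%N).
  by rewrite partials1 T0.
have fz : d z1 (T 1) = 0.
  have := rigid_lax 1 (isT : (1 < 3)%N) (isT : (1 < 2)%N).
  rewrite /lax_entry /= !partials1 fx !mulr0 !subr0 addr0 mulr1 TC1 -[LHS]addr0.
  by move=> /addrI /esym /eqP; rewrite mulf_eq0 (negPf (X_neq0 _)) => /eqP.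
have fy : d y1 (T 1) = 0.
  have := rigid_lax 1 (isT : (0 < 3)%N) (isT : (0 < 2)%N).
  rewrite /lax_entry /= !partials1 fx !mulr0 !addr0 mulr1 TC1 -[LHS]addr0.
  by move=> /addrI /esym /eqP; rewrite mulf_eq0 (negPf (X_neq0 _)) => /eqP.
have I : inter 0 0 (C v3) (d y2 (T 1)) (d z2 (T 1)) (C u3 * T 1).
  apply: (interE (inter_col3 1)); rewrite /U13 /U23 ?partials1 ?fx ?fy ?fz; ring.
have L (a b : K) q : [/\ lax1_vec C X d u1 u2 a 0 0 (C b * q) 0 = C b * d y1 q,
     lax1_vec C X d u1 u2 a 0 0 (C b * q) 1 = C b * (d z1 q - X x1 * d y1 q) &
     lax1_vec C X d u1 u2 a 0 0 (C b * q) 2 =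
       C b * (C a * q - X y1 * d y1 q - X z1 * d z1 q)].
  by split; rewrite /lax1_vec /lax_entry /= !(partials0, dM, dC); ring.
have J i' : (i' < 3)%N ->
    T (lax1_vec C X d u1 u2 u3 0 0 (C v3) i') = lax1_vec C X d u1 u2 v3 0 0 (C u3 * T 1) i'.
  have [] := L u3 v3 1; have [] := L v3 u3 (T 1).
  rewrite mulr1 fy fz !partials1 !mulr0 !subr0 !mulr0 mulr1.
  case: i' => [|[|[|]]]//=; rewrite 1?mulrA => e0 e1 e2 e0' e1' e2' _.
  - by rewrite e0 e0' T0.
  - by rewrite e1 e1' T0.
  - by rewrite e2 e2' TC TC1 mulrCA mulrA.
have [fy2 fz2 _] : [/\ d y2 (T 1) = 0, d z2 (T 1) = 0 & C u3 * T 1 = C u3 * T 1].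
  apply: (inter_uniq I) => k k3; move: I => _.
  have [T3 T3'] : (forall a b, T (a - b) = T a - T b) /\ (forall a b c, T (a - b - c) = T a - T b - T c).
    by split=> *; rewrite !(TD, TN).
  case: k k3 => [|[|[|//]]] _; rewrite /lower_inv /=.
  - exact: J.
  - by rewrite T3 rigid_x2 !J.
  - by rewrite T3' rigid_y2 (rigid_z2 _).1 !J.
have fx2 : d x2 (T 1) = 0.
  have := (rigid_z2 1).2; rewrite /U12 !partials1 fx fy2 !mulr0 !subr0 T0.
  by move=> <-.
by case: i => [] [|[|[|[|[|[|//]]]]]] i6; rewrite (bool_irrelevance i6 isT).
Qed.

(** The difference of T and a multiple of M satisfies the relations of E, B and
    X, and kills 1. *)
Lemma rigid_unique (M : A -> A) (c0 c1 : K) :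
  intertwiner C X d u1 u2 u3 v3 M -> M 1 = C c0 -> c0 != 0 -> T 1 = C c1 ->
  (forall n : nat, u1 - u2 + n%:R != 0) ->
  (forall n : nat, u1 - u3 + n%:R != 0) ->
  (forall n : nat, u2 - u3 + n%:R != 0) ->
  forall a b c a' b' c',
    let m := X x1 ^+ a * X y1 ^+ b * X z1 ^+ c *
      (X x2 ^+ a' * X y2 ^+ b' * X z2 ^+ c') in
    T m = C (c1 / c0) * M m.
Proof.
move=> M_it M1 c0_neq0 T1 u12 u13 u23 a b c a' b' c' m.
have [[MD MN MC] [MX _] _ _ _ ME MB _] := M_it.
have MXop := intertwine_opX part M_it.
set k := C (c1 / c0); pose D p := T p - k * M p.
have EB p q : opE C X d u1 u2 (p - k * q) =
    opE C X d u1 u2 p - k * opE C X d u1 u2 q.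
  by rewrite /opE !(dD, dN, dM, dC); ring.
have BB v p q : opB C X d u2 v (p - k * q) =
    opB C X d u2 v p - k * opB C X d u2 v q.
  by rewrite /opB !(dD, dN, dM, dC); ring.
have XB v p q : opX C X d u1 u2 v (p - k * q) =
    opX C X d u1 u2 v p - k * opX C X d u1 u2 v q.
  by rewrite /opX !(dD, dN, dM, dC); ring.
suff : D m = 0 by move=> /eqP; rewrite subr_eq0 => /eqP.
rewrite /m; apply: (@kernel_full u1 u2 u3 v3 D) => //; rewrite /D.
- by move=> p q; rewrite TD MD; ring.
- by move=> e p; rewrite TC MC; ring.
- by move=> p; rewrite rigid_x2 MX//; ring.
- by move=> p; rewrite rigid_y2 MX//; ring.
- by move=> p; rewrite (rigid_z2 p).1 MX//; ring.
- by move=> p; rewrite rigid_E ME EB.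
- by move=> p; rewrite rigid_B MB BB.
- by move=> p; rewrite rigid_X MXop XB.
- by rewrite T1 M1 /k -rmorphM divfK ?subrr.
Qed.
End Rigidity.
End Uniqueness.

(** * Linear maps on polynomials *)

Section Monomials.
Variable R : realType.
Local Notation pols := (pols R).
Local Notation C := (@mpolyC 6 R[i]).
Local Notation X := (fun i : 'I_6 => 'X_i : pols).
Local Notation d := (@mderiv 6 R[i]).

Lemma pols_dX i j : d i ('X_j : pols) = (j == i)%:R.
Proof.
rewrite mderivX mnm1E; case: eqP => [->|_]; last by rewrite scale0r.
rewrite scale1r -mpolyX0; congr 'X_[_].
by apply/mnmP => k; rewrite mnmBE subnn mnm0E.
Qed.

Lemma pols_const (p : pols) : (forall i, d i p = 0) -> exists c, p = C c.
Proof.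
move=> dp; exists p@_0%MM; apply/mpolyP => m; rewrite mcoeffC.
have [->|m0] := eqVneq m 0%MM; first by rewrite mulr1.
rewrite mulr0; have [i mi] : exists i, m i != 0%N.
  apply/existsP; apply: contraR m0 => /existsPn m0; apply/eqP/mnmP => i.
  by have /negPn/eqP-> := m0 i; rewrite mnm0E.
have mE : (m = m - U_(i) + U_(i))%MM.
  by rewrite submK// lep1mP.
have := congr1 (mcoeff (m - U_(i))%MM) (dp i).
rewrite mcoeff_deriv mcoeff0 -mE => /eqP.
by rewrite -mulr_natl mulf_eq0 pnatr_eq0 => /eqP.
Qed.

Section MonomialLift.
Variable V : lmodType R[i].
Implicit Types h : 'X_{1..6} -> V.

Definition monlift h (p : pols) : V := \sum_(m <- msupp p) p@_m *: h m.

Lemma monlift_widen h (s : seq 'X_{1..6}) p : uniq s -> {subset msupp p <= s} ->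
  monlift h p = \sum_(m <- s) p@_m *: h m.
Proof.
move=> s_uniq sub; rewrite /monlift [RHS](bigID (mem (msupp p)))/=.
rewrite [X in _ = _ + X]big1 ?addr0; last first.
  by move=> m /memN_msupp_eq0->; rewrite scale0r.
rewrite -[RHS]big_filter; apply: perm_big; apply: uniq_perm => //.
- exact: filter_uniq.
- by move=> m; rewrite mem_filter; case: (boolP (m \in msupp p)) => // /sub->.
Qed.

Lemma monlift_linear h : linear (monlift h).
Proof.
move=> a p q; pose s := undup (msupp p ++ msupp q ++ msupp (a *: p + q)).
have s_uniq : uniq s by apply: undup_uniq.
rewrite !(@monlift_widen h s)//; try by
  move=> m mp; rewrite mem_undup !mem_cat mp ?orbT.
rewrite scaler_sumr -big_split; apply: eq_bigr => m _ /=.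
by rewrite mcoeffD mcoeffZ scalerDl scalerA.
Qed.

Lemma monlift_X h m : monlift h 'X_[m] = h m.
Proof. by rewrite /monlift msuppX big_seq1 mcoeffX eqxx scale1r. Qed.

Lemma linear_monomial_ext (f g : pols -> V) : linear f -> linear g ->
  (forall m, f 'X_[m] = g 'X_[m]) -> f =1 g.
Proof.
move=> flin glin fg p.
pose F : {linear pols -> V} := HB.pack f (GRing.isLinear.Build _ _ _ _ f flin).
pose G : {linear pols -> V} := HB.pack g (GRing.isLinear.Build _ _ _ _ g glin).
rewrite -[f]/(F : _ -> _) -[g]/(G : _ -> _) [p]mpolyE !linear_sum.
by apply: eq_bigr => m _; rewrite !linearZ /= fg.
Qed.
End MonomialLift.

Lemma scalar_linearP (f : pols -> pols) : scalar_linear C f <-> linear f.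
Proof.
split=> [[fD _ fC] a p q|flin]; first by rewrite -!mul_mpolyC fD fC.
pose F : {linear pols -> pols} := HB.pack f (GRing.isLinear.Build _ _ _ _ f flin).
rewrite -[f]/(F : _ -> _); split=> *; rewrite ?mul_mpolyC.
- exact: linearD.
- exact: linearN.
- exact: linearZ.
Qed.

Lemma pols_locnil (D : {linear pols -> pols}) :
  (forall m, exists n, iter n D 'X_[m] = 0) -> locnil D.
Proof.
move=> nilX p; rewrite [p]mpolyE.
elim: (msupp p) => [|m s [n IHn]]; first by exists 0%N; rewrite big_nil.
rewrite big_cons; have [k Dk] := nilX m; exists (maxn n k).
rewrite iter_linear (iter_eq0_le (leq_maxr n k) Dk) scaler0 add0r.
exact: iter_eq0_le (leq_maxl n k) IHn.
Qed.

Lemma expop_push (D : {linear pols -> pols}) (F G : pols -> pols) : locnil D ->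
  scalar_linear C F -> scalar_linear C G ->
  (forall p, F (D p) = D (F p) + G p) -> (forall p, G (D p) = D (G p)) ->
  forall p, expop D (F p) = F (expop D p) - G (expop D p).
Proof.
move=> nilD /scalar_linearP Flin /scalar_linearP Glin FD GD p.
pose F' : {linear pols -> pols} := HB.pack F (GRing.isLinear.Build _ _ _ _ F Flin).
pose G' : {linear pols -> pols} := HB.pack G (GRing.isLinear.Build _ _ _ _ G Glin).
exact: (@expop_conjV _ _ D F' G').
Qed.

Lemma prod6 (A : comNzRingType) (F : 'I_6 -> A) :
  \prod_i F i = F x1 * F y1 * F z1 * (F x2 * F y2 * F z2).
Proof.
have fE i : F i = F (inord i) by rewrite inord_val.
rewrite (eq_bigr _ (fun i _ => fE i)) -(big_mkord xpredT (fun i => F (inord i))).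
rewrite /index_iota /= !big_cons big_nil mulr1 !mulrA.
by do !congr (_ * _); congr F; apply: val_inj; rewrite /= inordK.
Qed.

Lemma mpolyX6 (m : 'X_{1..6}) : 'X_[m] =
  'X_x1 ^+ m x1 * 'X_y1 ^+ m y1 * 'X_z1 ^+ m z1 *
  ('X_x2 ^+ m x2 * 'X_y2 ^+ m y2 * 'X_z2 ^+ m z2) :> pols.
Proof. by rewrite mpolyXE_id prod6. Qed.

End Monomials.

(** * Diagonal operators and division by z *)

Section DivisionByZ.
Variable R : realType.
Local Notation pols := (pols R).
Local Notation d := (@mderiv 6 R[i]).
Implicit Types (p : pols) (m : 'X_{1..6}) (h : nat -> R[i]).

Lemma mcoeff_mulX i p m :
  ('X_i * p)@_m = if m i == 0%N then 0 else p@_(m - U_(i)).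
Proof.
rewrite mulrC; case: eqP => [mi|/eqP mi]; last first.
  have mE : (m - U_(i) + U_(i))%MM = m by rewrite submK// lep1mP.
  by rewrite -[in LHS]mE addmC mcoeffMX.
apply/eqP; rewrite mcoeff_eq0 (perm_mem (msuppMX _ _)).
apply/mapP => -[m' _ mE]; move: mi.
by rewrite mE mnmDE mnm1E eqxx.
Qed.

Lemma mcoeff_euler i p m : ('X_i * d i p)@_m = (m i)%:R * p@_m.
Proof.
rewrite mcoeff_mulX; case: eqP => [->|/eqP mi]; first by rewrite mul0r.
rewrite mcoeff_deriv submK ?lep1mP// mnmBE mnm1E eqxx subn1 prednK ?lt0n//.
by rewrite mulr_natl.
Qed.

Definition diagop (k : 'I_6) h : pols -> pols :=
  monlift (fun m => h (m k) *: 'X_[m] : pols).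

Definition divz : pols -> pols :=
  monlift (fun m => if m z1 == 0%N then 0 else 'X_[m - U_(z1)] : pols).

Lemma mcoeff_monlift (g : 'X_{1..6} -> pols) p m :
  (monlift g p)@_m = \sum_(m' <- msupp p) p@_m' * (g m')@_m.
Proof.
by rewrite /monlift raddf_sum; apply: eq_bigr => m' _ /=; rewrite mcoeffZ.
Qed.

Lemma sum_msupp_delta p m (f : 'X_{1..6} -> R[i]) :
  (forall m', m' != m -> f m' = 0) -> \sum_(m' <- msupp p) p@_m' * f m' = p@_m * f m.
Proof.
move=> f0; have [mp|mp] := boolP (m \in msupp p).
  rewrite (bigD1_seq m)//= big1 ?addr0// => m' /f0->; exact: mulr0.
rewrite (memN_msupp_eq0 mp) mul0r big_seq big1// => m' m'p.
by rewrite f0 ?mulr0//; apply: contraNneq mp => <-.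
Qed.

Lemma mcoeff_diagop k h p m : (diagop k h p)@_m = h (m k) * p@_m.
Proof.
rewrite mcoeff_monlift (@sum_msupp_delta p m) => [|m' m'm].
  by rewrite mcoeffZ mcoeffX eqxx mulr1 mulrC.
by rewrite mcoeffZ mcoeffX (negPf m'm) mulr0.
Qed.

Lemma mcoeff_divz p m : (divz p)@_m = p@_(m + U_(z1)).
Proof.
rewrite mcoeff_monlift (@sum_msupp_delta p (m + U_(z1))%MM) => [|m' m'm].
  rewrite mnmDE mnm1E eqxx addn1 /= mcoeffX addmK eqxx mulr1 //.
case: eqP => [_|/eqP m'z]; first by rewrite mcoeff0.
rewrite mcoeffX; case: eqP => [mE|//].
by case/eqP: m'm; rewrite -mE submK ?lep1mP.
Qed.

Lemma diagop_linear k h : linear (diagop k h).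
Proof. exact: monlift_linear. Qed.

Lemma divz_linear : linear divz. Proof. exact: monlift_linear. Qed.

Lemma eq_diagop k h h' p : h =1 h' -> diagop k h p = diagop k h' p.
Proof. by move=> hh'; apply/mpolyP => m; rewrite !mcoeff_diagop hh'. Qed.

Lemma diagop_comp k h h' p :
  diagop k h (diagop k h' p) = diagop k (fun n => h n * h' n) p.
Proof. by apply/mpolyP => m; rewrite !mcoeff_diagop mulrA. Qed.

Lemma diagop_mulX i k h p : i != k -> diagop k h ('X_i * p) = 'X_i * diagop k h p.
Proof.
move=> ik; apply/mpolyP => m; rewrite mcoeff_diagop !mcoeff_mulX.
case: eqP => _; first by rewrite mulr0.
by rewrite mcoeff_diagop mnmBE mnm1E (negPf ik) subn0.
Qed.

Lemma diagop_deriv i k h p : i != k -> diagop k h (d i p) = d i (diagop k h p).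
Proof.
move=> ik; apply/mpolyP => m; rewrite mcoeff_diagop !mcoeff_deriv.
by rewrite mcoeff_diagop mnmDE mnm1E (negPf ik) addn0 mulrnAr.
Qed.

Lemma diagop_mulX_diag k h p :
  diagop k h ('X_k * p) = 'X_k * diagop k (fun n => h n.+1) p.
Proof.
apply/mpolyP => m; rewrite mcoeff_diagop !mcoeff_mulX.
case: eqP => [_|/eqP mk]; first by rewrite mulr0.
by rewrite mcoeff_diagop mnmBE mnm1E eqxx subn1 prednK ?lt0n.
Qed.

Lemma deriv_diagop k h p :
  d k (diagop k h p) = diagop k (fun n => h n.+1) (d k p).
Proof.
apply/mpolyP => m; rewrite mcoeff_diagop !mcoeff_deriv mcoeff_diagop.
by rewrite mnmDE mnm1E eqxx addn1 mulrnAr.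
Qed.

Lemma euler_diagop k p : 'X_k * d k p = diagop k (fun n => n%:R) p.
Proof. by apply/mpolyP => m; rewrite mcoeff_euler mcoeff_diagop. Qed.

Lemma scale_diagop k c p : c%:MP_[6] * p = diagop k (fun=> c) p.
Proof. by apply/mpolyP => m; rewrite mcoeffCM mcoeff_diagop. Qed.

Lemma add_diagop k h h' p :
  diagop k h p + diagop k h' p = diagop k (fun n => h n + h' n) p.
Proof. by apply/mpolyP => m; rewrite mcoeffD !mcoeff_diagop mulrDl. Qed.

Lemma divz_diagop h p : divz (diagop z1 h p) = diagop z1 (fun n => h n.+1) (divz p).
Proof.
apply/mpolyP => m; rewrite mcoeff_diagop !mcoeff_divz mcoeff_diagop.
by rewrite mnmDE mnm1E eqxx addn1.
Qed.

Lemma divz_diagop_other k h p : k != z1 -> divz (diagop k h p) = diagop k h (divz p).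
Proof.
move=> kz; apply/mpolyP => m; rewrite mcoeff_diagop !mcoeff_divz mcoeff_diagop.
by rewrite mnmDE mnm1E [z1 == k]eq_sym (negPf kz) addn0.
Qed.

Lemma divz_mulz p : divz ('X_z1 * p) = p.
Proof.
apply/mpolyP => m; rewrite mcoeff_divz mcoeff_mulX mnmDE mnm1E eqxx addn1 /=.
by rewrite addmK.
Qed.

Lemma divz_mulX i p : i != z1 -> divz ('X_i * p) = 'X_i * divz p.
Proof.
move=> iz; apply/mpolyP => m; rewrite mcoeff_divz !mcoeff_mulX mcoeff_divz.
rewrite mnmDE mnm1E [z1 == i]eq_sym (negPf iz) addn0; case: eqP => // /eqP mi.
congr (_@__); apply/mnmP => j; rewrite !(mnmDE, mnmBE, mnm1E).
have [<-|_] := eqVneq i j; last by rewrite !subn0.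
by rewrite eq_sym (negPf iz) !addn0.
Qed.

Lemma divz_deriv i p : i != z1 -> divz (d i p) = d i (divz p).
Proof.
move=> iz; apply/mpolyP => m; rewrite mcoeff_divz !mcoeff_deriv mcoeff_divz.
rewrite mnmDE mnm1E [z1 == i]eq_sym (negPf iz) addn0.
by congr (_@__ *+ _); apply/mnmP => j; rewrite !mnmDE addnAC.
Qed.

Lemma divz_euler p : divz ('X_z1 * d z1 p) = 'X_z1 * d z1 (divz p) + divz p.
Proof.
apply/mpolyP => m; rewrite mcoeff_divz mcoeffD !mcoeff_euler !mcoeff_divz.
by rewrite mnmDE mnm1E eqxx addn1 -natr1 mulrDl mul1r.
Qed.

Lemma divz_zdivision : zdivision (@mpolyC 6 R[i]) (fun i => 'X_i) d divz.
Proof.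
have /scalar_linearP[divzD divzN divzC] := divz_linear.
by split=> //; [exact: divz_mulz|exact: divz_mulX|exact: divz_deriv|exact: divz_euler].
Qed.

Lemma diagop_diagonal k h :
  diagonal (@mpolyC 6 R[i]) (fun i => 'X_i) d k (diagop k h).
Proof.
split; [by apply/scalar_linearP; exact: diagop_linear| | |].
- by move=> i p; apply: diagop_mulX.
- by move=> i p; apply: diagop_deriv.
- move=> p; rewrite !euler_diagop !diagop_comp.
  by apply: eq_diagop => n; rewrite mulrC.
Qed.
End DivisionByZ.

(** * Laurent polynomials modulo negative powers of z *)

Section Laurent.
Variable R : realType.
Local Notation pols := (pols R).
Local Notation laurent := (laurent R).
Local Notation d := (@mderiv 6 R[i]).

Section FreegLift.
Variables (K : choiceType) (V : lmodType R[i]).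
Local Notation freegK := {freeg K / R[i]}.

Lemma freegU_scale (c b : R[i]) (k : K) : c *: << b *g k >> = << (c * b) *g k >> :> freegK.
Proof.
by apply/eqP/freeg_eqP => z; rewrite coeffZ !coeffU mulrA.
Qed.

Lemma fglift_linear (f : K -> V) : linear (fglift f).
Proof.
pose F : {additive freegK -> V} := HB.pack (fglift f)
  (GRing.isAdditive.Build _ _ (fglift f) (lift_is_additive f)).
have fD : {morph fglift f : x y / x + y} by exact: (raddfD F).
have fE (D : freegK) : fglift f D = \sum_(z <- dom D) coeff z D *: f z.
  rewrite -{1}[D]freeg_sumE [LHS](raddf_sum F).
  by apply: eq_bigr => z _; apply: liftU.
have fZ c (D : freegK) : fglift f (c *: D) = c *: fglift f D.
  rewrite -{1}[D]freeg_sumE scaler_sumr [LHS](raddf_sum F) fE scaler_sumr.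
  by apply: eq_bigr => z _; rewrite freegU_scale [LHS]liftU scalerA.
by move=> c D E; rewrite fD fZ.
Qed.

Lemma linear_freeg_ext (f g : freegK -> V) : linear f -> linear g ->
  (forall k, f << k >> = g << k >>) -> f =1 g.
Proof.
move=> flin glin fg D.
pose F : {linear freegK -> V} := HB.pack f (GRing.isLinear.Build _ _ _ _ f flin).
pose G : {linear freegK -> V} := HB.pack g (GRing.isLinear.Build _ _ _ _ g glin).
rewrite -[f]/(F : _ -> _) -[g]/(G : _ -> _) -[D]freeg_sumE !linear_sum.
apply: eq_bigr => z _.
have -> : << coeff z D *g z >> = coeff z D *: << z >> :> freegK.
  by rewrite freegU_scale mulr1.
by rewrite !linearZ /= fg.
Qed.
End FreegLift.
End Laurent.

Section LaurentQuotient.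
Variable R : realType.
Local Notation pols := (pols R).
Local Notation laurent := (laurent R).
Local Notation d := (@mderiv 6 R[i]).

Definition lexpnt_of (m : 'X_{1..6}) : lexpnt :=
  (m x1, m y1, (m z1)%:Z, m x2, m y2, m z2).

Definition mnm6 (a b c a' b' c' : nat) : 'X_{1..6} :=
  [multinom [tuple a; b; c; a'; b'; c']].

Lemma lexpnt_mnm6 a b c a' b' c' :
  lexpnt_of (mnm6 a b c a' b' c') = (a, b, c%:Z, a', b', c').
Proof. by []. Qed.

Lemma of_laurent_linear : linear (@of_laurent R). Proof. exact: fglift_linear. Qed.

Let mul6A (A : comNzRingType) (a b c a' b' c' : A) :
  a * b * c * (a' * b' * c') = a * b * c * a' * b' * c'.
Proof. by rewrite !mulrA. Qed.

Lemma of_laurentU m : of_laurent << lexpnt_of m >> = 'X_[m] :> pols.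
Proof.
rewrite /of_laurent liftU scale1r; cbv [lexpnt_of].
by rewrite [RHS]mpolyX6 [RHS]mul6A.
Qed.

Lemma of_laurent_neg a b n a' b' c' c :
  of_laurent << c *g ((a, b, Negz n, a', b', c') : lexpnt) >> = 0 :> pols.
Proof. by rewrite [LHS]liftU scaler0. Qed.

Lemma to_laurentE (p : pols) :
  to_laurent p = monlift (fun m => << lexpnt_of m >> : laurent) p.
Proof.
by apply: eq_bigr => m _; rewrite freegU_scale mulr1.
Qed.

Lemma to_laurent_linear : linear (@to_laurent R).
Proof. by move=> a p q; rewrite !to_laurentE monlift_linear. Qed.

Lemma to_laurentK : cancel (@to_laurent R) (@of_laurent R).
Proof.
apply: linear_monomial_ext.
- by move=> a p q; rewrite to_laurent_linear of_laurent_linear.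
- by [].
- by move=> m; rewrite to_laurentE monlift_X of_laurentU.
Qed.

Lemma yz_dx_linear : linear (@yz_dx R). Proof. exact: fglift_linear. Qed.
Lemma fun_zdz_linear h : linear (@fun_zdz R h). Proof. exact: fglift_linear. Qed.
Lemma fun_ydy_linear h : linear (@fun_ydy R h). Proof. exact: fglift_linear. Qed.

(** (y_1 / z_1) d/dx_1 modulo negative powers of z_1. *)
Definition ydivz_dx (p : pols) : pols := 'X_y1 * divz (d x1 p).

Lemma ydivz_dx_linear : linear ydivz_dx.
Proof.
move=> a p q; rewrite /ydivz_dx mderivD mderivZ divz_linear mulrDr.
by rewrite scalerAr.
Qed.

Lemma linear_compose (U V W : lmodType R[i]) (f : V -> W) (g : U -> V) :
  linear f -> linear g -> linear (fun u => f (g u)).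
Proof. by move=> fl gl a u v; rewrite gl fl. Qed.

Lemma linear_at0 (U V : lmodType R[i]) (f : U -> V) : linear f -> f 0 = 0.
Proof.
by move=> /(_ (-1) 0 0); rewrite scaler0 addr0 scaleN1r addNr.
Qed.

Lemma linear_scale (U V : lmodType R[i]) (f : U -> V) a u : linear f ->
  f (a *: u) = a *: f u.
Proof. by move=> fl; rewrite -[a *: u]addr0 fl linear_at0 ?addr0. Qed.

(** An operator on Laurent polynomials descends along [of_laurent] as soon as
    it preserves the span of the monomials with negative powers of z_1. *)
Lemma of_laurent_ext (f : laurent -> laurent) (g : pols -> pols) :
  linear f -> linear g ->
  (forall m, of_laurent (f << lexpnt_of m >>) = g 'X_[m]) ->
  (forall a b n a' b' c',
     of_laurent (f << ((a, b, Negz n, a', b', c') : lexpnt) >>) = 0) ->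
  forall q, of_laurent (f q) = g (of_laurent q).
Proof.
move=> fl gl fg f0; apply: linear_freeg_ext.
- exact: linear_compose of_laurent_linear fl.
- exact: linear_compose gl of_laurent_linear.
case=> [[[[[a b] [c|n]] a'] b'] c'].
  by rewrite -lexpnt_mnm6 fg of_laurentU.
rewrite f0 of_laurent_neg.
by rewrite linear_at0.
Qed.

Lemma of_laurent_scaleU (c : R[i]) (k : lexpnt) :
  of_laurent (<< c *g k >> : laurent) = c *: of_laurent (<< k >> : laurent).
Proof.
by rewrite -(linear_scale _ _ of_laurent_linear) freegU_scale mulr1.
Qed.

Lemma of_laurent_zdz h (q : laurent) : of_laurent (fun_zdz h q) =
  diagop z1 (fun n => h n%:R) (of_laurent q).
Proof.
apply: (of_laurent_ext (g := diagop z1 (fun n => h n%:R))).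
- exact: fun_zdz_linear.
- exact: diagop_linear.
- move=> m; rewrite /fun_zdz [fglift _ _]liftU scale1r /diagop monlift_X.
  by rewrite [LHS]of_laurent_scaleU of_laurentU.
- by move=> a b n a' b' c'; rewrite /fun_zdz [fglift _ _]liftU scale1r of_laurent_neg.
Qed.

Lemma of_laurent_ydy h (q : laurent) : of_laurent (fun_ydy h q) =
  diagop y1 (fun n => h n%:R) (of_laurent q).
Proof.
apply: (of_laurent_ext (g := diagop y1 (fun n => h n%:R))).
- exact: fun_ydy_linear.
- exact: diagop_linear.
- move=> m; rewrite /fun_ydy [fglift _ _]liftU scale1r /diagop monlift_X.
  by rewrite [LHS]of_laurent_scaleU of_laurentU.
- by move=> a b n a' b' c'; rewrite /fun_ydy [fglift _ _]liftU scale1r of_laurent_neg.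
Qed.

Lemma of_laurent_yz_dx (q : laurent) : of_laurent (yz_dx q) = ydivz_dx (of_laurent q).
Proof.
apply: of_laurent_ext.
- exact: yz_dx_linear.
- exact: ydivz_dx_linear.
- move=> m; rewrite /yz_dx [fglift _ _]liftU scale1r [LHS]of_laurent_scaleU.
  rewrite /ydivz_dx mderivX.
  rewrite (linear_scale _ _ (@divz_linear R)) -scalerAr.
  have [->|mx] := eqVneq (m x1) 0%N; first by rewrite !scale0r.
  congr (_ *: _); rewrite /divz monlift_X mnmBE mnm1E /= subn0.
  have [mz|mz] := eqVneq (m z1) 0%N.
    by rewrite mz mulr0 sub0r [LHS]of_laurent_neg.
  rewrite -mpolyXD -of_laurentU; congr (of_laurent << _ *g _ >>).
  rewrite /lexpnt_of !(mnmDE, mnmBE, mnm1E) /=.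
  rewrite ?(subn0, addn0, add0n, subn1, add1n) -predn_int ?lt0n//.
- move=> a b n a' b' c'; rewrite /yz_dx [fglift _ _]liftU scale1r.
  by rewrite (_ : Negz n - 1 = Negz n.+1) ?of_laurent_neg// !NegzE -opprD -PoszD addn1.
Qed.

Lemma yz_dx_locnil (D : {linear laurent -> laurent}) (c : R[i]) :
  (forall q, D q = c *: yz_dx q) -> locnil D.
Proof.
move=> DE; have nilU (k : lexpnt) : iter (k.1.1.1.1.1).+1 D << k >> = 0.
  case: k => [[[[[a b] e] a'] b'] c'] /=.
  elim: a b e => [|a IHa] b e; rewrite -iterS iterSr DE /yz_dx liftU scale1r.
    by rewrite freegU0 scaler0.
  rewrite freegU_scale -[_ * _]mulr1 -freegU_scale.
  have iterZ n z v : iter n D (z *: v) = z *: iter n D v.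
    by elim: n => //= n ->; rewrite linearZ.
  by rewrite iterZ /= IHa scaler0.
move=> q; rewrite -[q]freeg_sumE.
elim: (dom q) => [|k s [n IHn]]; first by exists 0%N; rewrite big_nil.
rewrite big_cons; exists (maxn n (k.1.1.1.1.1).+1).
have -> : << coeff k q *g k >> = coeff k q *: << k >> :> laurent.
  by rewrite freegU_scale mulr1.
rewrite iter_linear (iter_eq0_le (leq_maxr n _) (nilU k)) scaler0 add0r.
exact: iter_eq0_le (leq_maxl n _) IHn.
Qed.

(** Each monomial is killed by a power of (y_1 / z_1) d/dx_1 since its exponent
    in x_1 decreases, and [to_laurent] transports this to polynomials. *)
Lemma of_laurent_expop (D : {linear laurent -> laurent}) (c : R[i])
   (D' : {linear pols -> pols}) :
  (forall q, D q = c *: yz_dx q) -> (forall p, D' p = c *: ydivz_dx p) ->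
  locnil D' /\ forall q, of_laurent (expop D q) = expop D' (of_laurent q).
Proof.
move=> DE D'E; have nilD := yz_dx_locnil DE.
have piD q : of_laurent (D q) = D' (of_laurent q).
  by rewrite DE D'E -of_laurent_yz_dx (linear_scale _ _ of_laurent_linear).
have piDn n q : of_laurent (iter n D q) = iter n D' (of_laurent q).
  by elim: n => //= n <-; rewrite piD.
split=> [p|q].
  have [n Dn] := nilD (to_laurent p); exists n.
  by rewrite -[p]to_laurentK -piDn Dn (linear_at0 of_laurent_linear).
have [n Dn] := nilD q.
rewrite (expopE Dn) (expopE (n := n)); last first.
  by rewrite -piDn Dn (linear_at0 of_laurent_linear).
pose P : {linear laurent -> pols} :=
  HB.pack (@of_laurent R) (GRing.isLinear.Build _ _ _ _ (@of_laurent R) of_laurent_linear).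
rewrite -[LHS]/(P _) linear_sum; apply: eq_bigr => k _; rewrite linearZ.
by rewrite -piDn.
Qed.
End LaurentQuotient.

(** * The substitution M_1 -> M_1 M_2 *)

Lemma mulX_fix (A : comNzRingType) (I : Type) (X : I -> A) (f : A -> A)
    (i1 i2 i3 i4 i5 i6 : I) (n1 n2 n3 n4 n5 n6 : nat) :
  f 1 = 1 -> (forall i p, f (X i * p) = X i * f p) ->
  let m := X i1 ^+ n1 * X i2 ^+ n2 * X i3 ^+ n3 *
    (X i4 ^+ n4 * X i5 ^+ n5 * X i6 ^+ n6) in f m = m.
Proof.
move=> f1 fX m; have fXn i n p : f (X i ^+ n * p) = X i ^+ n * f p.
  elim: n => [|n IHn]; first by rewrite expr0 !mul1r.
  by rewrite exprS -!mulrA fX IHn.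
by rewrite -[in LHS](mulr1 m) /m -!mulrA !fXn f1 mulr1.
Qed.

Section SubstitutionS3.
Variable R : realType.
Local Notation pols := (pols R).
Local Notation C := (@mpolyC 6 R[i]).
Local Notation X := (fun i : 'I_6 => 'X_i : pols).
Local Notation d := (@mderiv 6 R[i]).
Implicit Types (p q : pols) (i j : 'I_6).

Lemma pols_dd i j p : d i (d j p) = d j (d i p). Proof. exact: mderiv_comm. Qed.

Lemma pols_partials : partials C X d.
Proof.
split; [exact: mderivD|exact: mderivN|exact: mderivM|exact: mderivC|
  exact: pols_dX|exact: pols_dd].
Qed.

Lemma iter_deriv_eq0 j (m : 'X_{1..6}) : iter (m j).+1 (d j) ('X_[m] : pols) = 0.
Proof. by rewrite -mderivn_iter mderivnX ffact_small // scale0r. Qed.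

Section MulDeriv.
Variables (q : pols) (j : 'I_6).
Hypothesis dq : d j q = 0.

Definition mulderiv p := q * d j p.

Lemma mulderiv_linear : linear mulderiv.
Proof. by move=> a p r; rewrite /mulderiv mderivD mderivZ mulrDr scalerAr. Qed.

HB.instance Definition _ :=
  GRing.isLinear.Build R[i] pols pols _ mulderiv mulderiv_linear.

Lemma mulderiv_locnil : locnil mulderiv.
Proof.
apply: pols_locnil => m; exists (m j).+1.
have iterE n p : iter n mulderiv p = q ^+ n * iter n (d j) p.
  elim: n => [|n IHn]; first by rewrite expr0 mul1r.
  have dqn : d j (q ^+ n) = 0.
    elim: n {IHn} => [|n IHn]; first by rewrite expr0 -mpolyC1 mderivC.
    by rewrite exprS mderivM dq IHn mul0r mulr0 addr0.
  by rewrite iterS IHn /mulderiv mderivM dqn mul0r add0r exprS mulrA.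
by rewrite iterE iter_deriv_eq0 mulr0.
Qed.

Lemma mulderiv_expop : shift_exp C X d q j (expop mulderiv).
Proof.
apply: (exp_shift_exp pols_partials dq).
- by apply/scalar_linearP; apply: expop_linear mulderiv_locnil.
- by move=> F G Fl Gl FD GD; apply: expop_push mulderiv_locnil Fl Gl FD GD.
Qed.
End MulDeriv.

Lemma S3_translation : translation C X d (@S3 R).
Proof.
have dX0 i j : i != j -> d i ('X_j : pols) = 0.
  by move=> ij; rewrite pols_dX eq_sym (negPf ij).
apply: (@translation_exp _ _ _ _ _ pols_partials
   (expop (mulderiv 'X_x2 x1)) (expop (mulderiv 'X_z2 z1))
   (expop (mulderiv ('X_y2 - 'X_x1 * 'X_z2) y1))).
- by apply: mulderiv_expop; exact: dX0.
- by apply: mulderiv_expop; exact: dX0.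
- apply: mulderiv_expop; rewrite mderivB mderivM.
  by rewrite !dX0// mul0r mulr0 addr0 subr0.
Qed.

Lemma S3_linear : linear (@S3 R).
Proof. by apply/scalar_linearP; exact: tr_lin S3_translation. Qed.

Lemma S3_1 : S3 1 = 1 :> pols.
Proof.
by rewrite /S3 !(@expop_fix _ _ (mulderiv _ _))//= /mulderiv -mpolyC1 mderivC mulr0.
Qed.

(** This is how both compositions of the two substitutions are recognized as
    the identity: [S3] is defined by exponentials and is known only through its
    commutation rules. *)
Lemma mulX_linear_id (f : pols -> pols) : linear f -> f 1 = 1 ->
  (forall i p, f ('X_i * p) = 'X_i * f p) -> f =1 id.
Proof.
move=> flin f1 fX; apply: linear_monomial_ext => // m.
rewrite mpolyX6.
exact: (@mulX_fix _ _ (fun i => 'X_i) f x1 y1 z1 x2 y2 z2).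
Qed.

(** The substitution M_1 -> M_1 M_2^-1. *)
Definition S3_back : pols -> pols := comp_mpoly
  [tuple 'X_x1 - 'X_x2; 'X_y1 - 'X_y2 + ('X_x1 - 'X_x2) * 'X_z2; 'X_z1 - 'X_z2;
         'X_x2; 'X_y2; 'X_z2].

Let S3_backX : [/\ S3_back 'X_x1 = 'X_x1 - 'X_x2,
  S3_back 'X_y1 = 'X_y1 - 'X_y2 + ('X_x1 - 'X_x2) * 'X_z2 &
  S3_back 'X_z1 = 'X_z1 - 'X_z2] /\
  [/\ S3_back 'X_x2 = 'X_x2, S3_back 'X_y2 = 'X_y2 & S3_back 'X_z2 = 'X_z2].
Proof. by split; split; rewrite /S3_back comp_mpolyXU. Qed.

Lemma ord6P (P : 'I_6 -> Prop) : P x1 -> P y1 -> P z1 -> P x2 -> P y2 -> P z2 ->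
  forall i, P i.
Proof.
move=> P0 P1 P2 P3 P4 P5 [i i6].
case: i i6 => [|[|[|[|[|[|//]]]]]] i6.
- by rewrite (_ : Ordinal i6 = x1)//; apply: val_inj.
- by rewrite (_ : Ordinal i6 = y1)//; apply: val_inj.
- by rewrite (_ : Ordinal i6 = z1)//; apply: val_inj.
- by rewrite (_ : Ordinal i6 = x2)//; apply: val_inj.
- by rewrite (_ : Ordinal i6 = y2)//; apply: val_inj.
- by rewrite (_ : Ordinal i6 = z2)//; apply: val_inj.
Qed.

Lemma S3_backM p q : S3_back (p * q) = S3_back p * S3_back q.
Proof. exact: rmorphM. Qed.

Lemma S3_back_linear : linear S3_back.
Proof. by move=> a p q; rewrite /S3_back linearP. Qed.

Lemma S3_backK : cancel S3_back (@S3 R).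
Proof.
have tr := S3_translation.
have [[bx by_ bz] [bx' by' bz']] := S3_backX.
have [SD SN _] := tr_lin tr.
apply: mulX_linear_id.
- by move=> a p q; rewrite S3_back_linear S3_linear.
- by rewrite /S3_back rmorph1 S3_1.
apply: ord6P => p; rewrite S3_backM ?(bx, by_, bz, bx', by', bz').
- rewrite mulrBl SD SN (tr_x1 tr) (tr_x2 tr); ring.
- rewrite mulrDl mulrBl -mulrA mulrBl !(SD, SN) (tr_x1 tr) (tr_x2 tr) (tr_z2 tr).
  rewrite (tr_y1 tr) (tr_y2 tr); ring.
- rewrite mulrBl SD SN (tr_z1 tr) (tr_z2 tr); ring.
- exact: (tr_x2 tr).
- exact: (tr_y2 tr).
- exact: (tr_z2 tr).
Qed.

Lemma S3K : cancel (@S3 R) S3_back.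
Proof.
have tr := S3_translation.
have [[bx by_ bz] [bx' by' bz']] := S3_backX.
have bD p q : S3_back (p + q) = S3_back p + S3_back q by exact: rmorphD.
have bN p : S3_back (- p) = - S3_back p by exact: rmorphN.
apply: mulX_linear_id.
- by move=> a p q; rewrite S3_linear S3_back_linear.
- by rewrite S3_1 /S3_back rmorph1.
apply: ord6P => p.
- rewrite (tr_x1 tr) S3_backM bD bx bx'; ring.
- rewrite (tr_y1 tr) S3_backM !(bD, bN) S3_backM bx by_ by' bz'; ring.
- rewrite (tr_z1 tr) S3_backM bD bz bz'; ring.
- by rewrite (tr_x2 tr) S3_backM bx'.
- by rewrite (tr_y2 tr) S3_backM by'.
- by rewrite (tr_z2 tr) S3_backM bz'.
Qed.

Lemma S3invK : cancel (@S3inv R) (@S3 R).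
Proof.
move=> p; rewrite /S3inv pinvK ?inE//.
by exists (S3_back p) => //; exact: S3_backK.
Qed.

Lemma S3invE : @S3inv R =1 S3_back.
Proof. by move=> p; rewrite -[in RHS](S3invK p) S3K. Qed.
End SubstitutionS3.

(** * The formula modulo negative powers of z *)

Section Assembly.
Variable R : realType.
Local Notation pols := (pols R).
Local Notation C := (@mpolyC 6 R[i]).
Local Notation X := (fun i : 'I_6 => 'X_i : pols).
Local Notation d := (@mderiv 6 R[i]).
Local Notation part := (@pols_partials R).
Implicit Types (p q : pols) (u v : R[i]).

Lemma sum_ord3 (V : nmodType) (F : 'I_3 -> V) :
  \sum_k F k = F ord0 + F (fintype.lift ord0 ord0) + F ord_max.
Proof.
by rewrite !big_ord_recl big_ord0 addr0 addrA; congr (_ + F _); apply: val_inj.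
Qed.

Lemma opmulE (A B : 'M[pols -> pols]_3) i j p :
  opmul A B i j p = A i ord0 (B ord0 j p) + A i (fintype.lift ord0 ord0) (B (fintype.lift ord0 ord0) j p) +
    A i ord_max (B ord_max j p).
Proof. by rewrite mxE sum_ord3. Qed.

Let ent (s : seq (seq (pols -> pols))) i j := nth (fun=> 0) (nth [::] s i) j.
Lemma opmx3E (s t w : seq (seq (pols -> pols))) (i j : 'I_3) p :
  opmul (opmul (opmx s) (opmx t)) (opmx w) i j p =
   let c k := ent s i 0 (ent t 0 k (ent w k j p)) +
      ent s i 1 (ent t 1 k (ent w k j p)) +
      ent s i 2 (ent t 2 k (ent w k j p)) in c 0%N + c 1%N + c 2%N.
Proof. by rewrite opmulE !opmulE !mxE. Qed.

Lemma laxE x y z a1 a2 a3 (i j : 'I_3) p : uniq [:: x; y; z] ->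
  lax x y z a1 a2 a3 i j p = lax_entry C X d x y z a1 a2 a3 i j p.
Proof.
by move=> xyz; rewrite /lax opmx3E; apply: (lax_entries part a1 a2 a3 xyz p (ltn_ord i) (ltn_ord j)).
Qed.

Lemma S3_lax u1 u2 u3 v1 v2 v3 (i j : 'I_3) p :
  S3 (opmul (lax1 u1 u2 u3) (lax2 v1 v2 v3) i j p) =
  lax_conj C X d u1 u2 u3 v1 v2 v3 i j (S3 p).
Proof.
rewrite opmulE /lax1 /lax2 !laxE//.
exact: (translation_lax part (S3_translation R) u1 u2 u3 v1 v2 v3 p (ltn_ord i) (ltn_ord j)).
Qed.

(** c (y_1 / z_1) d/dx_1 modulo negative powers of z_1. *)
Definition yzexp_gen (c : R[i]) p : pols := C c * ('X_y1 * divz (d x1 p)).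

Lemma yzexp_gen_linear c : linear (yzexp_gen c).
Proof.
apply/scalar_linearP.
have /scalar_linearP[sD sN sC] := @ydivz_dx_linear R.
rewrite /ydivz_dx in sD sN sC.
split=> *; rewrite /yzexp_gen.
- by rewrite sD mulrDr.
- by rewrite sN mulrN.
- by rewrite sC mulrCA.
Qed.

HB.instance Definition _ c := GRing.isLinear.Build R[i] pols pols _
  (yzexp_gen c) (yzexp_gen_linear c).

Definition gratio (a b : R[i]) (n : nat) : R[i] :=
  gamma (n%:R + a) * rgamma (n%:R + b).

(** The three quotients of Gamma functions of the formula, from right to left. *)
Definition Amul u2 u3 := diagop z1 (gratio 1 (u2 - u3 + 1)).
Definition Hmul u1 u3 v3 := diagop y1 (gratio (u1 - v3 + 1) (u1 - u3 + 1)).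
Definition Qmul u2 v3 := diagop z1 (gratio (u2 - v3 + 1) 1).

Definition middle u1 u2 u3 v3 : pols -> pols :=
  factored (Amul u2 u3) (Hmul u1 u3 v3) (Qmul u2 v3)
    (expop (yzexp_gen 1)) (expop (yzexp_gen (-1))).

Lemma yzexp_laurent (c : R[i]) (D : laurent R -> laurent R) :
  (forall q : laurent R, D q = c *: yz_dx q) ->
  locnil (yzexp_gen c) /\
  forall q : laurent R, of_laurent (expop D q) = expop (yzexp_gen c) (of_laurent q).
Proof.
move=> DE.
have Dlin : linear D.
  move=> a u v; rewrite !DE (yz_dx_linear a u v) scalerDr !scalerA.
  by rewrite mulrC.
pose D' : {linear laurent R -> laurent R} :=
  HB.pack D (GRing.isLinear.Build _ _ _ _ D Dlin).
apply: (@of_laurent_expop R D' c (yzexp_gen c)) => [r|p]; first exact: DE.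
by rewrite -mul_mpolyC.
Qed.

Lemma of_laurent_zdz_eq (h : R[i] -> R[i]) (g : nat -> R[i]) (q : laurent R) :
  (forall n : nat, h n%:R = g n) ->
  of_laurent (fun_zdz h q) = diagop z1 g (of_laurent q).
Proof. by move=> hg; rewrite of_laurent_zdz; apply: eq_diagop. Qed.

Lemma of_laurent_ydy_eq (h : R[i] -> R[i]) (g : nat -> R[i]) (q : laurent R) :
  (forall n : nat, h n%:R = g n) ->
  of_laurent (fun_ydy h q) = diagop y1 g (of_laurent q).
Proof. by move=> hg; rewrite of_laurent_ydy; apply: eq_diagop. Qed.

Lemma R3_formulaE u1 u2 u3 v3 p :
  R3_formula u1 u2 u3 v3 p = S3inv (middle u1 u2 u3 v3 (S3 p)).
Proof.
have tE (n : nat) u v : n%:R + u - v + 1 = n%:R + (u - v + 1).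
  by rewrite !addrA.
rewrite /R3_formula /middle /factored.
rewrite (of_laurent_zdz_eq (g := gratio (u2 - v3 + 1) 1)); last first.
  by move=> n; rewrite /gratio !tE.
have [_ ->] := @yzexp_laurent 1 (@yz_dx R) (fun q : laurent R => esym (scale1r _)).
rewrite (of_laurent_ydy_eq (g := gratio (u1 - v3 + 1) (u1 - u3 + 1))); last first.
  by move=> n; rewrite /gratio !tE.
have [_ ->] := @yzexp_laurent (-1) (fun q : laurent R => - yz_dx q) (fun q : laurent R => esym (scaleN1r _)).
rewrite (of_laurent_zdz_eq (g := gratio 1 (u2 - u3 + 1))); last first.
  by move=> n; rewrite /gratio !tE.
by rewrite to_laurentK.
Qed.

Lemma yzexp_locnil c : locnil (yzexp_gen c).
Proof. by have [] := @yzexp_laurent c (fun q : laurent R => c *: yz_dx q) (fun=> erefl). Qed.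

Lemma yzexp_shear (c : R[i]) : shear C X d (@divz R) (C c) (expop (yzexp_gen c)).
Proof.
apply: (exp_shear part (divz_zdivision R)).
- by apply/scalar_linearP; apply: expop_linear (yzexp_locnil c).
- by move=> F G Fl Gl FD GD; apply: expop_push (yzexp_locnil c) Fl Gl FD GD.
Qed.
End Assembly.

(** * Generic parameters *)

Section Genericity.
Variable R : realType.
Implicit Types (s : seq R[i]) (x y t : R[i]).

Definition nonint x y := forall n : int, x - y <> n%:~R.

Lemma nonint_sym x y : nonint x y -> nonint y x.
Proof.
by move=> xy n e; apply: (xy (- n)); rewrite -opprB e mulrNz.
Qed.

Lemma nonintDr x y (n : int) : nonint x y -> nonint x (y + n%:~R).
Proof.
move=> xy m e; apply: (xy (m + n)); rewrite intrD -e; ring.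
Qed.

Lemma nonint_nat x y : nonint x y -> forall n : nat, x - y + n%:R != 0.
Proof.
move=> xy n; apply/eqP => e; apply: (xy (- n%:Z)).
by rewrite mulrNz -[LHS](addrK n%:R) e sub0r.
Qed.

Lemma generic_cons x s :
  generic (x :: s) <-> (forall y, y \in s -> nonint x y) /\ generic s.
Proof.
split=> [gen|[xs gen]].
  split=> [y|i j /andP[ij js]].
    by move=> /(nthP 0)[j js <-]; apply: (gen 0%N j.+1).
  by apply: (gen i.+1 j.+1); rewrite !ltnS ij.
case=> [|i] [|j] //= ij; first by apply: xs; rewrite mem_nth.
by apply: gen; rewrite -ltnS.
Qed.

(** The numbers k / N with k < N have no integer differences among each other,
    so when N exceeds the length of s, not all of them can have an integer
    difference with an entry of s. *)
Lemma avoid_int s : exists t, forall x, x \in s -> nonint x t.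
Proof.
apply: contrapT => no_t; pose N := (size s).+1.
pose t (k : 'I_N) : R[i] := k%:R / N%:R.
have N0 : N%:R != 0 :> R[i] by rewrite pnatr_eq0.
have hit (k : 'I_N) : exists i : 'I_(size s), exists n : int, s`_i - t k = n%:~R.
  apply: contrapT => no_i; apply: no_t; exists (t k) => x /(nthP 0)[i si <-] n e.
  by apply: no_i; exists (Ordinal si), n.
pose f k := projT1 (cid (hit k)).
have f_inj : injective f.
  move=> k k' ff; have [n en] := projT2 (cid (hit k)).
  have [n' en'] := projT2 (cid (hit k')); rewrite -/(f k) -/(f k') in en en'.
  have e : (k'%:Z - k%:Z = (n - n') * N%:Z)%R.
    apply/eqP; rewrite -(eqr_int R[i]) rmorphM !rmorphB /= -en -en' ff.
    apply/eqP; move: N0; rewrite /t -!pmulrn.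
    by move: (N%:R : R[i]) (s`_(f k')) (k%:R) (k'%:R) => M z m m' M0; field.
  apply/val_inj => /=; have [k_lt k'_lt] := (ltn_ord k, ltn_ord k').
  have [n0|n0] := eqVneq (n - n') 0.
    by move: e; rewrite n0 mul0r => /eqP; rewrite subr_eq0 eqz_nat => /eqP.
  have : (`|k'%:Z - k%:Z| < N%:Z)%R.
    have [kN k'N] : (k%:Z < N%:Z)%R /\ (k'%:Z < N%:Z)%R by rewrite !ltz_nat.
    have [k0 k'0] : (0 <= k%:Z)%R /\ (0 <= k'%:Z)%R by [].
    by rewrite ltr_norml; apply/andP; split; lra.
  rewrite e normrM [`|N%:Z|]gtr0_norm// => bad; exfalso; move: bad.
  apply/negP; rewrite -leNgt ler_peMl// -gtz0_ge1 normr_gt0//.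
by have := leq_card f f_inj; rewrite !card_ord /N ltnn.
Qed.
End Genericity.

(** * Existence *)

Section MainProof.
Variable R : realType.
Local Notation pols := (pols R).
Local Notation C := (@mpolyC 6 R[i]).
Local Notation X := (fun i : 'I_6 => 'X_i : pols).
Local Notation d := (@mderiv 6 R[i]).
Local Notation part := (@pols_partials R).
Implicit Types (p q : pols) (u v : R[i]).

Lemma gratioS (a b : R[i]) n : n%:R + a != 0 ->
  gratio a b n.+1 * (n%:R + b) = (n%:R + a) * gratio a b n.
Proof.
move=> na; rewrite /gratio -natr1 (rgammaS (n%:R + b)).
have -> : n%:R + 1 + a = n%:R + a + 1 by ring.
have -> : n%:R + 1 + b = n%:R + b + 1 by ring.
by rewrite gammaS//; ring.
Qed.

Lemma gratio_neq0 (a b : R[i]) : (forall n : nat, a + n%:R != 0) ->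
  (forall n : nat, b + n%:R != 0) -> gratio a b 0 != 0.
Proof.
by move=> a0 b0; rewrite /gratio !add0r mulf_neq0 ?invr_neq0// rgamma_neq0.
Qed.

(* A diagonal operator with h (n + 1) / h n = (n + a) / (n + b) exchanges the
   parameters a and b next to an Euler operator. *)
Section Ratio.
Variables (h : nat -> R[i]) (a b : R[i]).
Hypothesis hS : forall n, h n.+1 * (n%:R + b) = (n%:R + a) * h n.

Lemma diagop_euler_add (k : 'I_6) (c : R[i]) p :
  C c * p + 'X_k * d k p = diagop k (fun n => n%:R + c) p.
Proof. by rewrite (scale_diagop k) euler_diagop addrC add_diagop. Qed.

Lemma ratio_mulX (k : 'I_6) p : diagop k h ('X_k * (C b * p + 'X_k * d k p)) =
  'X_k * (C a * diagop k h p + 'X_k * d k (diagop k h p)).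
Proof.
rewrite !diagop_euler_add diagop_mulX_diag !diagop_comp; congr (_ * _).
exact: eq_diagop.
Qed.

Lemma ratio_mulX1 (k : 'I_6) p : a = 1 ->
  diagop k h ('X_k * (C b * p + 'X_k * d k p)) =
  'X_k * (diagop k h p + 'X_k * d k (diagop k h p)).
Proof. by move=> a1; rewrite ratio_mulX a1 mpolyC1 mul1r. Qed.

Lemma ratio_mul1X (k : 'I_6) p : b = 1 ->
  diagop k h ('X_k * (p + 'X_k * d k p)) =
  'X_k * (C a * diagop k h p + 'X_k * d k (diagop k h p)).
Proof. by move=> b1; rewrite -ratio_mulX b1 mpolyC1 mul1r. Qed.

Lemma ratio_deriv (k : 'I_6) p : diagop k h (C a * d k p + 'X_k * d k (d k p)) =
  C b * d k (diagop k h p) + 'X_k * d k (d k (diagop k h p)).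
Proof.
rewrite !diagop_euler_add deriv_diagop !diagop_comp.
by apply: eq_diagop => n /=; rewrite mulrC -hS mulrC.
Qed.

Lemma divz_euler_add (c : R[i]) p :
  divz ('X_z1 * d z1 p + C c * p) = diagop z1 (fun n => n%:R + (c + 1)) (divz p).
Proof.
rewrite addrC diagop_euler_add divz_diagop.
by apply: eq_diagop => n; rewrite -natr1 -addrA [1 + c]addrC.
Qed.

Lemma deriv_divz p : d z1 p = diagop z1 (fun n => n%:R + 1) (divz p).
Proof.
rewrite -[LHS]divz_mulz -[_ * _]addr0 -{1}[0](mul0r p) -(mpolyC0 6 R[i]).
by rewrite divz_euler_add; apply: eq_diagop => n; rewrite add0r.
Qed.

Lemma ratio_divz p : a = 1 ->
  diagop z1 h (d z1 p) = divz ('X_z1 * d z1 (diagop z1 h p) + C (b - 1) * diagop z1 h p).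
Proof.
move=> a1; rewrite divz_euler_add deriv_divz divz_diagop !diagop_comp.
apply: eq_diagop => n /=; rewrite subrK mulrC.
by have := hS n; rewrite a1 => <-; rewrite mulrC.
Qed.

Lemma ratio_divz_deriv p : b = 1 ->
  diagop z1 h (divz ('X_z1 * d z1 p + C (a - 1) * p)) = d z1 (diagop z1 h p).
Proof.
move=> b1; rewrite divz_euler_add deriv_divz divz_diagop !diagop_comp.
apply: eq_diagop => n /=; rewrite subrK mulrC.
by rewrite -hS b1 mulrC.
Qed.
End Ratio.

Section Existence.
Variables u1 u2 u3 v3 : R[i].
Hypothesis gen : generic [:: u1; u2; u3; v3].

Let gen13 (n : nat) : n%:R + (u1 - v3 + 1) != 0.
Proof.
have := nonint_nat (gen (i := 0) (j := 3) isT) n.+1.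
by rewrite -natr1 /=; congr (_ != _); ring.
Qed.

Let gen23 (n : nat) : n%:R + (u2 - v3 + 1) != 0.
Proof.
have := nonint_nat (gen (i := 1) (j := 3) isT) n.+1.
by rewrite -natr1 /=; congr (_ != _); ring.
Qed.

Let nat1 (n : nat) : n%:R + 1 != 0 :> R[i].
Proof. by rewrite natr1 pnatr_eq0. Qed.

Lemma middle_intertwiner :
  intertwiner C X d u1 u2 u3 v3 (middle u1 u2 u3 v3).
Proof.
have hA n := @gratioS 1 (u2 - u3 + 1) n (nat1 n).
have hQ n := @gratioS (u2 - v3 + 1) 1 n (gen23 n).
have hH n := @gratioS (u1 - v3 + 1) (u1 - u3 + 1) n (gen13 n).
have e1 := yzexp_shear (1 : R[i]); rewrite mpolyC1 in e1.
have eN1 := yzexp_shear (-1 : R[i]); rewrite mpolyCN mpolyC1 in eN1.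
apply: (factored_intertwiner part (divz_zdivision R) eN1 e1).
- exact: diagop_diagonal.
- exact: diagop_diagonal.
- by move=> p; apply: (ratio_mulX1 hA).
- by move=> p; have := ratio_divz hA p erefl; rewrite addrK.
- by move=> p; apply: (ratio_mul1X hQ).
- by move=> p; have := ratio_divz_deriv hQ p erefl; rewrite addrK.
- exact: diagop_diagonal.
- by move=> p; apply: esym; apply: divz_diagop_other.
- by move=> p; apply: (ratio_mulX hH).
- by move=> p; apply: (ratio_deriv hH).
Qed.

(** All factors preserve constants: the exponentials fix them, and the diagonal
    operators multiply them by their values at the exponent 0. *)
Lemma middle_one : exists2 c, c != 0 & middle u1 u2 u3 v3 1 = C c.
Proof.
have diag1 k h c : diagop k h (C c) = C (h 0%N * c).
  apply/mpolyP => m; rewrite mcoeff_diagop !mcoeffC.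
  by case: eqP => [->|_]; rewrite ?mnm0E ?mulr1 ?mulr0.
have exp1 (c k : R[i]) : expop (yzexp_gen c) (C k) = C k.
  apply: expop_fix; rewrite /= /yzexp_gen mderivC.
  by rewrite (linear_at0 (@divz_linear R)) !mulr0.
have nat1' (n : nat) : 1 + n%:R != 0 :> R[i] by rewrite addrC.
have g12 := nonint_nat (gen (i := 0) (j := 2) isT).
have g22 := nonint_nat (gen (i := 1) (j := 2) isT).
have shift1 (x y : R[i]) : (forall n : nat, x - y + n%:R != 0) ->
    forall n : nat, x - y + 1 + n%:R != 0.
  by move=> xy n; rewrite -addrA nat1r.
have flip (x : R[i]) : (forall n : nat, n%:R + x != 0) -> forall n : nat, x + n%:R != 0.
  by move=> nx n; rewrite addrC.
exists (gratio (u2 - v3 + 1) 1 0 * (gratio (u1 - v3 + 1) (u1 - u3 + 1) 0 *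
   (gratio 1 (u2 - u3 + 1) 0 * 1))).
  rewrite mulr1; apply: mulf_neq0; [|apply: mulf_neq0]; apply: gratio_neq0 => //.
  - exact: flip.
  - exact: flip.
  - exact: shift1.
  - exact: shift1.
transitivity (middle u1 u2 u3 v3 (C 1)); first by congr middle; rewrite mpolyC1.
by rewrite /middle /factored /Amul /Hmul /Qmul !(diag1, exp1).
Qed.
End Existence.

Lemma R3_formula_linear u1 u2 u3 v3 : linear (@R3_formula R u1 u2 u3 v3).
Proof.
pose Mid := middle u1 u2 u3 v3.
have midl : linear Mid.
  apply: (linear_compose (diagop_linear z1 _)).
  apply: (linear_compose (expop_linear (@yzexp_locnil R 1))).
  apply: (linear_compose (diagop_linear y1 _)).
  apply: (linear_compose (expop_linear (@yzexp_locnil R (-1)))).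
  exact: diagop_linear.
have E p : R3_formula u1 u2 u3 v3 p = S3_back (Mid (S3 p)).
  by rewrite R3_formulaE S3invE.
have l := linear_compose (@S3_back_linear R) (linear_compose midl (@S3_linear R)).
by move=> a p q; rewrite (E p) (E q) [LHS]E; apply: l.
Qed.

HB.instance Definition _ u1 u2 u3 v3 := GRing.isLinear.Build R[i] pols pols _
  (@R3_formula R u1 u2 u3 v3) (R3_formula_linear u1 u2 u3 v3).

Lemma R3_formula_shift u1 u2 u3 v3 (l : R[i]) :
  R3_formula u1 u2 u3 v3 =1 R3_formula (u1 + l) (u2 + l) (u3 + l) (v3 + l) :> (pols -> pols).
Proof.
have shiftB u v : u + l - (v + l) = u - v by rewrite opprD addrACA subrr addr0.
by move=> p; rewrite !R3_formulaE /middle /Amul /Hmul /Qmul !shiftB.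
Qed.

Lemma pols_mul4I (p q : pols) : p *+ 4 = q *+ 4 -> p = q.
Proof.
have n4 : 4%:R != 0 :> R[i] by rewrite pnatr_eq0.
by move=> pq; apply: (scalerI n4); rewrite !scaler_nat.
Qed.

Lemma R3_formula_solves u1 u2 u3 v1 v2 v3 (i j : 'I_3) p :
  generic [:: u1; u2; u3; v1; v2; v3] ->
  R3_formula u1 u2 u3 v3 (opmul (lax1 u1 u2 u3) (lax2 v1 v2 v3) i j p) =
  opmul (lax1 u1 u2 v3) (lax2 v1 v2 u3) i j (R3_formula u1 u2 u3 v3 p).
Proof.
move=> gen; have gen4 : generic [:: u1; u2; u3; v3].
  move: gen; rewrite !generic_cons => -[g1 [g2 [g3 [_ [_ g4]]]]].
  do ?split=> //.
  - by move=> y yin; apply: g1; move: yin; rewrite !inE => /or3P[] ->; rewrite ?orbT.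
  - by move=> y yin; apply: g2; move: yin; rewrite !inE => /orP[] ->; rewrite ?orbT.
  - by move=> y yin; apply: g3; move: yin; rewrite !inE => ->; rewrite ?orbT.
have E q : S3 (R3_formula u1 u2 u3 v3 q) = middle u1 u2 u3 v3 (S3 q).
  by rewrite R3_formulaE S3invK.
apply: (can_inj (@S3K R)); apply: etrans (E _) _.
rewrite (S3_lax u1 u2 u3 v1 v2 v3 i j p).
apply: etrans (esym (S3_lax u1 u2 v3 v1 v2 u3 i j _)); rewrite (E p).
exact: (intertwine_lax_conj part pols_mul4I (middle_intertwiner gen4) v1 v2 _ (ltn_ord i) (ltn_ord j)).
Qed.
End MainProof.

(** * Uniqueness *)

Section UniquenessProof.
Variable R : realType.
Local Notation pols := (pols R).
Local Notation C := (@mpolyC 6 R[i]).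
Local Notation X := (fun i : 'I_6 => 'X_i : pols).
Local Notation d := (@mderiv 6 R[i]).
Local Notation part := (@pols_partials R).
Implicit Types (p q : pols) (u v : R[i]).

Lemma generic6 u1 u2 u3 v1 v2 v3 : generic [:: u1; u2; u3; v3] ->
  (forall x, x \in [:: u1; u2; u3; v3] -> nonint x v1) ->
  (forall x, x \in [:: u1; u2; u3; v3] -> nonint x v2) -> nonint v1 v2 ->
  generic [:: u1; u2; u3; v1; v2; v3].
Proof.
move=> g a1 a2 a12.
have in4 : [/\ u1 \in [:: u1; u2; u3; v3], u2 \in [:: u1; u2; u3; v3],
    u3 \in [:: u1; u2; u3; v3] & v3 \in [:: u1; u2; u3; v3]].
  by rewrite !inE !eqxx !orbT.
have [i1 i2 i3 i4] := in4.
have n12 := g 0%N 1%N isT; have n13 := g 0%N 2%N isT.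
have n14 := g 0%N 3%N isT; have n23 := g 1%N 2%N isT.
have n24 := g 1%N 3%N isT; have n34 := g 2%N 3%N isT.
have g0 : generic ([::] : seq R[i]) by move=> i j; rewrite ltn0 andbF.
rewrite !generic_cons; split.
  by move=> y; rewrite !inE; do 4?case/orP; move=> /eqP->//; [exact: a1|exact: a2].
split.
  by move=> y; rewrite !inE; do 3?case/orP; move=> /eqP->//; [exact: a1|exact: a2].
split.
  by move=> y; rewrite !inE; do 2?case/orP; move=> /eqP->//; [exact: a1|exact: a2].
split.
  move=> y; rewrite !inE => /orP[] /eqP->//; apply: nonint_sym; exact: a1.
split=> //.
by move=> y; rewrite !inE => /eqP->; apply: nonint_sym; exact: a2.
Qed.

(** The parameters are first translated by - t so that none of them is an
    integer, in particular none is 0, and L_1 becomes injective.  Then v1 and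
    v2 are chosen so that the parameters remain generic when 1 is added to one
    of the two. *)
Lemma formula_unique (R3 : opfamily R) : shift_invariant R3 ->
  defining_equations R3 ->
  forall u1 u2 u3 v3, generic [:: u1; u2; u3; v3] -> exists c : R[i],
  forall p, R3 u1 u2 u3 v3 p = c *: R3_formula u1 u2 u3 v3 p.
Proof.
move=> R3_shift R3_eqs u1 u2 u3 v3 gen.
have [t avoid_t] := avoid_int [:: u1; u2; u3; v3].
pose w1 := u1 - t; pose w2 := u2 - t; pose w3 := u3 - t; pose w4 := v3 - t.
have w_neq0 x : x \in [:: u1; u2; u3; v3] -> x - t != 0.
  by move=> /avoid_t /nonint_nat /(_ 0%N); rewrite addr0.
have w1_neq0 : w1 != 0 by apply: w_neq0; rewrite !inE eqxx ?orbT.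
have w2_neq0 : w2 != 0 by apply: w_neq0; rewrite !inE eqxx ?orbT.
have w3_neq0 : w3 != 0 by apply: w_neq0; rewrite !inE eqxx ?orbT.
have w4_neq0 : w4 != 0 by apply: w_neq0; rewrite !inE eqxx ?orbT.
have genw : generic [:: w1; w2; w3; w4].
  move=> i j ij; have := gen i j ij; case/andP: ij.
  have E k : (k < 4)%N -> [:: w1; w2; w3; w4]`_k = [:: u1; u2; u3; v3]`_k - t.
    by case: k => [|[|[|[|]]]].
  move=> ij j4; rewrite !E//; last exact: ltn_trans ij j4.
  by rewrite opprB addrA subrK.
have [v1 avoid1] := avoid_int [:: w1; w2; w3; w4].
have [v2 avoid2] := avoid_int [:: w1; w2; w3; w4; v1].
have avoid2' x : x \in [:: w1; w2; w3; w4] -> nonint x v2.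
  by move=> xin; apply: avoid2; rewrite -[_ :: _]/([:: w1; w2; w3; w4] ++ [:: v1]) mem_cat xin.
have v12 : nonint v1 v2 by apply: avoid2; rewrite !inE eqxx !orbT.
have nonintS x y : nonint x y -> nonint x (y + 1) by exact: (@nonintDr _ x y 1).
have gen00 := generic6 genw avoid1 avoid2' v12.
have gen10 : generic [:: w1; w2; w3; v1 + 1; v2; w4].
  apply: generic6 => //; first by move=> x /avoid1 /nonintS.
  by apply: nonint_sym; apply: nonintS; apply: nonint_sym.
have gen01 : generic [:: w1; w2; w3; v1; v2 + 1; w4].
  by apply: generic6 => //; [move=> x /avoid2' /nonintS|apply: nonintS].
pose T p : pols := S3 (R3 w1 w2 w3 w4 (S3_back p)).
have T_lin : linear T.
  apply: (linear_compose (@S3_linear R)).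
  by apply: linear_compose (@S3_back_linear R); exact: linearP.
have [TD TN TC] := (scalar_linearP T).2 T_lin.
have solves x1 x2 : generic [:: w1; w2; w3; x1; x2; w4] ->
    forall i j p, (i < 3)%N -> (j < 3)%N ->
    T (lax_conj C X d w1 w2 w3 x1 x2 w4 i j p) = lax_conj C X d w1 w2 w4 x1 x2 w3 i j (T p).
  move=> genx i j p i3 j3; pose q := S3_back p.
  have L := S3_lax w1 w2 w3 x1 x2 w4 (Ordinal i3) (Ordinal j3) q.
  have L' := S3_lax w1 w2 w4 x1 x2 w3 (Ordinal i3) (Ordinal j3) (R3 w1 w2 w3 w4 q).
  have eqs := R3_eqs w1 w2 w3 x1 x2 w4 genx (Ordinal i3) (Ordinal j3) q.
  rewrite (S3_backK p : S3 q = p) in L.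
  apply: etrans L'; rewrite /T -L S3K; congr S3.
  exact: eqs.
have [T00 T10 T01] := And3 (solves _ _ gen00) (solves _ _ gen10) (solves _ _ gen01).
have X_neq0 (i : 'I_6) : 'X_i != 0 :> pols.
  by apply/eqP => /(congr1 (mcoeff U_(i))) /eqP; rewrite mcoeffX eqxx mcoeff0 oner_eq0.
have [c1 T1] : exists c1, T 1 = C c1.
  apply: pols_const => i.
  exact: (rigid_one part X_neq0 TD TN TC w1_neq0 w2_neq0 w3_neq0 w4_neq0 T00 T10 T01).
have [c0 c0_neq0 M1] := middle_one genw.
have Tm (m : 'X_{1..6}) : T 'X_[m] = (c1 / c0) *: middle w1 w2 w3 w4 'X_[m].
  rewrite -mul_mpolyC mpolyX6.
  exact: (rigid_unique part TD TN TC w1_neq0 w2_neq0 w3_neq0 w4_neq0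
    T00 T10 T01 (middle_intertwiner genw) M1 c0_neq0 T1
    (nonint_nat (genw 0%N 1%N isT)) (nonint_nat (genw 0%N 2%N isT))
    (nonint_nat (genw 1%N 2%N isT))
    (m x1) (m y1) (m z1) (m x2) (m y2) (m z2)).
have TE : T =1 (fun p => (c1 / c0) *: middle w1 w2 w3 w4 p).
  apply: linear_monomial_ext => //.
  have /scalar_linearP Ml := it_lin (middle_intertwiner genw).
  by move=> a p q; rewrite Ml scalerDr !scalerA mulrC.
exists (c1 / c0) => p.
rewrite (R3_shift u1 u2 u3 v3 gen (- t)) (R3_formula_shift u1 u2 u3 v3 (- t) p).
rewrite R3_formulaE S3invE -(linear_scale _ _ (@S3_back_linear R)) -TE /T !S3K.
by [].
Qed.
End UniquenessProof.

Theorem proposition6 (R : realType) :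
  (exists R3 : opfamily R,
    [/\ shift_invariant R3,
        defining_equations R3
      & forall u1 u2 u3 v3 : R[i], generic [:: u1; u2; u3; v3] ->
          exists p : pols R, R3 u1 u2 u3 v3 p <> 0]) /\
  (forall R3 : opfamily R,
    shift_invariant R3 -> defining_equations R3 ->
    exists c : R[i] -> R[i] -> R[i] -> R[i] -> R[i],
      forall u1 u2 u3 v3 : R[i], generic [:: u1; u2; u3; v3] ->
      forall p : pols R,
        R3 u1 u2 u3 v3 p = c u1 u2 u3 v3 *: R3_formula u1 u2 u3 v3 p).
Proof.
split.
  exists (fun u1 u2 u3 v3 => R3_formula u1 u2 u3 v3 : {linear pols R -> pols R}).
  split=> [u1 u2 u3 v3 _ l p|u1 u2 u3 v1 v2 v3 gen i j p|u1 u2 u3 v3 gen].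
  - exact: R3_formula_shift.
  - exact: R3_formula_solves.
  - have [c c0 M1] := middle_one gen; exists 1 => form0.
    have form1 : R3_formula u1 u2 u3 v3 1 = S3_back (mpolyC 6 c).
      by rewrite R3_formulaE S3_1 M1 S3invE.
    have := S3_backK (mpolyC 6 c).
    rewrite -form1 (form0 : R3_formula u1 u2 u3 v3 1 = 0).
    rewrite (linear_at0 (@S3_linear R)) => /esym /eqP.
    by rewrite mpolyC_eq0 (negPf c0).
move=> R3 R3_shift R3_eqs.
have exc u1 u2 u3 v3 : exists c : R[i], generic [:: u1; u2; u3; v3] ->
    forall p, R3 u1 u2 u3 v3 p = c *: R3_formula u1 u2 u3 v3 p.
  have [gen|ngen] := pselect (generic [:: u1; u2; u3; v3]).
    have [c cE] := formula_unique R3_shift R3_eqs gen; by exists c.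
  by exists 0 => gen; case: ngen.
exists (fun u1 u2 u3 v3 => projT1 (cid (exc u1 u2 u3 v3))) => u1 u2 u3 v3.
exact: projT2 (cid (exc u1 u2 u3 v3)).
Qed.
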